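(* Let $\mathcal V=V[h^{-1},h]$ be a vertex operator algebra with a formal parameter, let $\mathcal F=\bigoplus_{i=0}^{3}\mathcal F_i$ be the associated rescaled complex of light modes (identified, by setting $h=1$, with the complex of light modes $\mathcal F^{+}_{\mathcal L_0}(1)$ of the VOA $V$), and let $\mu_0,\{\cdot,\cdot\}_0,m_0,n_0$ be the leading coefficients in $h$ of the Lian–Zuckerman operations on $\mathcal F$. Then $\mathcal F$ with the operations $\mu_0,\ m_0,\ \{\cdot,\cdot\}_0,\ n_0$ and the differentials $Q$ and $h^{-1}b_0$ satisfies the relations of a homotopy BV algebra.
   Context: **VOA with a formal parameter.** $V=\bigoplus_{n\ge 0}V^n$ is a graded complex vector space, $\mathcal V^n=V^n[h^{-1},h]$, and $\mathcal V=\bigoplus_{n\ge0}\mathcal V^n$ carries a VOA structure whose space of conformal weight $n$ is $\mathcal V^n$. A state $A$ has vertex operator $A(z)=\sum_n A_nz^{-n-1}$; the Virasoro field is $L(z)=\sum_n L_nz^{-n-2}$. Assumed: (i) all modes $A_n$ commute with $\mathbb C[h,h^{-1}]$; (ii) $A_nB\in hV[h]$ for $A,B\in V$, $n\ge0$; (iii) $L_{-1}V\subset V$; (iv) $L_1A\in hV$ for $A\in V^1$. $V[h]$ is a vertex algebra (closed under all products). Setting $h=1$ gives a VOA structure on $V$. **Ghosts and BRST operator.** $\Lambda$ is the Fock module of the super Heisenberg algebra $\{b_n,c_m\}=\delta_{n+m,0}$ with vacuum $\mathbf 1$, $c_k\mathbf 1=0$ for $k\ge2$, $b_k\mathbf 1=0$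 for $k\ge-1$; $b(z)=\sum b_mz^{-m-2}$, $c(z)=\sum c_nz^{-n+1}$ are primary of weights $2$ and $-1$ for the standard Virasoro field $L^\Lambda$. The ghost number $|a|$ counts $c$ with $+1$ and $b$ with $-1$. On $\mathcal V\otimes\Lambda$ put $\mathcal L(z)=L(z)+L^\Lambda(z)$, $Q=\mathrm{Res}_z\big(c(z)L(z)+{:}c\,\partial c\,b{:}(z)+\tfrac32\partial^2c(z)\big)$. Light modes: states annihilated by $\mathcal L_0$. $\mathcal F^+_{\mathcal L_0}$ is the space of light modes in $V[h]\otimes\Lambda$, and $\mathcal F^+_{\mathcal L_0}(1)$ is the same object with $h=1$. **The complex $\mathcal F$.** Writing states via their operators, $\mathcal F_0=V^0$, $\mathcal F_1=cV^1\oplus h\,\partial c\,V^0$, $\mathcal F_2=h\,c\,\partial c\,V^1\oplus h\,c\,\partial^2c\,V^0$, $\mathcal F_3=h^2c\,\partial c\,\partial^2c\,V^0$. It is preserved by $Q$ and $h^{-1}b_0$. **Lian–Zuckerman operations.** $\mu(a_1,a_2)=\mathrm{Res}_z\frac{a_1(z)a_2}{z}$, $\{a_1,a_2\}=(-1)^{|a_1|}\mathrm{Res}_z(b_{-1}a_1)(z)a_2$, $m(a_1,a_2)=\sum_{i\ge0}\frac{(-1)^i}{i+1}\mathrm{Res}_w\mathrm{Res}_{z-w}(z-w)^iw^{-i-1}b_{-1}(a_1(z-w)a_2)(w)\mathbf 1$, $n(a_1,a_2,a_3)=\sum_{i\ge0}\frac1{i+1}\mathrm{Res}_z\mathrm{Res}_w\,w^iz^{-i-1}(b_{-1}a_1)(z)a_2(w)a_3+(-1)^{|a_1||a_2|}\sum_{i\ge0}\frac1{i+1}\mathrm{Res}_w\mathrm{Res}_z\,z^iw^{-i-1}(b_{-1}a_2)(w)a_1(z)a_3$.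 On $\mathcal F$: $\mu$ maps $\mathcal F_i\otimes\mathcal F_j\to\mathcal F_{i+j}[h]$, $m$ maps to $\mathcal F_{i+j-1}[h]$, $n$ maps $\mathcal F_i\otimes\mathcal F_j\otimes\mathcal F_k\to\mathcal F_{i+j+k-1}[h]$, and $\{\mathcal F_i,\mathcal F_j\}\subset h\mathcal F_{i+j-1}[h]$. One defines $\mu_0,m_0,n_0,\{\cdot,\cdot\}_0$ by $\mu=\mu_0+O(h)$, $m=m_0+O(h)$, $n=n_0+O(h)$, $\{\cdot,\cdot\}=h\{\cdot,\cdot\}_0+O(h^2)$. **Homotopy BV algebra.** A graded space with differentials $Q$ (degree $1$), $\beta$ (degree $-1$) and operations $\mu$ (degree 0), $\{\cdot,\cdot\}$ (degree $-1$), $m,n$ (degree $-1$) satisfies the relations of a homotopy BV algebra if there are a bilinear $m'$ and a trilinear $n'$ (degree $-2$) such that: 1. $Q\mu(a_1,a_2)=\mu(Qa_1,a_2)+(-1)^{|a_1|}\mu(a_1,Qa_2)$; 2. $\mu(a_1,a_2)-(-1)^{|a_1||a_2|}\mu(a_2,a_1)=Qm(a_1,a_2)+m(Qa_1,a_2)+(-1)^{|a_1|}m(a_1,Qa_2)$; 3. $Qn(a_1,a_2,a_3)+n(Qa_1,a_2,a_3)+(-1)^{|a_1|}n(a_1,Qa_2,a_3)+(-1)^{|a_1|+|a_2|}n(a_1,a_2,Qa_3)=\mu(\mu(a_1,a_2),a_3)-\mu(a_1,\mu(a_2,a_3))$; 4. $(-1)^{|a_1|}\{a_1,a_2\}=\beta\mu(a_1,a_2)-\mu(\beta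 a_1,a_2)-(-1)^{|a_1|}\mu(a_1,\beta a_2)$; 5. $\{a_1,a_2\}+(-1)^{(|a_1|-1)(|a_2|-1)}\{a_2,a_1\}=(-1)^{|a_1|-1}\big(Qm'(a_1,a_2)-m'(Qa_1,a_2)-(-1)^{|a_1|}m'(a_1,Qa_2)\big)$; 6. $\{a_1,\mu(a_2,a_3)\}=\mu(\{a_1,a_2\},a_3)+(-1)^{(|a_1|-1)|a_2|}\mu(a_2,\{a_1,a_3\})$; 7. $\{\mu(a_1,a_2),a_3\}-\mu(a_1,\{a_2,a_3\})-(-1)^{(|a_3|-1)|a_2|}\mu(\{a_1,a_3\},a_2)=(-1)^{|a_1|+|a_2|-1}\big(Qn'(a_1,a_2,a_3)-n'(Qa_1,a_2,a_3)-(-1)^{|a_1|}n'(a_1,Qa_2,a_3)-(-1)^{|a_1|+|a_2|}n'(a_1,a_2,Qa_3)\big)$; 8. $\{\{a_1,a_2\},a_3\}-\{a_1,\{a_2,a_3\}\}+(-1)^{(|a_1|-1)(|a_2|-1)}\{a_2,\{a_1,a_3\}\}=0$. In the theorem $\beta=h^{-1}b_0$. *)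

(* Defs.v *)
From HB Require Import structures.
From mathcomp Require Import all_boot all_order all_algebra.
From mathcomp Require Import boolp classical_sets functions cardinality fsbigop.
From mathcomp Require Import reals.
From mathcomp Require Import complex.

Set Implicit Arguments.
Unset Strict Implicit.
Unset Printing Implicit Defensive.

Import Order.TTheory GRing.Theory Num.Theory.

Local Open Scope classical_set_scope.
Local Open Scope ring_scope.

Definition subspace (K : fieldType) (M : lmodType K) (S : set M) : Prop :=
  S 0 /\ forall (k : K) x y, S x -> S y -> S (k *: x + y).

Definition bilin (K : fieldType) (M N P : lmodType K) (f : M -> N -> P) : Prop :=
  (forall y, linear (fun x => f x y)) /\ (forall x, linear (f x)).

(* V is the internal direct sum of the V^n, n >= 0. *)
Definition direct_grading (K : fieldType) (V : lmodType K) (Vn : nat -> set V) :=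
  [/\ forall n, subspace (Vn n),
      forall v, exists N (f : nat -> V),
        (forall n, Vn n (f n)) /\ v = \sum_(n < N) f n
    & forall N (f : nat -> V), (forall n, Vn n (f n)) ->
        \sum_(n < N) f n = 0 -> forall n, (n < N)%N -> f n = 0].

(* A tensor product of M and N, given by its universal property. *)
Record tensor_product (K : fieldType) (M N : lmodType K) := TensorProduct {
  tspace :> lmodType K;
  tens : M -> N -> tspace;
  tlift : forall P : lmodType K, (M -> N -> P) -> tspace -> P;
  tens_bilin : bilin tens;
  tlift_linear : forall (P : lmodType K) (f : M -> N -> P),
    bilin f -> linear (tlift f);
  tliftE : forall (P : lmodType K) (f : M -> N -> P),
    bilin f -> forall x y, tlift f (tens x y) = f x y;
  tlift_unique : forall (P : lmodType K) (g1 g2 : tspace -> P),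
    linear g1 -> linear g2 ->
    (forall x y, g1 (tens x y) = g2 (tens x y)) -> forall t, g1 t = g2 t
}.

Section Laurent.
Variables (K : fieldType) (V : lmodType K).

Definition lfinite : {pred int -> V} :=
  fun f => `[< finite_set [set i | f i != 0] >].

Lemma lfinite_submod_closed : submod_closed lfinite.
Proof.
split=> [|k f g /asboolP fin_f /asboolP fin_g]; apply/asboolP.
  by rewrite (_ : [set _ | _] = set0) // -subset0 => i /=; rewrite eqxx.
apply: (@sub_finite_set _ _ ([set i | f i != 0] `|` [set i | g i != 0])).
  move=> i /= nz; apply/orP; move: nz; apply: contraNT.
  rewrite negb_or !negbK => /andP[/eqP fi0 /eqP gi0].
  by rewrite [X in X == _](_ : _ = k *: f i + g i) // fi0 gi0 scaler0 addr0.
by rewrite finite_setU.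
Qed.

HB.instance Definition _ :=
  GRing.isSubmodClosed.Build K (int -> V) lfinite lfinite_submod_closed.

(* The element x stands for \sum_i (lcoef x i) h^i. *)
Record laurent := Laurent { lcoef :> int -> V; _ : lcoef \in lfinite }.

HB.instance Definition _ := [isSub for lcoef].
HB.instance Definition _ := [Choice of laurent by <:].
HB.instance Definition _ := [SubChoice_isSubLmodule of laurent by <:].

Lemma lmono_subproof (k : int) (v : V) :
  (fun i => if i == k then v else 0) \in lfinite.
Proof.
apply/asboolP; apply: (@sub_finite_set _ _ [set k]); last exact: finite_set1.
by move=> i /=; case: (i =P k) => // _ /eqP[].
Qed.

(* v h^k *)
Definition lmono (k : int) (v : V) : laurent := Laurent (lmono_subproof k v).

Lemma hmul_subproof (k : int) (x : laurent) : (fun i => x (i - k)) \in lfinite.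
Proof.
case: x => f /= /asboolP fin_f; apply/asboolP.
apply: (@sub_finite_set _ _ ((fun i => i + k) @` [set i | f i != 0])).
  by move=> i /= nz; exists (i - k) => //; rewrite subrK.
exact: finite_image.
Qed.

(* multiplication by h^k *)
Definition hmul (k : int) (x : laurent) : laurent := Laurent (hmul_subproof k x).

(* h^m V[h] *)
Definition hpoly (m : int) : set laurent :=
  [set x | forall i : int, i < m -> x i = 0].

End Laurent.

(* the binomial coefficient m(m-1)...(m-j+1)/j! *)
Definition binz (K : fieldType) (m : int) (j : nat) : K :=
  (\prod_(i < j) (m - i%:Z)%:~R) / (j`!)%:R.

(* [nprod n a b] is a_(n) b, where a(z) = \sum_n a_(n) z^(-n-1); in other words
   Res_z z^n a(z) b = a_(n) b. *)
Record vsa (K : fieldType) (M : lmodType K) := VSA {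
  vpar : bool -> set M;
  vac : M;
  nprod : int -> M -> M -> M;
  vpar_subspace : forall p, subspace (vpar p);
  vpar_span : forall x, exists y z, [/\ vpar false y, vpar true z & x = y + z];
  vpar_direct : forall x, vpar false x -> vpar true x -> x = 0;
  nprod_bilin : forall n, bilin (nprod n);
  vac_even : vpar false vac;
  nprod_par : forall n p q a b,
    vpar p a -> vpar q b -> vpar (p (+) q) (nprod n a b);
  nprod_trunc : forall a b, exists N : int,
    forall n : int, N <= n -> nprod n a b = 0;
  vac_left : forall n a, nprod n vac a = if n == -1 then a else 0;
  vac_right : forall a, nprod (-1) a vac = a;
  vac_right0 : forall (n : int) a, 0 <= n -> nprod n a vac = 0;
  borcherds : forall p q a b c, vpar p a -> vpar q b -> forall m n k : int,
    \sum_(j \in [set: nat])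
      binz K m j *: nprod (m + k - j%:Z) (nprod (n + j%:Z) a b) c =
    \sum_(j \in [set: nat])
      ((-1) ^+ j * binz K n j) *:
        (nprod (m + n - j%:Z) a (nprod (k + j%:Z) b c)
         - ((-1) ^+ (p && q) * (-1) ^ n) *:
             nprod (n + k - j%:Z) b (nprod (m + j%:Z) a c))
}.

(* the translation operator *)
Definition vT (K : fieldType) (M : lmodType K) (Y : vsa M) (a : M) : M :=
  nprod Y (-2) a (vac Y).

(* The tensor product of vertex superalgebras, (A (x) a)(z) = A(z) (x) a(z), with
   the usual Koszul sign. *)
Record tensor_vsa (K : fieldType) (M N : lmodType K) (YM : vsa M) (YN : vsa N) :=
  TensorVSA {
  tv_space :> tensor_product M N;
  tv_vsa : vsa tv_space;
  tv_vac : vac tv_vsa = tens tv_space (vac YM) (vac YN);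
  tv_par : forall p q A a, vpar YM p A -> vpar YN q a ->
    vpar tv_vsa (p (+) q) (tens tv_space A a);
  tv_nprod : forall p q A B a b n, vpar YN p a -> vpar YM q B ->
    nprod tv_vsa n (tens tv_space A a) (tens tv_space B b) =
    (-1) ^+ (p && q) *:
      \sum_(i \in [set: int])
        tens tv_space (nprod YM i A B) (nprod YN (n - 1 - i) a b)
}.

Record voa_formal (K : fieldType) (V : lmodType K) (Vn : nat -> set V) :=
  VOAFormal {
  vf_vsa :> vsa (laurent V);
  vf_omega : laurent V;
  vf_charge : K;
  vf_grading : direct_grading Vn;
  vf_even : forall x, vpar vf_vsa false x;
  (* L(z) = \sum_n L_n z^(-n-2), so that L_n is the mode omega_(n+1). *)
  vf_vir : forall (m n : int) x,
    let L k := nprod vf_vsa (k + 1) vf_omega in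
    L m (L n x) - L n (L m x) =
      (m - n)%:~R *: L (m + n) x
      + (if m + n == 0 then vf_charge * (m ^+ 3 - m)%:~R / 12%:R else 0) *: x;
  vf_trans : forall x, nprod vf_vsa 0 vf_omega x = vT vf_vsa x;
  vf_weight : forall (n : nat) x,
    nprod vf_vsa 1 vf_omega x = n%:R *: x <-> (forall i, Vn n (x i));
  vf_hmul : forall n k A B,
    nprod vf_vsa n A (hmul k B) = hmul k (nprod vf_vsa n A B);
  vf_h : forall (n : int) (A B : V), 0 <= n ->
    hpoly 1 (nprod vf_vsa n (lmono 0 A) (lmono 0 B));
  vf_Lm1 : forall A : V, exists B : V,
    nprod vf_vsa 0 vf_omega (lmono 0 A) = lmono 0 B;
  vf_L1 : forall A : V, Vn 1%N A -> exists B : V,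
    nprod vf_vsa 2 vf_omega (lmono 0 A) = lmono 1 B;
  vf_vac_poly : hpoly 0 (vac vf_vsa);
  vf_poly : forall n A B, hpoly 0 A -> hpoly 0 B ->
    hpoly 0 (nprod vf_vsa n A B)
}.

(* The Fock module Lambda with the vertex superalgebra structure for which b(z)
   and c(z) are the vertex operators of the states b = b_(-2) 1 and c = c_1 1.
   With b(z) = \sum_m b_m z^(-m-2) and c(z) = \sum_n c_n z^(-n+1), b_m is the mode
   b_(m+1) and c_n the mode c_(n-2); hence the conditions b_m 1 = 0 for m >= -1
   and c_n 1 = 0 for n >= 2 are instances of [vac_right0].  A module over these
   anticommutation relations that is generated by such a nonzero vector 1 is the
   Fock module. *)
Record ghost_vsa (K : fieldType) (L : lmodType K) := GhostVSA {
  gh_vsa :> vsa L;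
  gh_b : L;
  gh_c : L;
  gh_bm := fun m : int => nprod gh_vsa (m + 1) gh_b;
  gh_cm := fun n : int => nprod gh_vsa (n - 2) gh_c;
  gh_b_odd : vpar gh_vsa true gh_b;
  gh_c_odd : vpar gh_vsa true gh_c;
  gh_bc : forall (m n : int) x,
    gh_bm m (gh_cm n x) + gh_cm n (gh_bm m x) = if m + n == 0 then x else 0;
  gh_bb : forall (m n : int) x, gh_bm m (gh_bm n x) + gh_bm n (gh_bm m x) = 0;
  gh_cc : forall (m n : int) x, gh_cm m (gh_cm n x) + gh_cm n (gh_cm m x) = 0;
  gh_vac_neq0 : vac gh_vsa <> 0;
  gh_cyclic : forall S : set L, subspace S -> S (vac gh_vsa) ->
    (forall m x, S x -> S (gh_bm m x) /\ S (gh_cm m x)) -> forall x, S x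
}.

Section LianZuckerman.
Variables (K : fieldType) (V : lmodType K) (Vn : nat -> set V).
Variables (Y : voa_formal Vn) (L : lmodType K) (G : ghost_vsa L).
Variable W : tensor_vsa Y G.

Local Notation "A ⊗ a" := (tens W A a) (at level 40).
Local Notation YW := (tv_vsa W).

(* :a b: for states of Lambda *)
Local Notation nop a b := (nprod G (-1) a b).

Definition gc : L := gh_c G.
Definition gdc : L := vT G gc.
Definition gddc : L := vT G gdc.
Definition gcdc : L := nop gc gdc.
Definition gcddc : L := nop gc gddc.
Definition gcdcddc : L := nop gc (nop gdc gddc).

(* multiplication by h^k on the tensor product *)
Definition hW (k : int) : W -> W := tlift (fun A a => hmul k A ⊗ a).

(* the BRST current c L + :c dc b: + 3/2 ddc *)
Definition brst_current : W :=
  vf_omega Y ⊗ gc + vac Y ⊗ nop gc (nop gdc (gh_b G))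
  + (3%:R / 2%:R) *: (vac Y ⊗ gddc).

Definition Q (x : W) : W := nprod YW 0 brst_current x.

(* b_m as an operator on the tensor product *)
Definition bW (m : int) (x : W) : W := nprod YW (m + 1) (vac Y ⊗ gh_b G) x.

Definition beta (x : W) : W := hW (-1) (bW 0 x).

(* F_i; the index is the ghost number, and F_i = 0 unless 0 <= i <= 3. *)
Definition F (i : int) : set W :=
  match i with
  | Posz 0%N => [set x | exists2 u, Vn 0%N u & x = lmono 0 u ⊗ vac G]
  | Posz 1%N => [set x | exists A u,
      [/\ Vn 1%N A, Vn 0%N u & x = lmono 0 A ⊗ gc + lmono 1 u ⊗ gdc]]
  | Posz 2%N => [set x | exists A u,
      [/\ Vn 1%N A, Vn 0%N u & x = lmono 1 A ⊗ gcdc + lmono 1 u ⊗ gcddc]]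
  | Posz 3%N => [set x | exists2 u, Vn 0%N u & x = lmono 2 u ⊗ gcdcddc]
  | _ => [set 0]
  end.

(* h^k F_i[h] *)
Definition Fh (k : nat) (i : int) : set W :=
  [set x | exists N (f : nat -> W), (forall j, F i (f j)) /\
     x = \sum_(j < N) hW (k + j)%N%:Z (f j)].

(* In the operations below the integers d, d1, d2 are the degrees |a|, |a1|, |a2|
   of the arguments. *)

Definition mu (a1 a2 : W) : W := nprod YW (-1) a1 a2.

Definition brk (d1 : int) (a1 a2 : W) : W :=
  (-1) ^ d1 *: nprod YW 0 (bW (-1) a1) a2.

Definition mop (a1 a2 : W) : W :=
  \sum_(i \in [set: nat]) ((-1) ^+ i / i.+1%:R) *:
    nprod YW (- i%:Z - 1) (bW (-1) (nprod YW i%:Z a1 a2)) (vac YW).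

Definition nop3 (d1 d2 : int) (a1 a2 a3 : W) : W :=
  \sum_(i \in [set: nat]) i.+1%:R^-1 *:
    nprod YW (- i%:Z - 1) (bW (-1) a1) (nprod YW i%:Z a2 a3)
  + (-1) ^ (d1 * d2) *:
    \sum_(i \in [set: nat]) i.+1%:R^-1 *:
      nprod YW (- i%:Z - 1) (bW (-1) a2) (nprod YW i%:Z a1 a3).

(* The coefficient f in F_i of h^k in an element x = h^k f + O(h^(k+1)) of
   h^k F_i[h]. *)
Definition lead (k : nat) (i : int) (x : W) : W :=
  xget 0 [set f | F i f /\ Fh k.+1 i (x - hW k%:Z f)].

(* components F_i x F_j -> F_(i+j+d) of the leading parts *)
Definition mu0 (i j : int) (a1 a2 : W) : W := lead 0 (i + j) (mu a1 a2).
Definition brk0 (i j : int) (a1 a2 : W) : W := lead 1 (i + j - 1) (brk i a1 a2).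
Definition m0 (i j : int) (a1 a2 : W) : W := lead 0 (i + j - 1) (mop a1 a2).
Definition n0 (i j k : int) (a1 a2 a3 : W) : W :=
  lead 0 (i + j + k - 1) (nop3 i j a1 a2 a3).

(* The leading parts of the operations exist and are unique on F. *)
Definition leading_parts_defined : Prop :=
  [/\ forall k i f, F i f -> Fh k.+1 i (hW k%:Z f) -> f = 0,
      forall i j a1 a2, F i a1 -> F j a2 -> Fh 0 (i + j) (mu a1 a2),
      forall i j a1 a2, F i a1 -> F j a2 -> Fh 1 (i + j - 1) (brk i a1 a2),
      forall i j a1 a2, F i a1 -> F j a2 -> Fh 0 (i + j - 1) (mop a1 a2)
    & forall i j k a1 a2 a3, F i a1 -> F j a2 -> F k a3 ->
        Fh 0 (i + j + k - 1) (nop3 i j a1 a2 a3)].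

End LianZuckerman.

Arguments Q {K V Vn Y L G} W x.
Arguments beta {K V Vn Y L G} W x.
Arguments F {K V Vn Y L G} W i.
Arguments mu0 {K V Vn Y L G} W i j a1 a2.
Arguments brk0 {K V Vn Y L G} W i j a1 a2.
Arguments m0 {K V Vn Y L G} W i j a1 a2.
Arguments n0 {K V Vn Y L G} W i j k a1 a2 a3.
Arguments leading_parts_defined {K V Vn Y L G} W.

Section HomotopyBV.
Variables (K : fieldType) (E : lmodType K).

(* A graded space is given as a family of subspaces E_i of an ambient space, and a
   graded operation by its components: mu i j is only used on E_i x E_j. *)
Variable gr : int -> set E.

Definition graded_map1 (d : int) (f : E -> E) : Prop :=
  forall i, (forall a, gr i a -> gr (i + d) (f a)) /\
    (forall (k : K) a a', gr i a -> gr i a' -> f (k *: a + a') = k *: f a + f a').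

Definition graded_map2 (d : int) (f : int -> int -> E -> E -> E) : Prop :=
  forall i j,
  [/\ forall a b, gr i a -> gr j b -> gr (i + j + d) (f i j a b),
      forall (k : K) a a' b, gr i a -> gr i a' -> gr j b ->
        f i j (k *: a + a') b = k *: f i j a b + f i j a' b
    & forall (k : K) a b b', gr i a -> gr j b -> gr j b' ->
        f i j a (k *: b + b') = k *: f i j a b + f i j a b'].

Definition graded_map3 (d : int) (f : int -> int -> int -> E -> E -> E -> E) :
    Prop :=
  forall i j l,
  [/\ forall a b c, gr i a -> gr j b -> gr l c ->
        gr (i + j + l + d) (f i j l a b c),
      forall (k : K) a a' b c, gr i a -> gr i a' -> gr j b -> gr l c ->
        f i j l (k *: a + a') b c = k *: f i j l a b c + f i j l a' b c,
      forall (k : K) a b b' c, gr i a -> gr j b -> gr j b' -> gr l c ->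
        f i j l a (k *: b + b') c = k *: f i j l a b c + f i j l a b' c
    & forall (k : K) a b c c', gr i a -> gr j b -> gr l c -> gr l c' ->
        f i j l a b (k *: c + c') = k *: f i j l a b c + f i j l a b c'].

Definition differential (d : int) (f : E -> E) : Prop :=
  graded_map1 d f /\ forall i a, gr i a -> f (f a) = 0.

Local Notation sg d := ((-1 : K) ^ (d : int)).

Definition homotopy_BV (Q beta : E -> E) (mu br m : int -> int -> E -> E -> E)
    (n : int -> int -> int -> E -> E -> E -> E) : Prop :=
  (forall i, subspace (gr i)) /\
  [/\ differential 1 Q, differential (-1) beta &
  [/\ graded_map2 0 mu, graded_map2 (-1) br, graded_map2 (-1) m
    & graded_map3 (-1) n]] /\
  exists (m' : int -> int -> E -> E -> E)
         (n' : int -> int -> int -> E -> E -> E -> E),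
  [/\ graded_map2 (-2) m', graded_map3 (-2) n' &
  forall (i j k : int) (a1 a2 a3 : E), gr i a1 -> gr j a2 -> gr k a3 ->
  [/\ [/\
  Q (mu i j a1 a2) = mu (i + 1) j (Q a1) a2 + sg i *: mu i (j + 1) a1 (Q a2),
  mu i j a1 a2 - sg (i * j) *: mu j i a2 a1 =
    Q (m i j a1 a2) + m (i + 1) j (Q a1) a2 + sg i *: m i (j + 1) a1 (Q a2),
  Q (n i j k a1 a2 a3) + n (i + 1) j k (Q a1) a2 a3
    + sg i *: n i (j + 1) k a1 (Q a2) a3
    + sg (i + j) *: n i j (k + 1) a1 a2 (Q a3) =
  mu (i + j) k (mu i j a1 a2) a3 - mu i (j + k) a1 (mu j k a2 a3)
  & sg i *: br i j a1 a2 =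
    beta (mu i j a1 a2) - mu (i - 1) j (beta a1) a2
    - sg i *: mu i (j - 1) a1 (beta a2)],
  br i j a1 a2 + sg ((i - 1) * (j - 1)) *: br j i a2 a1 =
    sg (i - 1) *: (Q (m' i j a1 a2) - m' (i + 1) j (Q a1) a2
                   - sg i *: m' i (j + 1) a1 (Q a2)),
  br i (j + k) a1 (mu j k a2 a3) =
    mu (i + j - 1) k (br i j a1 a2) a3
    + sg ((i - 1) * j) *: mu j (i + k - 1) a2 (br i k a1 a3),
  br (i + j) k (mu i j a1 a2) a3 - mu i (j + k - 1) a1 (br j k a2 a3)
    - sg ((k - 1) * j) *: mu (i + k - 1) j (br i k a1 a3) a2 =
  sg (i + j - 1) *: (Q (n' i j k a1 a2 a3) - n' (i + 1) j k (Q a1) a2 a3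
                     - sg i *: n' i (j + 1) k a1 (Q a2) a3
                     - sg (i + j) *: n' i j (k + 1) a1 a2 (Q a3))
  & br (i + j - 1) k (br i j a1 a2) a3 - br i (j + k - 1) a1 (br j k a2 a3)
    + sg ((i - 1) * (j - 1)) *: br j (i + k - 1) a2 (br i k a1 a3) = 0]].

End HomotopyBV.

(* Main.v *)
(** On V[h] (x) Lambda the operations of Lian and Zuckerman satisfy the relations
    1-4, 6 and 8 as formal consequences of the Borcherds identity, of
    Q b_(-1) + b_(-1) Q = T, and of the vanishing of all products a_(n) b, n >= 1, of
    light modes, which truncates m and n to their first terms.

    An element of h^k F_i[h] is a combination of the six ghost monomials 1, c, dc, c dc,
    c ddc and c dc ddc whose coefficients lie in prescribed powers of h.  The products of
    these monomials are computed in the supercommutative algebra generated by the modes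
    c_n, n <= 1, and each nonnegative product on V contributes a factor h; comparing both
    shows that the operations respect the powers of h, so the relations descend to the
    leading coefficients.  The anomaly of Q^2 involves only c_n with |n| >= 2 and does not
    act on F, whatever the central charge.

    Relations 5 and 7 then follow from the others: the bracket is the commutator of
    beta = b_0 / h with mu, and Q anticommutes with beta, so commuting beta with the
    homotopies m and n yields m' and, up to a term m(a_2, {a_1, a_3}), also n'. *)

Require Import Defs.
From HB Require Import structures.
From mathcomp Require Import all_boot all_order all_algebra.
From mathcomp Require Import boolp classical_sets functions cardinality fsbigop.
From mathcomp Require Import reals.
From mathcomp Require Import complex.
From mathcomp Require Import zify ring lra.

Set Implicit Arguments.
Unset Strict Implicit.
Unset Printing Implicit Defensive.

Import Order.TTheory GRing.Theory Num.Theory.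

Local Open Scope classical_set_scope.
Local Open Scope ring_scope.

(** * Linear identities by reflection *)

(** Conformal weight drives the truncations: a product of index n of two light modes has weight -n -
    1, while V has no negative weights and a monomial in c and its derivatives has weight at least
    -1. Hence nothing survives for n >= 1, and for n = 0 only c and c dc, with coefficients of
    weight 0.

    The powers of h follow one count: a ghost monomial carries one h for each differentiated factor.
    So b_(-1), which removes c, leaves the exponent alone; b_0, which removes dc, frees the power of
    h that beta divides out; and c_(-1) L_1 spends on ddc the power that L_1 supplies.

    Leading coefficients are unique only if the light ghost monomials are linearly independent. The
    Fock module is given by its relations and a nonzero cyclic vector, without a basis, so
    independence is obtained by stripping factors with modes of b and applying a functional that is
    nonzero on the vacuum.

    The correction in n' arises because beta applied to the associator yields mu(a_2, {a_1, a_3}),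
    whereas relation 7 asks for mu({a_1, a_3}, a_2). *)

Section LinearIdentities.
Variables (K : nzRingType) (M : lmodType K).

(** Reified linear combinations: an identity in a module reduces to [ring] goals on coefficients,
    which is how the sign-laden relations below are closed. *)
Inductive lexp :=
  | LVar of nat | LZero | LAdd of lexp & lexp | LOpp of lexp | LScale of K & lexp.

Fixpoint leval (env : seq M) (e : lexp) : M :=
  match e with
  | LVar n => nth 0 env n
  | LZero => 0
  | LAdd e1 e2 => leval env e1 + leval env e2
  | LOpp e1 => - leval env e1
  | LScale k e1 => k *: leval env e1
  end.

Fixpoint lcoeff (e : lexp) (n : nat) : K :=
  match e with
  | LVar m => if m == n then 1 else 0
  | LZero => 0
  | LAdd e1 e2 => lcoeff e1 n + lcoeff e2 n
  | LOpp e1 => - lcoeff e1 n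
  | LScale k e1 => k * lcoeff e1 n
  end.

Lemma leval_sum env e : leval env e = \sum_(n < size env) lcoeff e n *: nth 0 env n.
Proof.
elim: e => [m||e1 IH1 e2 IH2|e IHe|k e IHe] /=.
- have [mN|Nm] := ltnP m (size env).
    rewrite (bigD1 (Ordinal mN)) //= eqxx scale1r big1 ?addr0 // => n.
    by rewrite -val_eqE eq_sym /= => /negPf->; rewrite scale0r.
  rewrite nth_default // big1 // => n _; rewrite ifF ?scale0r //.
  by apply/negP => /eqP mn; have := ltn_ord n; rewrite -mn ltnNge Nm.
- by rewrite big1 // => n _; rewrite scale0r.
- by rewrite IH1 IH2 -big_split; apply: eq_bigr => n _; rewrite scalerDl.
- by rewrite IHe -sumrN; apply: eq_bigr => n _; rewrite scaleNr.
- by rewrite IHe scaler_sumr; apply: eq_bigr => n _; rewrite scalerA.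
Qed.

(** A conjunction by recursion instead of a bounded quantifier: it computes to one coefficient
    equation per atom. *)
Fixpoint lcoeff_eq (e1 e2 : lexp) (n : nat) : Prop :=
  match n with
  | 0 => True
  | n'.+1 => lcoeff e1 n' = lcoeff e2 n' /\ lcoeff_eq e1 e2 n'
  end.

Lemma leval_eq env e1 e2 : lcoeff_eq e1 e2 (size env) -> leval env e1 = leval env e2.
Proof.
move=> E; rewrite !leval_sum; apply: eq_bigr => n _; congr (_ *: _).
case: n => n /=; elim: (size env) E => //= N IHN [E EN].
by rewrite ltnS leq_eqVlt => /orP[/eqP->//|]; apply: IHN.
Qed.

End LinearIdentities.

Ltac lin_mem x l := lazymatch l with
  | nil => constr:(false) | cons x _ => constr:(true) | cons _ ?l' => lin_mem x l' end.
Ltac lin_index x l := lazymatch l with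
  | cons x _ => constr:(0%N) | cons _ ?l' => let n := lin_index x l' in constr:(S n) end.
Ltac lin_atoms l t := lazymatch t with
  | @GRing.add _ ?x ?y => let l' := lin_atoms l x in lin_atoms l' y
  | @GRing.opp _ ?x => lin_atoms l x
  | @GRing.scale _ _ _ ?x => lin_atoms l x
  | @GRing.zero _ => l
  | _ => lazymatch lin_mem t l with true => l | false => constr:(cons t l) end
  end.
Ltac lin_reify K l t := lazymatch t with
  | @GRing.add _ ?x ?y =>
      let e1 := lin_reify K l x in let e2 := lin_reify K l y in constr:(@LAdd K e1 e2)
  | @GRing.opp _ ?x => let e := lin_reify K l x in constr:(@LOpp K e)
  | @GRing.scale _ _ ?k ?x => let e := lin_reify K l x in constr:(@LScale K k e)
  | @GRing.zero _ => constr:(@LZero K)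
  | _ => let n := lin_index t l in constr:(@LVar K n)
  end.
Ltac lin_identity K M :=
  lazymatch goal with |- ?x = ?y =>
    let l := lin_atoms (@nil M) x in
    let l := lin_atoms l y in
    let e1 := lin_reify K l x in
    let e2 := lin_reify K l y in
    apply: (@leval_eq K M l e1 e2); rewrite /=; repeat split; try ring
  end.

(** * Finitely supported sums and linear maps *)

(** Sums over all of [nat] are finitely supported sums, with value 0 when the support is infinite; a
    bound on the support turns them into sums that compute. *)
Lemma fsbig_ord_vanish (M : zmodType) (N : nat) (f : nat -> M) :
  (forall j, (N <= j)%N -> f j = 0) ->
  \sum_(j \in [set: nat]) f j = \sum_(j < N) f j.
Proof.
move=> f0; rewrite -(fsbig_widen `I_N [set: nat]) //; first by rewrite fsbig_ord.
by move=> j /= [_ /negP]; rewrite -leqNgt => /f0.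
Qed.

Lemma fsbig_seq_vanish (I : choiceType) (M : zmodType) (r : seq I) (f : I -> M) :
  uniq r -> (forall i, i \notin r -> f i = 0) ->
  \sum_(i \in [set: I]) f i = \sum_(i <- r) f i.
Proof.
move=> ur f0; rewrite [RHS]fsbig_seq // (fsbig_widen [set` r] [set: I]) //.
by move=> i /= [_ /negP]; apply: f0.
Qed.

Lemma subz0 (m : int) : m - 0%:Z = m. Proof. exact: subr0. Qed.
Lemma addz0 (m : int) : m + 0%:Z = m. Proof. exact: addr0. Qed.

Section Bilinear.
Variables (K : fieldType) (M N P : lmodType K) (f : M -> N -> P).
Hypothesis bf : bilin f.

Lemma bilinDl x y z : f (x + y) z = f x z + f y z.
Proof. by have := bf.1 z 1 x y; rewrite !scale1r. Qed.
Lemma bilinDr x y z : f x (y + z) = f x y + f x z.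
Proof. by have := bf.2 x 1 y z; rewrite !scale1r. Qed.
Lemma bilin0l z : f 0 z = 0.
Proof. by apply: (addrI (f 0 z)); rewrite -bilinDl !addr0. Qed.
Lemma bilin0r z : f z 0 = 0.
Proof. by apply: (addrI (f z 0)); rewrite -bilinDr !addr0. Qed.
Lemma bilinZl k x z : f (k *: x) z = k *: f x z.
Proof. by have := bf.1 z k x 0; rewrite bilin0l !addr0. Qed.
Lemma bilinZr k x z : f x (k *: z) = k *: f x z.
Proof. by have := bf.2 x k z 0; rewrite bilin0r !addr0. Qed.
Lemma bilinNl x z : f (- x) z = - f x z.
Proof. by rewrite -scaleN1r bilinZl scaleN1r. Qed.
Lemma bilinNr x z : f x (- z) = - f x z.
Proof. by rewrite -scaleN1r bilinZr scaleN1r. Qed.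
Lemma bilinBl x y z : f (x - y) z = f x z - f y z.
Proof. by rewrite bilinDl bilinNl. Qed.
Lemma bilinBr x y z : f x (y - z) = f x y - f x z.
Proof. by rewrite bilinDr bilinNr. Qed.
Lemma bilin_suml I (r : seq I) (Q : pred I) F z :
  f (\sum_(i <- r | Q i) F i) z = \sum_(i <- r | Q i) f (F i) z.
Proof. exact: (big_morph (f^~ z) (fun x y => bilinDl x y z) (bilin0l z)). Qed.
Lemma bilin_sumr I (r : seq I) (Q : pred I) F z :
  f z (\sum_(i <- r | Q i) F i) = \sum_(i <- r | Q i) f z (F i).
Proof. exact: (big_morph (f z) (bilinDr z) (bilin0r z)). Qed.
End Bilinear.

Section Linear.
Variables (K : fieldType) (M N : lmodType K) (f : M -> N).
Hypothesis lf : linear f.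
Lemma linD x y : f (x + y) = f x + f y.
Proof. by have := lf 1 x y; rewrite !scale1r. Qed.
Lemma lin0 : f 0 = 0.
Proof. by apply: (addrI (f 0)); rewrite -linD !addr0. Qed.
Lemma linZ k x : f (k *: x) = k *: f x.
Proof. by have := lf k x 0; rewrite lin0 !addr0. Qed.
Lemma linN x : f (- x) = - f x.
Proof. by rewrite -scaleN1r linZ scaleN1r. Qed.
Lemma linB x y : f (x - y) = f x - f y.
Proof. by rewrite linD linN. Qed.
Lemma lin_sum I (r : seq I) (Q : pred I) F :
  f (\sum_(i <- r | Q i) F i) = \sum_(i <- r | Q i) f (F i).
Proof. exact: (big_morph f linD lin0). Qed.
End Linear.

Section Subspace.
Variables (K : fieldType) (M : lmodType K) (S : set M).
Hypothesis sS : subspace S.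
Lemma subspaceD x y : S x -> S y -> S (x + y).
Proof. by move=> Sx Sy; rewrite -[x]scale1r; apply: sS.2. Qed.
Lemma subspaceZ k x : S x -> S (k *: x).
Proof. by move=> Sx; rewrite -[_ *: _]addr0; apply: sS.2 => //; exact: sS.1. Qed.
Lemma subspaceN x : S x -> S (- x).
Proof. by rewrite -scaleN1r; apply: subspaceZ. Qed.
Lemma subspaceB x y : S x -> S y -> S (x - y).
Proof. by move=> Sx Sy; apply: subspaceD => //; apply: subspaceN. Qed.
Lemma subspace_sum I (r : seq I) (Q : pred I) F :
  (forall i, Q i -> S (F i)) -> S (\sum_(i <- r | Q i) F i).
Proof. by move=> SF; elim/big_rec: _ => [|i x Qi Sx]; [exact: sS.1|apply: subspaceD; auto]. Qed.
End Subspace.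

(** * Binomial coefficients with integer upper index *)

Section Binomial.
Variable K : numFieldType.

Lemma binz0 m : binz K m 0 = 1.
Proof. by rewrite /binz big_ord0 fact0 divr1. Qed.

Lemma binz1 m : binz K m 1 = m%:~R.
Proof. by rewrite /binz big_ord1 subr0 factS fact0 divr1. Qed.

Lemma binzS m j : binz K m j.+1 = binz K m j * (m - j%:Z)%:~R / j.+1%:R.
Proof. by rewrite /binz big_ord_recr /= factS natrM invfM -!mulrA; congr (_ * _); ring. Qed.

Lemma binz_0S j : binz K 0 j.+1 = 0.
Proof. by elim: j => [|j IHj]; rewrite binzS ?IHj ?mul0r // binz0 subr0 mulr0z mulr0 mul0r. Qed.

Lemma binz_1SS j : binz K 1 j.+2 = 0.
Proof. by elim: j => [|j IHj]; rewrite binzS ?IHj ?mul0r // subrr mulr0 mul0r. Qed.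

Lemma binzN1 j : binz K (-1) j = (-1) ^+ j.
Proof.
elim: j => [|j IHj]; first by rewrite binz0.
rewrite binzS IHj exprS (_ : -1 - j%:Z = - j.+1%:Z :> int); last by lia.
by rewrite mulrNz -pmulrn mulN1r mulrN mulNr mulfK // pnatr_eq0.
Qed.

Lemma binzN2 j : binz K (-2) j = (-1) ^+ j * j.+1%:R.
Proof.
elim: j => [|j IHj]; first by rewrite binz0 mulr1.
rewrite binzS IHj exprS (_ : -2 - j%:Z = - j.+2%:Z :> int); last by lia.
rewrite mulrNz -pmulrn mulN1r mulrN !mulNr; congr (- _).
by rewrite mulrAC mulfK // pnatr_eq0.
Qed.
End Binomial.

(** * Vertex superalgebras *)

Section VertexAlgebra.
Variables (K : numFieldType) (M : lmodType K) (Y : vsa M).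
Local Notation "a ⟪ n ⟫ b" := (nprod Y n a b)
  (at level 40, n at level 99, b at next level, format "a  ⟪ n ⟫  b").
Local Notation T := (vT Y).
Let bY := nprod_bilin Y.

Lemma nprod_bound a b : exists N : int, 0 <= N /\ forall n, N <= n -> a ⟪n⟫ b = 0.
Proof.
have [N aN] := nprod_trunc Y a b; exists (Num.max N 0); split; first lia.
by move=> n Nn; apply: aN; lia.
Qed.

Lemma nprod_bound_nat a b (k : int) : exists N : nat,
  forall j, (N <= j)%N -> a ⟪k + j%:Z⟫ b = 0.
Proof.
have [N [_ aN]] := nprod_bound a b; exists `|N - k|%N => j Nj.
by apply: aN; lia.
Qed.

(** The Borcherds identity at [n = 0]: the factor [binz K 0 j] leaves only j = 0 on its right-hand
    side. *)
Lemma commutator p q a b c (m k : int) N : vpar Y p a -> vpar Y q b ->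
  (forall j, (N <= j)%N -> a ⟪j%:Z⟫ b = 0) ->
  a ⟪m⟫ (b ⟪k⟫ c) - (-1) ^+ (p && q) *: (b ⟪k⟫ (a ⟪m⟫ c)) =
  \sum_(j < N) binz K m j *: ((a ⟪j%:Z⟫ b) ⟪m + k - j%:Z⟫ c).
Proof.
move=> pa qb abN; have /= := borcherds c pa qb m 0 k.
rewrite (fsbig_ord_vanish (N := N)); last first.
  by move=> j /abN; rewrite add0r => ->; rewrite (bilin0l (bY _)) scaler0.
rewrite (fsbig_ord_vanish (N := 1)); last first.
  by case=> // j _; rewrite binz_0S mulr0 scale0r.
rewrite big_ord1 /= !subz0 binz0 expr0z !mulr1 scale1r add0r => <-.
by apply: eq_bigr => j _; rewrite add0r.
Qed.

(** The Borcherds identity at [m = 0], where the left-hand side reduces to its term j = 0; the bound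
    [N] only has to cover the right-hand side. *)
Lemma associator p q a b c (n k : int) N : vpar Y p a -> vpar Y q b ->
  (forall j, (N <= j)%N -> a ⟪j%:Z⟫ c = 0 /\ b ⟪k + j%:Z⟫ c = 0) ->
  (a ⟪n⟫ b) ⟪k⟫ c =
  \sum_(j < N) ((-1) ^+ j * binz K n j) *:
    (a ⟪n - j%:Z⟫ (b ⟪k + j%:Z⟫ c)
     - ((-1) ^+ (p && q) * (-1) ^ n) *: (b ⟪n + k - j%:Z⟫ (a ⟪j%:Z⟫ c))).
Proof.
move=> pa qb abN; have /= := borcherds c pa qb 0 n k.
rewrite (fsbig_ord_vanish (N := 1)); last first.
  by case=> // j _; rewrite binz_0S scale0r.
rewrite (fsbig_ord_vanish (N := N)); last first.
  move=> j /abN [aj bj]; rewrite !add0r aj bj.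
  by rewrite !(bilin0r (bY _)) scaler0 subr0 scaler0.
rewrite big_ord1 /= binz0 scale1r subz0 add0r addz0 => ->.
by apply: eq_bigr => j _; rewrite add0r.
Qed.

(** Binomials of upper index 0 vanish beyond j = 0, so a mode of index 0 is a superderivation of
    every product. This serves for Q, for b_(-1) and for the bracket with a fixed first argument. *)
Lemma zero_mode_derivation p q a b c k : vpar Y p a -> vpar Y q b ->
  a ⟪0⟫ (b ⟪k⟫ c) = (a ⟪0⟫ b) ⟪k⟫ c + (-1) ^+ (p && q) *: (b ⟪k⟫ (a ⟪0⟫ c)).
Proof.
move=> pa qb; have [N abN] := nprod_bound_nat a b 0.
apply/eqP; rewrite -subr_eq; apply/eqP.
rewrite (@commutator p q a b c 0 k N.+1 pa qb).
- rewrite big_ord_recl /= binz0 scale1r subz0 add0r big1 ?addr0 // => j _.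
  by rewrite /bump /= add1n binz_0S scale0r.
- by move=> j Nj; rewrite -(add0r j%:Z) abN // ltnW.
Qed.

(** At upper index 1 two binomials survive, so a mode of index 1 is a derivation only up to a
    product with [a ⟪0⟫ b]. This covers L_0, which yields the weight of a product, and b_0, which
    yields the bracket. *)
Lemma one_mode_commutator p q a b c k : vpar Y p a -> vpar Y q b ->
  a ⟪1⟫ (b ⟪k⟫ c) = (a ⟪0⟫ b) ⟪k + 1⟫ c + (a ⟪1⟫ b) ⟪k⟫ c
    + (-1) ^+ (p && q) *: (b ⟪k⟫ (a ⟪1⟫ c)).
Proof.
move=> pa qb; have [N abN] := nprod_bound_nat a b 0.
apply/eqP; rewrite -subr_eq; apply/eqP.
rewrite (@commutator p q a b c 1 k N.+2 pa qb).
- rewrite !big_ord_recl /= binz0 binz1 !scale1r subz0 addrA addrC.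
  rewrite big1 ?add0r; last by move=> j _; rewrite /bump /= add1n binz_1SS scale0r.
    by rewrite /bump /= addn0 [1 + k]addrC addrK.
- by move=> j Nj; rewrite -(add0r j%:Z) abN // ltnW // ltnW.
Qed.

(** The Borcherds identity speaks of homogeneous states; statements closed under linear combinations
    extend from these. *)
Lemma parity_ind (S : set M) : subspace S ->
  (forall p a, vpar Y p a -> S a) -> forall a, S a.
Proof.
move=> sS Sp a; have [y [z [py pz ->]]] := vpar_span Y a.
by apply: subspaceD => //; [exact: Sp py|exact: Sp pz].
Qed.

Lemma vT_linear : linear T.
Proof. exact: (bY _).1. Qed.

Lemma vT_vac : T (vac Y) = 0.
Proof. by rewrite /vT vac_left. Qed.

Lemma vpar_vT p a : vpar Y p a -> vpar Y p (T a).
Proof. by move=> pa; have := nprod_par (-2) pa (vac_even Y); rewrite addbF. Qed.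

Lemma subspace_eq (N : lmodType K) (f g : M -> N) : linear f -> linear g ->
  subspace [set a | f a = g a].
Proof.
move=> lf lg; split=> /= [|k x y]; first by rewrite !lin0.
by rewrite lf lg => -> ->.
Qed.

Lemma parity_eq (N : lmodType K) (f g : M -> N) : linear f -> linear g ->
  (forall p a, vpar Y p a -> f a = g a) -> f =1 g.
Proof. by move=> lf lg; apply: parity_ind; apply: subspace_eq. Qed.

(** The associator of [a ⟪-2⟫ vac] contains modes of the vacuum, of which only the one of index -1
    is nonzero, so at most one term survives. *)
Lemma vT_nprod a n b : (T a) ⟪n⟫ b = (- n)%:~R *: (a ⟪n - 1⟫ b).
Proof.
move: a; apply: (parity_eq (f := fun a => T a ⟪n⟫ b)
  (g := fun a => (- n)%:~R *: (a ⟪n - 1⟫ b))).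
- by move=> k x y; rewrite vT_linear (bY _).1.
- by move=> k x y; rewrite (bY _).1 scalerDr !scalerA mulrC.
move=> p a pa; have [N1 aN1] := nprod_bound_nat a b 0.
have [N2 bN2] : exists N2 : nat, forall j, (N2 <= j)%N -> n + j%:Z != -1 /\ n - 2 - j%:Z != -1.
  by exists `|n|%N.+2 => j Nj; split; lia.
pose N := (N1 + N2 + `|n|.+2)%N.
rewrite /vT (associator (N := N) _ pa (vac_even Y)); last first.
  move=> j Nj; rewrite -(add0r j%:Z) aN1 ?add0r; last by rewrite /N in Nj; lia.
  by rewrite vac_left (negPf (bN2 j _).1) //; rewrite /N in Nj; lia.
have coefE (j : nat) : (-1) ^+ j * binz K (-2) j = j.+1%:R.
  by rewrite binzN2 mulrA -expr2 sqrr_sign mul1r.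
have sg2 : (-1 : K) ^ (-2) = 1 by rewrite -exprnN sqrrN expr1n invr1.
rewrite andbF expr0 mul1r sg2.
under eq_bigr => j _ do rewrite coefE !vac_left scale1r.
(* The vacuum mode has index n + j in one half of the associator and n - 2 - j in the other. It
   equals -1 at j = |n| - 1, in the former half for n < 0 and in the latter for n > 0, and never for
   n = 0. *)
case: (ltrP n 0) => n0.
  have jN : (`|n|.-1 < N)%N by rewrite /N; lia.
  rewrite (bigD1 (Ordinal jN)) //= big1 ?addr0 => [|j neq].
    rewrite ifT; last by lia.
    rewrite ifF; last by lia.
    rewrite subr0 (_ : -2 - `|n|.-1%:Z = n - 1); last by lia.
    rewrite (_ : `|n|.-1.+1 = `|n|%N); last by lia.
    by rewrite pmulrn (_ : `|n|%N%:Z = - n) //; lia.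
  have neq' : (j : nat) != `|n|.-1 := neq.
  rewrite ifF; last by lia.
  rewrite ifF; last by lia.
  by rewrite (bilin0r (bY _)) subr0 scaler0.
have [nE0|nN0] := eqVneq n 0.
  rewrite [in RHS]nE0 oppr0 scale0r big1 // => j _.
  rewrite ifF; last by lia.
  rewrite ifF; last by lia.
  by rewrite (bilin0r (bY _)) subr0 scaler0.
have jN : (`|n|.-1 < N)%N by rewrite /N; lia.
rewrite (bigD1 (Ordinal jN)) //= big1 ?addr0 => [|j neq].
  rewrite ifF; last by lia.
  rewrite ifT; last by lia.
  rewrite (bilin0r (bY _)) sub0r scalerN -scaleNr.
  rewrite (_ : `|n|.-1%:Z = n - 1); last by lia.
  rewrite (_ : `|n|.-1.+1 = `|n|%N); last by lia.
  by rewrite pmulrn -mulrNz (_ : - `|n|%N%:Z = - n) //; lia.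
have neq' : (j : nat) != `|n|.-1 := neq.
rewrite ifF; last by lia.
rewrite ifF; last by lia.
by rewrite (bilin0r (bY _)) subr0 scaler0.
Qed.

(** In the associator of [(a ⟪n⟫ b) ⟪-2⟫ vac] the modes of [b] on the vacuum leave j = 0 and j = 1;
    the second term is -n times [a ⟪n - 1⟫ b], that is [(T a) ⟪n⟫ b]. *)
Lemma nprod_vT a n b : T (a ⟪n⟫ b) = (T a) ⟪n⟫ b + a ⟪n⟫ (T b).
Proof.
move: a; apply: (parity_eq (f := fun a => T (a ⟪n⟫ b))
  (g := fun a => T a ⟪n⟫ b + a ⟪n⟫ T b)).
- by move=> k x y; rewrite (bY _).1 vT_linear.
- by move=> k x y; rewrite vT_linear !(bY _).1 scalerDr addrACA.
move=> p a pa; move: b; apply: (parity_eq (f := fun b => T (a ⟪n⟫ b))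
  (g := fun b => T a ⟪n⟫ b + a ⟪n⟫ T b)).
- by move=> k x y; rewrite (bY _).2 vT_linear.
- by move=> k x y; rewrite vT_linear !(bY _).2 scalerDr addrACA.
move=> q b qb; rewrite {1}/vT (associator (N := 2) _ pa qb); last first.
  by case=> [|[|j]] // _; split; apply: vac_right0 => //; lia.
rewrite !big_ord_recl big_ord0 addr0 /= binz0 binz1 expr0 mul1r expr1 mulN1r.
rewrite !(vac_right0 Y a) // !(bilin0r (bY _)) scaler0 !subr0 scale1r.
by rewrite addr0 (_ : -2 + (bump 0 0)%:Z = -1 :> int) // vac_right vT_nprod addrC mulrNz scaleNr.
Qed.

End VertexAlgebra.

(** * Laurent polynomials and formal vertex operator algebras *)

Section LaurentTheory.
Variables (K : fieldType) (V : lmodType K).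
Implicit Types x y : laurent V.

Lemma laurentP x y : (forall i, x i = y i) -> x = y.
Proof. by move=> xy; apply/val_inj/funext. Qed.

Lemma lcoefP k x y i : (k *: x + y) i = k *: x i + y i.
Proof. by []. Qed.

Lemma lcoefD x y i : (x + y) i = x i + y i.
Proof. by []. Qed.

Lemma lcoef0 i : (0 : laurent V) i = 0.
Proof. by []. Qed.

Lemma lcoef_sum I (r : seq I) (P : pred I) (F : I -> laurent V) i :
  (\sum_(j <- r | P j) F j) i = \sum_(j <- r | P j) F j i.
Proof. exact: (big_morph (fun x : laurent V => x i)). Qed.

Lemma lmono_linear k : linear (lmono k : V -> laurent V).
Proof.
move=> c u v; apply: laurentP => i; rewrite lcoefP /=.
by case: ifP; rewrite ?scaler0 ?addr0.
Qed.

Lemma hmul_linear k : linear (hmul k : laurent V -> laurent V).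
Proof. by move=> c x y; apply: laurentP => i. Qed.

Lemma hmul_hmul k l x : hmul k (hmul l x) = hmul (k + l) x.
Proof. by apply: laurentP => i /=; congr (x _); lia. Qed.

Lemma hmul0 x : hmul 0 x = x.
Proof. by apply: laurentP => i /=; congr (x _); lia. Qed.

Lemma hmul_lmono k l (v : V) : hmul k (lmono l v) = lmono (k + l) v.
Proof.
by apply: laurentP => i /=; rewrite (_ : (i - k == l) = (i == k + l)) //; lia.
Qed.

Lemma lmonoE k (v : V) : lmono k v = hmul k (lmono 0 v).
Proof. by rewrite hmul_lmono addr0. Qed.

Lemma laurent_expand x : exists r : seq int,
  [/\ uniq r, forall i, i \notin r -> x i = 0 & x = \sum_(i <- r) lmono i (x i)].
Proof.
have /asboolP /finite_seqP[s sE] := valP x.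
have f0 i : i \notin undup s -> x i = 0.
  rewrite mem_undup; apply: contraNeq => xi0.
  by have : [set i | x i != 0] i by []; rewrite sE.
exists (undup s); split; rewrite ?undup_uniq //.
apply: laurentP => i; rewrite lcoef_sum /=.
have [ir|ir] := boolP (i \in undup s).
  rewrite (bigD1_seq i) ?undup_uniq //= eqxx big1 ?addr0 // => j ji.
  by rewrite eq_sym (negPf ji).
rewrite big_seq big1 ?f0 // => j jr; case: eqP => // ij.
by rewrite ij jr in ir.
Qed.

Lemma laurent_ind (S : set (laurent V)) : subspace S ->
  (forall k v, S (lmono k v)) -> forall x, S x.
Proof.
move=> sS Sm x; have [r [_ _ ->]] := laurent_expand x.
by apply: subspace_sum.
Qed.

(* [hgr k S] is h^k S[h]. *)
Definition hgr (k : int) (S : set V) : set (laurent V) :=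
  [set x | hpoly k x /\ forall i, S (x i)].

Lemma hgr_subspace k S : subspace S -> subspace (hgr k S).
Proof.
move=> sS; split; first by split=> // i; exact: sS.1.
move=> c x y [px Sx] [py Sy]; split=> i; last by rewrite lcoefP; apply: sS.2.
by move=> ik; rewrite lcoefP px // py // scaler0 addr0.
Qed.

Lemma hgr_le k l S x : l <= k -> hgr k S x -> hgr l S x.
Proof. by move=> lk [px Sx]; split=> // i il; apply: px; lia. Qed.

Lemma hgr_hmul k l S x : hgr k S x -> hgr (l + k) S (hmul l x).
Proof. by move=> [px Sx]; split=> i //= ik; apply: px; lia. Qed.

Lemma hgr_lmono k S v : S 0 -> S v -> hgr k S (lmono k v).
Proof. by move=> S0 Sv; split=> i /=; case: ifP => //; lia. Qed.

(** Valid for every larger number of terms, so that several coefficients can be expanded with one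
    common bound. *)
Lemma hgr_expand_ge (k : int) S x : hgr k S x -> exists N, forall M, (N <= M)%N ->
  x = \sum_(j < M) lmono (k + j%:Z) (x (k + j%:Z)).
Proof.
move=> [px _]; have [r [ur xr _]] := laurent_expand x.
have [N Nr] : exists N : nat, forall i, i \in r -> i < k + N%:Z.
  elim: r {ur xr} => [|a r [N IHN]]; first by exists 0%N.
  exists (N + `|a - k|.+1)%N => i; rewrite in_cons => /orP[/eqP->|/IHN]; lia.
exists N => M NM; apply: laurentP => i; rewrite lcoef_sum /=.
have [ik|ki] := ltrP i k.
  by rewrite px // big1 // => j _; case: eqP => //; lia.
have [iM|Mi] := ltrP i (k + M%:Z).
  have jM : (`|i - k| < M)%N by lia.
  rewrite (bigD1 (Ordinal jM)) //= big1 ?addr0; last first.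
    move=> j neq; case: eqP => // ij; case/eqP: neq; apply: val_inj => /=; lia.
  by rewrite (_ : k + `|i - k|%N%:Z = i) ?eqxx //; lia.
rewrite xr; last by apply/negP => /Nr; lia.
by rewrite big1 // => j _; case: eqP => // ij; have := ltn_ord j; lia.
Qed.

Lemma hgr_expand (k : int) S x : hgr k S x -> exists N,
  x = \sum_(j < N) lmono (k + j%:Z) (x (k + j%:Z)).
Proof. by move=> /hgr_expand_ge[N /(_ N (leqnn N)) xE]; exists N. Qed.

End LaurentTheory.

(** * Conformal weights and powers of h in a formal vertex operator algebra *)

Section FormalVOA.
Variables (K : numFieldType) (V : lmodType K) (Vn : nat -> set V).
Variable Y : voa_formal Vn.
Local Notation "a ⟪ n ⟫ b" := (nprod Y n a b)
  (at level 40, n at level 99, b at next level, format "a  ⟪ n ⟫  b").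
Local Notation om := (vf_omega Y).
Let bY := nprod_bilin Y.
Implicit Types A B u : laurent V.

Lemma Vn_subspace n : subspace (Vn n).
Proof. by case: (vf_grading Y). Qed.

Lemma nprod_hmulr n k A B : A ⟪n⟫ (hmul k B) = hmul k (A ⟪n⟫ B).
Proof. exact: vf_hmul. Qed.

(** Compatibility with h is assumed in the second argument; the first is reached through the state
    h^k 1. As L_(-1) commutes with h, this state is annihilated by T, and the formula for the modes
    of T a kills all its modes of index other than -1. *)
Lemma hmul_vac_mode (k n : int) A : n != -1 -> hmul k (vac Y) ⟪n⟫ A = 0.
Proof.
move=> nN1; have T0 : vT Y (hmul k (vac Y)) = 0.
  by rewrite -(vf_trans Y) nprod_hmulr (vac_right0 Y) // (lin0 (@hmul_linear _ _ k)).
have /eqP := vT_nprod Y (hmul k (vac Y)) (n + 1) A.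
rewrite T0 (bilin0l (bY _)) eq_sym addrK scaler_eq0 intr_eq0.
by rewrite oppr_eq0 -[1]opprK subr_eq0 (negPf nN1) => /eqP.
Qed.

(** The nonnegative products of A with h^k 1 vanish, so their modes of index -1 commute; evaluate
    both orders on the vacuum. *)
Lemma hmul_vac_modeN1 k A : hmul k (vac Y) ⟪-1⟫ A = hmul k A.
Proof.
have [N AN] := nprod_bound_nat Y A (hmul k (vac Y)) 0.
have := @commutator _ _ Y false false A (hmul k (vac Y)) (vac Y) (-1) (-1) 0
  (vf_even Y _) (vf_even Y _).
rewrite big_ord0 scale1r !vac_right nprod_hmulr vac_right => E.
apply/esym/eqP; rewrite -subr_eq0; apply/eqP/E => j _.
by rewrite nprod_hmulr (vac_right0 Y) // (lin0 (@hmul_linear _ _ k)).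
Qed.

(* The Borcherds identity expands (A_(-1) e)_(n) for the state e = h^k 1, whose
   only nonzero mode is e_(-1) = h^k. *)
Lemma nprod_hmull n k A B : (hmul k A) ⟪n⟫ B = hmul k (A ⟪n⟫ B).
Proof.
rewrite -[in LHS](vac_right Y A) -nprod_hmulr.
have [N1 AN] := nprod_bound_nat Y A B 0.
pose N := (N1 + `|n|.+2)%N.
rewrite (@associator _ _ Y false false _ _ _ _ _ N (vf_even Y _) (vf_even Y _)); last first.
  move=> j Nj; rewrite -(add0r j%:Z) AN ?add0r; last by rewrite /N in Nj; lia.
  by rewrite hmul_vac_mode //; rewrite /N in Nj; lia.
under eq_bigr => j _.
  rewrite binzN1 -exprMn mulN1r opprK expr1n scale1r mul1r.
  over.
rewrite (_ : (-1) ^ (-1) = -1 :> K); last by rewrite -exprnN expr1 invrN invr1.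
have [n0|n0] := ltrP n 0.
  have jN : (`|n|.-1 < N)%N by rewrite /N; lia.
  rewrite (bigD1 (Ordinal jN)) //= big1 ?addr0; last first.
    move=> j neq; have {}neq : (j : nat) != `|n|.-1 := neq.
    rewrite !hmul_vac_mode ?(bilin0r (bY _)) ?scaler0 ?subr0 //; lia.
  rewrite (_ : n + `|n|.-1%:Z = -1); last by lia.
  rewrite (_ : -1 - `|n|.-1%:Z = n); last by lia.
  rewrite hmul_vac_modeN1 (hmul_vac_mode _ (n := -1 + n - _)); last by lia.
  by rewrite scaler0 subr0 nprod_hmulr.
have jN : (`|n| < N)%N by rewrite /N; lia.
rewrite (bigD1 (Ordinal jN)) //= big1 ?addr0; last first.
  move=> j neq; have {}neq : (j : nat) != `|n|%N := neq.
  rewrite !hmul_vac_mode ?(bilin0r (bY _)) ?scaler0 ?subr0 //; lia.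
rewrite hmul_vac_mode ?(bilin0r (bY _)); last by lia.
rewrite (_ : -1 + n - `|n|%N%:Z = -1); last by lia.
rewrite (_ : `|n|%N%:Z = n); last by lia.
by rewrite hmul_vac_modeN1 sub0r scaleN1r opprK.
Qed.

(** The conformal state is L_(-2) 1, and [L_0, L_(-2)] = 2 L_(-2) has no central term. *)
Lemma omega_weight : forall i, Vn 2 (om i).
Proof.
apply/(vf_weight Y 2); have /= := vf_vir Y 0 (-2) (vac Y).
rewrite (_ : -2 + 1 = -1 :> int) // vac_right (vac_right0 Y (n := 0 + 1)) //.
rewrite (bilin0r (bY _)) subr0.
by rewrite scale0r addr0 (_ : 0 - -2 = 2 :> int).
Qed.

Lemma weight_nprod a b n A B : (forall i, Vn a (A i)) -> (forall i, Vn b (B i)) ->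
  om ⟪1⟫ (A ⟪n⟫ B) = (a%:Z + b%:Z - n - 1)%:~R *: (A ⟪n⟫ B).
Proof.
move=> /(vf_weight Y) A1 /(vf_weight Y) B1.
rewrite (@one_mode_commutator _ _ Y false false) ?A1 ?B1; try exact: vf_even.
rewrite (vf_trans Y) vT_nprod addrK scale1r (bilinZl (bY _)) (bilinZr (bY _)).
rewrite -!scalerDl; congr (_ *: _); rewrite !pmulrn -!intrD; congr (_%:~R); lia.
Qed.

Lemma weight_decompose (x : laurent V) : exists N (f : nat -> laurent V),
  (forall n i, Vn n (f n i)) /\ x = \sum_(n < N) f n.
Proof.
move: x; apply: laurent_ind.
  split=> [|k x y [N [f [fV ->]]] [M [g [gV ->]]]].
    by exists 0%N, (fun=> 0); split=> [n i|]; [exact: (Vn_subspace n).1|rewrite big_ord0].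
  exists (N + M)%N, (fun n => (if (n < N)%N then k *: f n else 0) + (if (n < M)%N then g n else 0)).
  split=> [n i|].
    rewrite lcoefD; apply: subspaceD; first exact: Vn_subspace.
      case: ifP => _; last exact: (Vn_subspace n).1.
      by apply: subspaceZ; [exact: Vn_subspace|exact: fV].
    by case: ifP => _ //; exact: (Vn_subspace n).1.
  rewrite big_split /= -!big_mkcond /= scaler_sumr; congr (_ + _).
    by rewrite (big_ord_widen_cond _ xpredT (fun n => k *: f n) (leq_addr M N)).
  by rewrite (big_ord_widen_cond _ xpredT g (leq_addl N M)).
move=> k v; have [_ /(_ v)[N [f [fV ->]]] _] := vf_grading Y.
exists N, (fun n => lmono k (f n)); split=> [n i /=|].
  by case: ifP => // _; exact: (Vn_subspace n).1.
exact: (lin_sum (@lmono_linear _ _ k)).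
Qed.

(** Split x into components of weights n >= 0: directness of the grading makes n - r times each
    component vanish, and n - r > 0. *)
Lemma weight_neg (r : int) x : r < 0 -> om ⟪1⟫ x = r%:~R *: x -> x = 0.
Proof.
move=> r0; have [N [f [fV ->]]] := weight_decompose x.
rewrite (bilin_sumr (bY _)) scaler_sumr => /eqP; rewrite -subr_eq0 -sumrB => /eqP E.
apply: big1 => n _; apply: laurentP => i; rewrite lcoef0.
have [_ _ /(_ N (fun n => (n%:R - r%:~R) *: f n i))] := vf_grading Y.
move=> /(_ _ _ n (ltn_ord n)) H.
have /eqP : (n%:R - r%:~R) *: f n i = 0.
  apply: H => [m|]; first by apply: subspaceZ => //; exact: Vn_subspace.
  have := congr1 (fun x : laurent V => x i) E; rewrite lcoef_sum lcoef0 => {2}<-.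
  by apply: eq_bigr => m _; rewrite ((vf_weight Y m (f m)).2 (fV m)) -scalerBl.
rewrite scaler_eq0 pmulrn -intrB intr_eq0 => /orP[|/eqP//]; lia.
Qed.

Lemma nprod_weight_neg a b n A B : (forall i, Vn a (A i)) -> (forall i, Vn b (B i)) ->
  a%:Z + b%:Z <= n -> A ⟪n⟫ B = 0.
Proof.
move=> Aa Bb abn; apply: (@weight_neg (a%:Z + b%:Z - n - 1)); first lia.
exact: weight_nprod.
Qed.

Lemma nprod_weight a b c n A B : (forall i, Vn a (A i)) -> (forall i, Vn b (B i)) ->
  a%:Z + b%:Z - n - 1 = c%:Z -> forall i, Vn c ((A ⟪n⟫ B) i).
Proof.
move=> Aa Bb abc; apply/(vf_weight Y); rewrite (weight_nprod _ Aa Bb) abc.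
by rewrite -pmulrn.
Qed.

Lemma hpoly_nprod n k l A B : hpoly k A -> hpoly l B -> hpoly (k + l) (A ⟪n⟫ B).
Proof.
move=> kA lB i ikl.
have E k' (X : laurent V) : X = hmul k' (hmul (- k') X).
  by rewrite hmul_hmul subrr hmul0.
rewrite (E k A) (E l B) nprod_hmull nprod_hmulr hmul_hmul /=.
apply: (@vf_poly _ _ _ Y) => [j|j|] /=; [move=> j0; apply: kA| move=> j0; apply: lB|]; lia.
Qed.

(** The axiom [vf_h] concerns states of V; expansion in powers of h carries it to Laurent
    polynomials. The extra power of h later pays for the derivatives of ghosts that a product
    creates. *)
Lemma hpoly_nprod_pos n k l A B : 0 <= n -> hpoly k A -> hpoly l B ->
  hpoly (k + l + 1) (A ⟪n⟫ B).
Proof.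
move=> n0 kA lB.
have [N ->] : exists N, A = \sum_(j < N) lmono (k + j%:Z) (A (k + j%:Z)).
  by apply: (hgr_expand (S := setT)).
have [M ->] : exists M, B = \sum_(j < M) lmono (l + j%:Z) (B (l + j%:Z)).
  by apply: (hgr_expand (S := setT)).
rewrite (bilin_suml (bY _)) => i ikl; rewrite lcoef_sum big1 // => j _.
rewrite (bilin_sumr (bY _)) lcoef_sum big1 // => m _.
rewrite (lmonoE (k + _)) (lmonoE (l + _)) nprod_hmull nprod_hmulr hmul_hmul /=.
apply: (vf_h Y) => //; lia.
Qed.

Lemma hgr_nprod a b c n k l A B : hgr k (Vn a) A -> hgr l (Vn b) B ->
  a%:Z + b%:Z - n - 1 = c%:Z -> hgr (k + l) (Vn c) (A ⟪n⟫ B).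
Proof.
move=> [kA aA] [lB bB] abc; split; first exact: hpoly_nprod.
exact: (nprod_weight aA bB).
Qed.

Lemma hgr_nprod_pos a b c n k l A B : 0 <= n -> hgr k (Vn a) A -> hgr l (Vn b) B ->
  a%:Z + b%:Z - n - 1 = c%:Z -> hgr (k + l + 1) (Vn c) (A ⟪n⟫ B).
Proof.
move=> n0 [kA aA] [lB bB] abc; split; first exact: hpoly_nprod_pos.
exact: (nprod_weight aA bB).
Qed.

Lemma hgr_Lm1 k u : hgr k (Vn 0) u -> hgr k (Vn 1) (om ⟪0⟫ u).
Proof.
move=> uk; have [N uE] := hgr_expand uk.
split; last by apply: (nprod_weight omega_weight uk.2).
rewrite uE (bilin_sumr (bY _)) => i ik; rewrite lcoef_sum big1 // => j _.
rewrite lmonoE nprod_hmulr.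
have [B ->] := vf_Lm1 Y (u (k + j%:Z)).
by rewrite /= ifF //; lia.
Qed.

Lemma hgr_L1 k A : hgr k (Vn 1) A -> hgr (k + 1) (Vn 0) (om ⟪2⟫ A).
Proof.
move=> Ak; have [N AE] := hgr_expand Ak.
split; last by apply: (nprod_weight omega_weight Ak.2).
rewrite AE (bilin_sumr (bY _)) => i ik; rewrite lcoef_sum big1 // => j _.
rewrite lmonoE nprod_hmulr.
have [B ->] := vf_L1 Y (Ak.2 (k + j%:Z)).
by rewrite /= ifF //; lia.
Qed.

(** [L_1, L_(-1)] = 2 L_0 vanishes on weight 0, and its central term contains m^3 - m, which is 0 at
    m = 1. This makes Q^2 vanish on 1 and on dc. *)
Lemma L1_Lm1 u : (forall i, Vn 0 (u i)) -> om ⟪2⟫ (om ⟪0⟫ u) = 0.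
Proof.
move=> uV; have /= := vf_vir Y 1 (-1) u.
rewrite (nprod_weight_neg (n := 1 + 1) omega_weight uV) // (bilin0r (bY _)) subr0 => ->.
rewrite (_ : 1 - 1 + 1 = 1 :> int) // ((vf_weight Y 0 u).2 uV) scale0r scaler0.
by rewrite subrr mulr0 mul0r scale0r addr0.
Qed.

End FormalVOA.

(** * The ghost system *)

(** By Zorn's lemma: a maximal set closed under linear combinations and avoiding [v] is a complement
    of the line through [v]. *)
Lemma linear_functional_exists (K : fieldType) (M : lmodType K) (v : M) :
  v <> 0 -> exists phi : M -> K, [/\ forall k x y, phi (k *: x + y) = k * phi x + phi y
    & phi v = 1].
Proof.
(* Membership of 0 is left out of [P] because the union of the empty chain is empty and must satisfy
   [P]. *)
move=> v0; pose P (S : set M) :=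
  (forall (k : K) x y, S x -> S y -> S (k *: x + y)) /\ ~ S v.
have [|A [[Alin Av] Amax]] := @Zorn_bigcup M P.
  move=> F FP Ftot; split=> [k x y [X FX Xx] [Z FZ Zy]|[X FX Xv]].
    have [XZ|ZX] := Ftot _ _ FX FZ.
      by exists Z => //; apply: (FP _ FZ).1 => //; apply: XZ.
    by exists X => //; apply: (FP _ FX).1 => //; apply: ZX.
  exact: (FP _ FX).2.
have Alin0 (k : K) x : A 0 -> A x -> A (k *: x).
  by move=> A0 Ax; rewrite -[_ *: _]addr0; apply: Alin.
have A0 : A 0.
  apply: contrapT => nA0.
  have Ae x : ~ A x.
    move=> Ax; apply: nA0; have := Alin (-1) x x Ax Ax.
    by rewrite scaleN1r addNr.
  apply: (Amax [set 0]); last first.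
    by split=> [k x y -> ->|/v0//]; rewrite scaler0 addr0.
  by split=> [x /Ae//|/(_ 0 erefl)].
(* The value at x is the unique k with x - k v in A: were there none, A + K x would be larger and
   still avoid [v]. *)
have dec x : exists k, A (x - k *: v).
  have [Ax|nAx] := pselect (A x); first by exists 0; rewrite scale0r subr0.
  have [/(Amax _)|] := pselect (A `<` [set a + k *: x | a in A & k in [set: K]]).
    move=> nP; apply: contrapT => nk; apply: nP; split.
      move=> k y z [a Aa [l _ <-]] [b Ab [m _ <-]].
      exists (k *: a + b); first exact: Alin.
      by exists (k * l + m) => //; rewrite scalerDl scalerDr scalerA addrACA.
    move=> [a Aa [k _ E]]; apply: nk; exists k^-1.
    have k0 : k != 0.
      by apply/eqP => k0; apply: Av; rewrite -E k0 scale0r addr0.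
    rewrite -E scalerDr scalerA mulVf // scale1r opprD addrCA subrr addr0 -scaleNr.
    exact: Alin0.
  case; split=> [y Ay|AS]; first by exists y => //; exists 0 => //; rewrite scale0r addr0.
  by apply: nAx; apply: AS; exists 0 => //; exists 1 => //; rewrite scale1r add0r.
have uniq x k l : A (x - k *: v) -> A (x - l *: v) -> k = l.
  move=> Ak Al; apply/eqP; rewrite -subr_eq0; apply: contrapT => /negP kl; apply: Av.
  have := Alin (-1) _ _ Ak Al.
  rewrite scaleN1r opprB addrA subrK -scalerBl => /(Alin0 (k - l)^-1 _ A0).
  by rewrite scalerA mulVf // scale1r.
exists (fun x => projT1 (cid (dec x))); split=> [k x y|].
  case: cid => kxy /= Akxy; case: cid => kx /= Akx; case: cid => ky /= Aky.
  apply: (uniq _ _ _ Akxy); have := Alin k _ _ Akx Aky.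
  by rewrite scalerBr scalerA addrACA -opprD -scalerDl.
case: cid => k /= Ak; apply: (uniq _ _ _ Ak); by rewrite scale1r subrr.
Qed.

Section Ghosts.
Variables (K : numFieldType) (L : lmodType K) (G : ghost_vsa L).
Local Notation "a ⟪ n ⟫ b" := (nprod G n a b)
  (at level 40, n at level 99, b at next level, format "a  ⟪ n ⟫  b").
Local Notation c := (gh_c G).
Local Notation b := (gh_b G).
Local Notation v := (vac G).
Local Notation T := (vT G).
Let bG := nprod_bilin G.

(* The creation mode c_(1-k). *)
Definition cmode (k : nat) (x : L) : L := c ⟪- k%:Z - 1⟫ x.
Local Notation D := cmode.

(** An entry k stands for the k-th derivative of c divided by k!, of weight k - 1; this
    normalisation is the origin of the factors 2 in the formulas for ddc. *)
Definition cmon (s : seq nat) : L := foldr D v s.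

Lemma cmode_linear k : linear (D k).
Proof. exact: (bG _).2. Qed.

Lemma c_anticomm m n x : c ⟪m⟫ (c ⟪n⟫ x) = - (c ⟪n⟫ (c ⟪m⟫ x)).
Proof.
have := gh_cc G (m + 2) (n + 2) x; rewrite /gh_cm !addrK => /eqP.
by rewrite addr_eq0 => /eqP.
Qed.

Lemma b_anticomm m n x : b ⟪m⟫ (b ⟪n⟫ x) = - (b ⟪n⟫ (b ⟪m⟫ x)).
Proof.
have := gh_bb G (m - 1) (n - 1) x; rewrite /gh_bm !subrK => /eqP.
by rewrite addr_eq0 => /eqP.
Qed.

Lemma bc_anticomm m n x :
  b ⟪m⟫ (c ⟪n⟫ x) = (if m + n == -1 then x else 0) - c ⟪n⟫ (b ⟪m⟫ x).
Proof.
have := gh_bc G (m - 1) (n + 2) x; rewrite /gh_bm /gh_cm subrK addrK.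
rewrite (_ : (m - 1 + (n + 2) == 0) = (m + n == -1)); last by lia.
by move=> <-; rewrite addrK.
Qed.

Lemma eq_oppr0 (x : L) : x = - x -> x = 0.
Proof.
move=> /eqP; rewrite -subr_eq0 opprK -mulr2n -scaler_nat scaler_eq0 pnatr_eq0 /=.
by move=> /eqP.
Qed.

Lemma cmode_sq i x : D i (D i x) = 0.
Proof. exact/eq_oppr0/c_anticomm. Qed.

Lemma cmode_anticomm i j x : D i (D j x) = - D j (D i x).
Proof. exact: c_anticomm. Qed.

Lemma bmode_cmode m k x : b ⟪m⟫ (D k x) = (if m == k%:Z then x else 0) - D k (b ⟪m⟫ x).
Proof.
by rewrite /cmode bc_anticomm (_ : (m + (- k%:Z - 1) == -1) = (m == k)) //; lia.
Qed.

Lemma bmode_vac (m : int) : 0 <= m -> b ⟪m⟫ v = 0.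
Proof. exact: vac_right0. Qed.

(* States annihilated by the modes c_n with n >= 2. *)
Definition cpure (x : L) := forall n : int, 0 <= n -> c ⟪n⟫ x = 0.

Lemma cpure_cmon s : cpure (cmon s).
Proof.
move=> n n0; elim: s => [|i s IHs] /=; first exact: vac_right0.
by rewrite [LHS]c_anticomm IHs (bilin0r (bG _)) oppr0.
Qed.

Lemma cmon_par s : vpar G (odd (size s)) (cmon s).
Proof.
elim: s => [|i s IHs] /=; first exact: vac_even.
exact: (nprod_par _ (gh_c_odd G) IHs).
Qed.

(** The annihilation modes of c kill [y], so half of the associator drops out and a product of ghost
    monomials becomes a recursion on the left one that involves creation modes only. *)
Lemma c_cmon_nprod i s (k : int) y N : cpure y ->
  (forall j : nat, (N <= j)%N -> cmon s ⟪k + j%:Z⟫ y = 0) ->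
  cmon (i :: s) ⟪k⟫ y = \sum_(j < N) ((-1) ^+ j * binz K (- i%:Z - 1) j) *:
     D (i + j) (cmon s ⟪k + j%:Z⟫ y).
Proof.
move=> cy sN; rewrite /= (associator (N := N) _ (gh_c_odd G) (cmon_par s)).
  apply: eq_bigr => j _; rewrite cy // (bilin0r (bG _)) scaler0 subr0.
  congr (_ *: _); rewrite /cmode; congr (nprod _ _ _ _); lia.
by move=> j Nj; rewrite cy // sN.
Qed.

Lemma cmon_nprod_ge0 s (k : int) y : cpure y -> 0 <= k -> cmon s ⟪k⟫ y = 0.
Proof.
move=> cy; elim: s k => [|i s IHs] k k0; first by rewrite vac_left ifF //; lia.
rewrite (@c_cmon_nprod i s _ y 0 cy) ?big_ord0 // => j _; rewrite IHs //; lia.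
Qed.

(** Light modes call for ghost products of index -1, -2 and -3. The coefficients here and in the
    next two statements are (-1)^j binom(-i - 1, j) = binom(i + j, j). *)
Lemma cmon_nprodN1 i s y : cpure y ->
  cmon (i :: s) ⟪-1⟫ y = D i (cmon s ⟪-1⟫ y).
Proof.
move=> cy; rewrite (@c_cmon_nprod i s _ y 1 cy) // => [|j j1].
  by rewrite big_ord1 binz0 !expr0 mulr1 scale1r /= addn0 addz0.
by rewrite cmon_nprod_ge0 //; lia.
Qed.

Lemma cmon_nprodN2 i s y : cpure y ->
  cmon (i :: s) ⟪-2⟫ y = D i (cmon s ⟪-2⟫ y) + i.+1%:R *: D i.+1 (cmon s ⟪-1⟫ y).
Proof.
move=> cy; rewrite (@c_cmon_nprod i s _ y 2 cy) // => [|j j1].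
  rewrite !big_ord_recl big_ord0 binz0 binz1 !expr0 mulr1 scale1r /= addn0 addz0 addr0.
  rewrite /bump /= addn0 addn1 expr1 mulN1r -mulrNz; congr (_ + _ *: _).
  by rewrite opprB opprK -intS -pmulrn.
by rewrite cmon_nprod_ge0 //; lia.
Qed.

Lemma cmon_nprodN3 i s y : cpure y ->
  cmon (i :: s) ⟪-3⟫ y = D i (cmon s ⟪-3⟫ y) + i.+1%:R *: D i.+1 (cmon s ⟪-2⟫ y)
    + (i.+1 * i.+2)%:R / 2 *: D i.+2 (cmon s ⟪-1⟫ y).
Proof.
move=> cy; rewrite (@c_cmon_nprod i s _ y 3 cy) // => [|j j1].
  rewrite !big_ord_recl big_ord0 binz0 binz1 !expr0 mulr1 scale1r /= addn0 addz0 addr0.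
  rewrite /bump /= addn0 addn1 addn2 expr1 mulN1r -mulrNz addrA; congr (_ + _ *: _ + _ *: _).
    by rewrite opprB opprK -intS -pmulrn.
  rewrite sqrrN expr1n mul1r (binzS _ _ 1) binz1 -intrM.
  by rewrite (_ : _ * _ = (i.+1 * i.+2)%N%:Z) //; nia.
by rewrite cmon_nprod_ge0 //; lia.
Qed.

Lemma cmode_vT k y : T (D k y) = D k (T y) + k.+1%:R *: D k.+1 y.
Proof.
rewrite nprod_vT vT_nprod addrC; congr (_ + _ *: nprod _ _ _ _); last by lia.
by rewrite opprB opprK -intS -pmulrn.
Qed.

Lemma gcE : gc G = cmon [:: 0%N].
Proof. by rewrite /= /cmode vac_right. Qed.

Lemma gdcE : gdc G = cmon [:: 1%N].
Proof. by []. Qed.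

Lemma gddcE : gddc G = 2 *: cmon [:: 2%N].
Proof.
by rewrite /gddc gdcE /= cmode_vT vT_vac (lin0 (cmode_linear _)) add0r.
Qed.

Lemma gcddcE : gcddc G = 2 *: cmon [:: 0; 2]%N.
Proof. by rewrite /gcddc gddcE (bilinZr (bG _)). Qed.

Lemma gcdcddcE : gcdcddc G = 2 *: cmon [:: 0; 1; 2]%N.
Proof.
rewrite /gcdcddc gddcE gdcE (bilinZr (bG _)) cmon_nprodN1; last exact: cpure_cmon.
by rewrite vac_left /= (bilinZr (bG _)).
Qed.

(** [X] is the cubic term of the BRST current and [Z] its image under b_(-1). [Z] differs from the
    ghost conformal field by a total derivative, so its mode of index 0 is the same. *)
Local Notation Z := (gdc G ⟪-1⟫ b).
Local Notation X := (gc G ⟪-1⟫ Z).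

Lemma gdc_odd : vpar G true (gdc G).
Proof. exact/vpar_vT/gh_c_odd. Qed.

Lemma Z_even : vpar G false Z.
Proof. exact: (nprod_par _ gdc_odd (gh_b_odd G)). Qed.

Lemma X_odd : vpar G true X.
Proof. exact: (nprod_par _ (gh_c_odd G) Z_even). Qed.

Lemma b_nprod_b (k : int) : 0 <= k -> b ⟪k⟫ b = 0.
Proof.
move=> k0; rewrite -{2}(vac_right G b) b_anticomm bmode_vac //.
by rewrite (bilin0r (bG _)) oppr0.
Qed.

Lemma b_nprod_c (k : int) : 0 <= k -> b ⟪k⟫ c = if k == 0 then v else 0.
Proof.
move=> k0; rewrite -{1}(vac_right G c) bc_anticomm bmode_vac //.
rewrite (bilin0r (bG _)) subr0 (_ : (k - 1 == -1) = (k == 0)) //; lia.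
Qed.

Lemma b_nprod_gdc : b ⟪0⟫ (gdc G) = 0.
Proof. by rewrite bc_anticomm bmode_vac // (bilin0r (bG _)) subr0. Qed.

Lemma c_nprod_b (k : int) : 0 <= k -> c ⟪k⟫ b = if k == 0 then v else 0.
Proof.
move=> k0; have := bc_anticomm (-1) k v; rewrite (vac_right0 G (n := k)) //.
rewrite (bilin0r (bG _)) vac_right (_ : (-1 + k == -1) = (k == 0)); last by lia.
by move=> /eqP; rewrite eq_sym subr_eq0 eq_sym => /eqP.
Qed.

Lemma Z_nprod_c (k : int) : 0 <= k -> Z ⟪k⟫ c = if k == 0 then gdc G else 0.
Proof.
move=> k0; rewrite (associator (N := 1) _ gdc_odd (gh_b_odd G)); last first.
  move=> j j1; split; first by rewrite gdcE -/(gc G) gcE cmon_nprod_ge0 //; exact: cpure_cmon.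
  by rewrite b_nprod_c ?ifF //; lia.
rewrite big_ord1 /= !subz0 expr0 mul1r binz0 scale1r.
rewrite [gdc G ⟪0⟫ _](_ : _ = 0); last first.
  by rewrite gdcE -/(gc G) gcE cmon_nprod_ge0 //; exact: cpure_cmon.
rewrite (bilin0r (bG _)) scaler0 subr0 b_nprod_c //.
by case: ifP; rewrite ?vac_right ?(bilin0r (bG _)).
Qed.

Lemma Z_nprod_b : Z ⟪0⟫ b = T b.
Proof.
(* The mode j of dc is -j times the mode j - 1 of c, and among the nonnegative modes of c only that
   of index 0 is nonzero on b. *)
have dcb j : gdc G ⟪j%:Z⟫ b = if j == 1%N then - v else 0.
  rewrite vT_nprod; case: j => [|j]; first by rewrite oppr0 scale0r.
  rewrite c_nprod_b; last by lia.
  by case: j => [|j] /=; rewrite ?scaleN1r ?scaler0.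
rewrite (associator (N := 2) _ gdc_odd (gh_b_odd G)); last first.
  by move=> j j1; rewrite add0r b_nprod_b // dcb ifF //; lia.
rewrite !big_ord_recl big_ord0 /= !dcb /= !(bilin0r (bG _)) !b_nprod_b //.
rewrite !(bilin0r (bG _)) scaler0 subr0 scaler0 add0r addr0 sub0r.
rewrite binz1 (bilinNr (bG _)) -[(-1) ^ (-1)]exprnN expr1 invrN invr1.
by rewrite !mulN1r opprK !scale1r opprK.
Qed.

(* The modes of b and c generate the Fock module, and both sides act on these
   modes as derivations. *)
Lemma Z_zero_mode x : Z ⟪0⟫ x = T x.
Proof.
have derZ q a n y : vpar G q a ->
    Z ⟪0⟫ (a ⟪n⟫ y) = (Z ⟪0⟫ a) ⟪n⟫ y + a ⟪n⟫ (Z ⟪0⟫ y).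
  by move=> qa; rewrite (zero_mode_derivation _ _ Z_even qa) scale1r.
apply: (gh_cyclic (g := G) (S := [set x | Z ⟪0⟫ x = T x])).
- by apply: subspace_eq; [exact: (bG _).2|exact: vT_linear].
- by rewrite /= (vac_right0 G) // vT_vac.
move=> m y /= IHy; split; rewrite /gh_bm /gh_cm.
  by rewrite (derZ _ _ _ _ (gh_b_odd G)) IHy Z_nprod_b -nprod_vT.
by rewrite (derZ _ _ _ _ (gh_c_odd G)) IHy Z_nprod_c // -nprod_vT.
Qed.

Lemma b_nprod_X : b ⟪0⟫ X = Z.
Proof.
rewrite (zero_mode_derivation _ _ (gh_b_odd G) (gh_c_odd G)) b_nprod_c //= vac_left.
rewrite (zero_mode_derivation _ _ (gh_b_odd G) gdc_odd) b_nprod_gdc b_nprod_b //.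
by rewrite (bilin0l (bG _)) !(bilin0r (bG _), scaler0, addr0).
Qed.

Lemma X_nprod_c : X ⟪0⟫ c = cmon [:: 0; 1]%N.
Proof.
rewrite (associator (N := 1) _ (gh_c_odd G) Z_even); last first.
  move=> j j1; rewrite add0r Z_nprod_c // -/(gc G) gcE cmon_nprod_ge0 // ?ifF //; first lia.
  exact: cpure_cmon.
rewrite big_ord1 /= subz0 expr0 mul1r binz0 scale1r.
rewrite [gc G ⟪0⟫ _](_ : _ = 0); last first.
  by rewrite -/(gc G) gcE cmon_nprod_ge0 //; exact: cpure_cmon.
by rewrite (bilin0r (bG _)) scaler0 subr0 Z_nprod_c.
Qed.

(** The anticommutator of the cubic charge with a mode of c is a mode of c dc; iterated down to the
    vacuum, this computes the charge on every monomial. *)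
Lemma X_cmode i y : X ⟪0⟫ (D i y) = cmon [:: 0; 1]%N ⟪- i%:Z - 1⟫ y - D i (X ⟪0⟫ y).
Proof. by rewrite (zero_mode_derivation _ _ X_odd (gh_c_odd G)) X_nprod_c scaleN1r. Qed.

Lemma X_vac : X ⟪0⟫ v = 0. Proof. exact: vac_right0. Qed.

End Ghosts.

(** * The tensor product and the BRST operator *)

Section Tensor.
Variables (K : numFieldType) (V : lmodType K) (Vn : nat -> set V).
Variables (Y : voa_formal Vn) (L : lmodType K) (G : ghost_vsa L).
Variable W : tensor_vsa Y G.

Local Notation "A ⊗ a" := (tens W A a) (at level 40).
Local Notation "x ⟪ n ⟫ y" := (nprod (tv_vsa W) n x y)
  (at level 45, n at level 99, y at next level, format "x  ⟪ n ⟫  y").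
Local Notation om := (vf_omega Y).
Local Notation cmon := (cmon G).
Local Notation cmode := (cmode G).
Local Notation hW_ := (hW (W := W)).
Local Notation bW_ := (Defs.bW (W := W)).
Let bG := nprod_bilin G.
Let bN := nprod_bilin (tv_vsa W).
Let bT := tens_bilin W.
Implicit Types A B : laurent V.

Lemma tens_eq (P : lmodType K) (f g : W -> P) : linear f -> linear g ->
  (forall A a, f (A ⊗ a) = g (A ⊗ a)) -> f =1 g.
Proof. exact: tlift_unique. Qed.

Lemma tens_par p A a : vpar G p a -> vpar (tv_vsa W) p (A ⊗ a).
Proof. by move=> pa; have := tv_par W (vf_even Y A) pa. Qed.

Let zrange (N : nat) : seq int := [seq j%:Z - N%:Z | j <- iota 0 (N + N)].

Let mem_zrange N (i : int) : (i \in zrange N) = (- N%:Z <= i < N%:Z).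
Proof.
apply/mapP/idP => [[j]|iN]; first by rewrite mem_iota => jN ->; lia.
by exists (absz (i + N%:Z)); rewrite ?mem_iota; lia.
Qed.

Let zrange_uniq N : uniq (zrange N).
Proof. by rewrite map_inj_uniq ?iota_uniq // => i j; lia. Qed.

(** [tv_nprod] asks for homogeneous ghosts. Explicit ranges, valid from some size on, let the
    formula pass to sums of an even and an odd ghost state; the states of V are even, so no sign
    appears. *)
Let tens_nprod_zrange n A B a b : exists N : nat, forall M : nat, (N <= M)%N ->
  A ⊗ a ⟪n⟫ B ⊗ b =
  \sum_(i <- zrange M) nprod Y i A B ⊗ nprod G (n - 1 - i) a b.
Proof.
move: a; apply: parity_ind (G) _ _ _.
  split=> [|k x y [N1 xE] [N2 yE]].
    exists 0%N => M _; rewrite (bilin0r bT) (bilin0l (bN _)) big1 // => i _.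
    by rewrite (bilin0l (bG _)) (bilin0r bT).
  exists (N1 + N2)%N => M NM; rewrite bT.2 (bN _).1 (xE M) ?(yE M); try lia.
  rewrite scaler_sumr -big_split; apply: eq_bigr => i _.
  by rewrite (bG _).1 bT.2.
move=> p a pa; have [N1 [N1_ge0 AB]] := nprod_bound Y A B.
have [N2 [N2_ge0 ab]] := nprod_bound G a b.
exists (`|N1| + `|N2| + `|n|.+1)%N => M NM.
rewrite (tv_nprod W _ _ _ pa (vf_even Y B)) andbF expr0 scale1r.
apply: fsbig_seq_vanish => // i; rewrite mem_zrange => iM.
have [i0|i0] := ltrP i 0.
  by rewrite ab ?(bilin0r bT) //; lia.
by rewrite AB ?(bilin0l bT) //; lia.
Qed.

Lemma tens_nprod n A B a b (r : seq int) : uniq r ->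
  (forall i, i \notin r -> nprod Y i A B = 0 \/ nprod G (n - 1 - i) a b = 0) ->
  A ⊗ a ⟪n⟫ B ⊗ b = \sum_(i <- r) nprod Y i A B ⊗ nprod G (n - 1 - i) a b.
Proof.
move=> ur r0; have [N NE] := tens_nprod_zrange n A B a b.
have {}r0 i : i \notin r -> nprod Y i A B ⊗ nprod G (n - 1 - i) a b = 0.
  by move=> /r0[->|->]; rewrite ?(bilin0l bT) ?(bilin0r bT).
have [M rM] : exists M : nat, forall i, i \in r -> - M%:Z <= i < M%:Z.
  elim: r {ur r0} => [|i r [M IHM]]; first by exists 0%N.
  exists (M + `|i|.+1)%N => j; rewrite in_cons => /orP[/eqP->|/IHM]; lia.
rewrite (NE (N + M)%N) ?leq_addr //; apply: etrans (fsbig_seq_vanish ur r0).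
apply/esym/fsbig_seq_vanish => [|i]; first exact: zrange_uniq.
 rewrite mem_zrange => iM; apply: r0; apply/negP => /rM; lia.
Qed.

Lemma tens_nprod_vacl n A a b : vac Y ⊗ a ⟪n⟫ A ⊗ b = A ⊗ nprod G n a b.
Proof.
rewrite (tens_nprod (r := [:: -1])) //; last first.
  by move=> i; rewrite inE vac_left => /negPf->; left.
by rewrite big_seq1 vac_left eqxx opprK subrK.
Qed.

Lemma tens_nprod_vacr n A B a : A ⊗ vac G ⟪n⟫ B ⊗ a = nprod Y n A B ⊗ a.
Proof.
rewrite (tens_nprod (r := [:: n])) //; last first.
  by move=> i; rewrite inE vac_left => ni; right; rewrite ifF //; lia.
by rewrite big_seq1 vac_left ifT //; lia.
Qed.

Let hW_bilin k : bilin (fun (A : laurent V) (a : L) => hmul k A ⊗ a).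
Proof.
by split=> [a|A] x y z /=; rewrite ?hmul_linear ?bT.1 ?bT.2.
Qed.

Lemma hW_linear k : linear (hW_ k).
Proof. exact: tlift_linear. Qed.

Lemma hW_tens k A a : hW_ k (A ⊗ a) = hmul k A ⊗ a.
Proof. exact: (tliftE _ (hW_bilin k)). Qed.

Lemma hW_hW k l x : hW_ k (hW_ l x) = hW_ (k + l) x.
Proof.
move: x; apply: (tens_eq (f := fun x => hW_ k (hW_ l x))) => [c x y||A a].
- by rewrite !hW_linear.
- exact: hW_linear.
by rewrite !hW_tens hmul_hmul.
Qed.

Lemma hW0 x : hW_ 0 x = x.
Proof.
by move: x; apply: (tens_eq (g := id)) => [||A a] //; [exact: hW_linear|rewrite hW_tens hmul0].
Qed.

Lemma nprod_hWl k n x y : hW_ k x ⟪n⟫ y = hW_ k (x ⟪n⟫ y).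
Proof.
move: x; apply: (tens_eq (f := fun x => hW_ k x ⟪n⟫ y)
  (g := fun x => hW_ k (x ⟪n⟫ y))) => [c x z|c x z|A a].
- by rewrite hW_linear (bN _).1.
- by rewrite (bN _).1 hW_linear.
move: y; apply: (tens_eq (f := fun y => hW_ k (A ⊗ a) ⟪n⟫ y)
  (g := fun y => hW_ k (A ⊗ a ⟪n⟫ y))) => [|c x z|B b].
- exact: (bN _).2.
- by rewrite (bN _).2 hW_linear.
rewrite hW_tens; have [N1 E1] := tens_nprod_zrange n (hmul k A) B a b.
have [N2 E2] := tens_nprod_zrange n A B a b.
rewrite (E1 (N1 + N2)%N) ?leq_addr // (E2 (N1 + N2)%N) ?leq_addl //.
rewrite (lin_sum (hW_linear k)); apply: eq_bigr => i _.
by rewrite hW_tens nprod_hmull.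
Qed.

Lemma nprod_hWr k n x y : x ⟪n⟫ hW_ k y = hW_ k (x ⟪n⟫ y).
Proof.
move: x; apply: (tens_eq (f := fun x => x ⟪n⟫ hW_ k y)
  (g := fun x => hW_ k (x ⟪n⟫ y))) => [|c x z|A a].
- exact: (bN _).1.
- by rewrite (bN _).1 hW_linear.
move: y; apply: (tens_eq (f := fun y => A ⊗ a ⟪n⟫ hW_ k y)
  (g := fun y => hW_ k (A ⊗ a ⟪n⟫ y))) => [c x z|c x z|B b].
- by rewrite hW_linear (bN _).2.
- by rewrite (bN _).2 hW_linear.
rewrite hW_tens; have [N1 E1] := tens_nprod_zrange n A (hmul k B) a b.
have [N2 E2] := tens_nprod_zrange n A B a b.
rewrite (E1 (N1 + N2)%N) ?leq_addr // (E2 (N1 + N2)%N) ?leq_addl //.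
rewrite (lin_sum (hW_linear k)); apply: eq_bigr => i _.
by rewrite hW_tens nprod_hmulr.
Qed.

Lemma bW_tens m A a : bW_ m (A ⊗ a) = A ⊗ nprod G (m + 1) (gh_b G) a.
Proof. exact: tens_nprod_vacl. Qed.

Lemma bW_linear m : linear (bW_ m).
Proof. exact: (bN _).2. Qed.

Lemma bW_hW m k x : bW_ m (hW_ k x) = hW_ k (bW_ m x).
Proof. exact: nprod_hWr. Qed.

Let b_odd : vpar (tv_vsa W) true (vac Y ⊗ gh_b G).
Proof. exact/tens_par/gh_b_odd. Qed.

Lemma bW_par p m x : vpar (tv_vsa W) p x -> vpar (tv_vsa W) (~~ p) (bW_ m x).
Proof. by move=> px; have := nprod_par (m + 1) b_odd px. Qed.

Lemma bW_bW m x : bW_ m (bW_ m x) = 0.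
Proof.
move: x; apply: (tens_eq (f := fun x => bW_ m (bW_ m x)) (g := fun=> 0)).
- by move=> c x y; rewrite !bW_linear.
- by move=> c x y; rewrite scaler0 addr0.
move=> A a; rewrite !bW_tens [X in _ ⊗ X](_ : _ = 0) ?(bilin0r bT) //.
exact/eq_oppr0/b_anticomm.
Qed.

Lemma bm1_derivation p n x y : vpar (tv_vsa W) p x ->
  bW_ (-1) (x ⟪n⟫ y) =
  bW_ (-1) x ⟪n⟫ y + (-1) ^+ p *: (x ⟪n⟫ bW_ (-1) y).
Proof. exact: (zero_mode_derivation _ _ b_odd). Qed.

(** b_0 is the mode of index 1 of b, so it fails to be a derivation by a product with b_(-1) x; for
    n = -1 this failure is the bracket up to sign. *)
Lemma b0_commutator p n x y : vpar (tv_vsa W) p x ->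
  bW_ 0 (x ⟪n⟫ y) = bW_ (-1) x ⟪n + 1⟫ y + bW_ 0 x ⟪n⟫ y
    + (-1) ^+ p *: (x ⟪n⟫ bW_ 0 y).
Proof. exact: (one_mode_commutator _ _ b_odd). Qed.

Local Notation Z := (nprod G (-1) (gdc G) (gh_b G)).

Let brst_odd : vpar (tv_vsa W) true (brst_current W).
Proof.
apply: subspaceD; first exact: vpar_subspace.
  apply: subspaceD; first exact: vpar_subspace.
    exact/tens_par/gh_c_odd.
  exact/tens_par/X_odd.
apply: subspaceZ; first exact: vpar_subspace.
exact/tens_par/vpar_vT/gdc_odd.
Qed.

Lemma Q_linear : linear (Q W).
Proof. exact: (bN _).2. Qed.

Lemma Q_derivation p n x y : vpar (tv_vsa W) p x ->
  Q W (x ⟪n⟫ y) = Q W x ⟪n⟫ y + (-1) ^+ p *: (x ⟪n⟫ Q W y).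
Proof. exact: (zero_mode_derivation _ _ brst_odd). Qed.

Lemma vT_tens A a : vT (tv_vsa W) (A ⊗ a) = vT Y A ⊗ a + A ⊗ vT G a.
Proof.
rewrite {1}/vT tv_vac (tens_nprod (r := [:: -2; -1])) //; last first.
  move=> i; rewrite !inE => iN; have [i0|i0] := ltrP i 0.
    by right; apply: vac_right0; lia.
  by left; apply: vac_right0.
by rewrite !big_cons big_nil addr0 !vac_right.
Qed.

(* b_(-1) maps the BRST current to the total conformal field up to a translation,
   and the zero mode of the conformal field is the translation operator. *)
Lemma Q_bm1 x : Q W (bW_ (-1) x) + bW_ (-1) (Q W x) = vT (tv_vsa W) x.
Proof.
have -> : Q W (bW_ (-1) x) + bW_ (-1) (Q W x) =
    bW_ (-1) (brst_current W) ⟪0⟫ x.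
  by rewrite (bm1_derivation _ _ brst_odd) scaleN1r addrC subrK.
rewrite /brst_current !(linD (bW_linear _)) (linZ (bW_linear _)) !bW_tens.
rewrite (b_nprod_c G (k := -1 + 1)) // b_nprod_X.
rewrite [nprod G _ _ (gddc G)](_ : _ = 0); last first.
  by rewrite gddcE (bilinZr (bG _)) bmode_cmode // bmode_vac // (lin0 (cmode_linear G _)) subr0 scaler0.
rewrite (bilin0r bT) scaler0 addr0.
move: x; apply: (tens_eq (f := fun x => (om ⊗ vac G + vac Y ⊗ Z) ⟪0⟫ x)).
- exact: (bN _).2.
- exact: vT_linear.
move=> A a; rewrite (bilinDl (bN _)) tens_nprod_vacr tens_nprod_vacl Z_zero_mode.
by rewrite (vf_trans Y) vT_tens.
Qed.

(** The modes on V are cut on both sides: an index that is too low meets a nonnegative product of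
    monomials in c, which is 0, and one that is too high produces a negative weight. The next three
    formulas use the same cuts. *)
Lemma tens_nprodN1 a b A B s t : (forall i, Vn a (A i)) -> (forall i, Vn b (B i)) ->
  (a + b <= 2)%N ->
  A ⊗ cmon s ⟪-1⟫ B ⊗ cmon t = nprod Y (-1) A B ⊗ nprod G (-1) (cmon s) (cmon t)
    + nprod Y 0 A B ⊗ nprod G (-2) (cmon s) (cmon t)
    + nprod Y 1 A B ⊗ nprod G (-3) (cmon s) (cmon t).
Proof.
move=> aA bB ab; rewrite (tens_nprod (r := [:: -1; 0; 1])) //; last first.
  move=> i; rewrite !inE => iN; have [i0|i0] := ltrP i 0.
    by right; apply: cmon_nprod_ge0; [exact: cpure_cmon|lia].
  by left; apply: (nprod_weight_neg Y aA bB); lia.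
by rewrite 2!big_cons big_seq1; exact: addrA.
Qed.

Lemma tens_nprod0 a b A B s t : (forall i, Vn a (A i)) -> (forall i, Vn b (B i)) ->
  (a + b <= 2)%N ->
  A ⊗ cmon s ⟪0⟫ B ⊗ cmon t = nprod Y 0 A B ⊗ nprod G (-1) (cmon s) (cmon t)
    + nprod Y 1 A B ⊗ nprod G (-2) (cmon s) (cmon t).
Proof.
move=> aA bB ab; rewrite (tens_nprod (r := [:: 0; 1])) //; last first.
  move=> i; rewrite !inE => iN; have [i0|i0] := ltrP i 0.
    by right; apply: cmon_nprod_ge0; [exact: cpure_cmon|lia].
  by left; apply: (nprod_weight_neg Y aA bB); lia.
by rewrite big_cons big_seq1.
Qed.

Lemma tens_nprod1 a b A B s t : (forall i, Vn a (A i)) -> (forall i, Vn b (B i)) ->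
  (a + b <= 2)%N ->
  A ⊗ cmon s ⟪1⟫ B ⊗ cmon t = nprod Y 1 A B ⊗ nprod G (-1) (cmon s) (cmon t).
Proof.
move=> aA bB ab; rewrite (tens_nprod (r := [:: 1])) //; last first.
  move=> i; rewrite !inE => iN; have [i0|i0] := ltrP i 1.
    by right; apply: cmon_nprod_ge0; [exact: cpure_cmon|lia].
  by left; apply: (nprod_weight_neg Y aA bB); lia.
by rewrite big_seq1.
Qed.

Lemma tens_nprod_ge2 (n : int) a b A B s t : 2 <= n ->
  (forall i, Vn a (A i)) -> (forall i, Vn b (B i)) -> (a + b <= 2)%N ->
  A ⊗ cmon s ⟪n⟫ B ⊗ cmon t = 0.
Proof.
move=> n2 aA bB ab; rewrite (tens_nprod (r := [::])) ?big_nil // => i _.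
have [i0|i0] := ltrP i n.
  by right; apply: cmon_nprod_ge0; [exact: cpure_cmon|lia].
by left; apply: (nprod_weight_neg Y aA bB); lia.
Qed.

(** The same two cuts leave n = -1, 0, 1 in the sum of the L_n c_(-n); the last term is the action
    of :c dc b:. *)
Lemma Q_tens a A s : (forall i, Vn a (A i)) -> (a <= 1)%N ->
  Q W (A ⊗ cmon s) = nprod Y 0 om A ⊗ cmode 0 (cmon s)
    + nprod Y 1 om A ⊗ cmode 1 (cmon s) + nprod Y 2 om A ⊗ cmode 2 (cmon s)
    + A ⊗ nprod G 0 (nprod G (-1) (gc G) Z) (cmon s).
Proof.
move=> aA a1; rewrite /Q !(bilinDl (bN _)) (bilinZl (bN _)) !tens_nprod_vacl.
rewrite gddcE (bilinZl (bG _)) cmon_nprod_ge0 //; last exact: cpure_cmon.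
rewrite scaler0 (bilin0r bT) scaler0 addr0 gcE; congr (_ + _).
rewrite (tens_nprod (r := [:: 0; 1; 2])) //; last first.
  move=> i; rewrite !inE => iN; have [i0|i0] := ltrP i 0.
    by right; apply: cmon_nprod_ge0; [exact: cpure_cmon|lia].
  by left; apply: (nprod_weight_neg Y (omega_weight Y) aA); lia.
by rewrite 2!big_cons big_seq1 -gcE; exact: addrA.
Qed.

End Tensor.

(** * Light ghost monomials *)

Section LightGhosts.
Implicit Types s t : seq nat.
Variables (K : numFieldType) (L : lmodType K) (G : ghost_vsa L).
Local Notation "a ⟪ n ⟫ b" := (nprod G n a b)
  (at level 40, n at level 99, b at next level, format "a  ⟪ n ⟫  b").
Local Notation b := (gh_b G).
Local Notation D := (cmode G).
Local Notation cmon := (cmon G).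

(* The ghost monomials that occur in light modes, namely 1, c, dc, c dc,
   c ddc / 2 and c dc ddc / 2.  In F the monomial s is tensored with states of
   weight [vwt s] and carries the factor h^(hexp s). *)
Definition lights : seq (seq nat) :=
  [:: [::]; [:: 0]; [:: 1]; [:: 0; 1]; [:: 0; 2]; [:: 0; 1; 2]]%N.
Definition vwt (s : seq nat) : nat := size s - sumn s.
Definition hexp (s : seq nat) : nat := count (leq 1) s.

Lemma lights_ind (P : seq nat -> Prop) :
  P [::] -> P [:: 0]%N -> P [:: 1]%N -> P [:: 0; 1]%N -> P [:: 0; 2]%N ->
  P [:: 0; 1; 2]%N -> forall s : seq nat, s \in lights -> P s.
Proof.
by move=> P1 P2 P3 P4 P5 P6 s; rewrite !inE =>
  /or3P[/eqP->|/eqP->|/or3P[/eqP->|/eqP->|/orP[]/eqP->]].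
Qed.

Definition inspan (s : seq nat) (a : L) : Prop := exists k : K, a = k *: cmon s.

Lemma inspan0 s : inspan s 0.
Proof. by exists 0; rewrite scale0r. Qed.
Lemma inspan_cmon s : inspan s (cmon s).
Proof. by exists 1; rewrite scale1r. Qed.
Lemma inspanD s x y : inspan s x -> inspan s y -> inspan s (x + y).
Proof. by move=> [k ->] [l ->]; exists (k + l); rewrite scalerDl. Qed.
Lemma inspanZ s k x : inspan s x -> inspan s (k *: x).
Proof. by move=> [l ->]; exists (k * l); rewrite scalerA. Qed.
Lemma inspanN s x : inspan s x -> inspan s (- x).
Proof. by rewrite -scaleN1r; apply: inspanZ. Qed.

Lemma cmon_prodN1_nil t : cmon [::] ⟪-1⟫ cmon t = cmon t.
Proof. by rewrite vac_left. Qed.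
Lemma cmon_prodN2_nil t : cmon [::] ⟪-2⟫ cmon t = 0.
Proof. by rewrite vac_left. Qed.
Lemma cmon_prodN3_nil t : cmon [::] ⟪-3⟫ cmon t = 0.
Proof. by rewrite vac_left. Qed.
Lemma cmon_prodN1 i s t : cmon (i :: s) ⟪-1⟫ cmon t = D i (cmon s ⟪-1⟫ cmon t).
Proof. exact/cmon_nprodN1/cpure_cmon. Qed.
Lemma cmon_prodN2 i s t : cmon (i :: s) ⟪-2⟫ cmon t =
  D i (cmon s ⟪-2⟫ cmon t) + i.+1%:R *: D i.+1 (cmon s ⟪-1⟫ cmon t).
Proof. exact/cmon_nprodN2/cpure_cmon. Qed.
Lemma cmon_prodN3 i s t : cmon (i :: s) ⟪-3⟫ cmon t =
  D i (cmon s ⟪-3⟫ cmon t) + i.+1%:R *: D i.+1 (cmon s ⟪-2⟫ cmon t)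
    + (i.+1 * i.+2)%:R / 2 *: D i.+2 (cmon s ⟪-1⟫ cmon t).
Proof. exact/cmon_nprodN3/cpure_cmon. Qed.
Lemma cmon_cons i s : cmon (i :: s) = D i (cmon s). Proof. by []. Qed.
Lemma cmon_nil : cmon [::] = vac G. Proof. by []. Qed.
Lemma cmodeD i x y : D i (x + y) = D i x + D i y.
Proof. exact/linD/cmode_linear. Qed.
Lemma cmodeZ i k x : D i (k *: x) = k *: D i x.
Proof. exact/linZ/cmode_linear. Qed.
Lemma cmodeN i x : D i (- x) = - D i x.
Proof. exact/linN/cmode_linear. Qed.
Lemma cmode0 i : D i 0 = 0.
Proof. exact/lin0/cmode_linear. Qed.

Definition cmon_prodE := (cmon_prodN1_nil, cmon_prodN2_nil, cmon_prodN3_nil,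
  cmon_prodN1, cmon_prodN2, cmon_prodN3).

(** Rewriting rules that sort a word of creation modes into increasing order. Index 4 is the largest
    that occurs: light monomials have entries at most 2, and the product formulas raise an entry by
    at most 2. *)
Definition cmode_sort := (cmode_sq G,
  (cmode_anticomm G 1 0, cmode_anticomm G 2 0, cmode_anticomm G 2 1,
   cmode_anticomm G 3 0, cmode_anticomm G 3 1, cmode_anticomm G 3 2,
   cmode_anticomm G 4 0, cmode_anticomm G 4 1, cmode_anticomm G 4 2, cmode_anticomm G 4 3),
  (cmodeD, cmodeZ, cmodeN, cmode0), (@scaler0 K L, @oppr0 L, @addr0 L, @add0r L)).

(* The possible values of a ghost product inside light modes of ghost number i
   and weight w on the V side, when a factor h^e is available. *)
Definition light_span (i w e : nat) (a : L) : Prop :=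
  a = 0 \/ exists s, [/\ s \in lights, size s = i, vwt s = w, (hexp s <= e)%N & inspan s a].

End LightGhosts.

Ltac inspan_tac := repeat first
  [ exact: inspan0 | exact: inspan_cmon | apply: inspanN | apply: inspanZ | apply: inspanD ].

Ltac ghost_norm := rewrite ?cmon_prodE ?(cmon_cons, cmon_nil) ?cmode_sort.

(** Ghost number and weight determine a light monomial, so each product is 0 or a multiple of a
    single one, found by trial. *)
Ltac light_span_tac := ghost_norm; first
  [ by left
  | right; first
    [ by exists [::]; split=> //; inspan_tac
    | by exists [:: 0]%N; split=> //; inspan_tac
    | by exists [:: 1]%N; split=> //; inspan_tac
    | by exists [:: 0; 1]%N; split=> //; inspan_tac
    | by exists [:: 0; 2]%N; split=> //; inspan_tac
    | by exists [:: 0; 1; 2]%N; split=> //; inspan_tac ] ].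

Section LightGhostProducts.
Implicit Types s t p : seq nat.
Variables (K : numFieldType) (L : lmodType K) (G : ghost_vsa L).
Local Notation "a ⟪ n ⟫ b" := (nprod G n a b)
  (at level 40, n at level 99, b at next level, format "a  ⟪ n ⟫  b").
Local Notation b := (gh_b G).
Local Notation cmon := (cmon G).

Lemma light_prodN1 s t : s \in lights -> t \in lights ->
  light_span G (size s + size t) (vwt s + vwt t) (hexp s + hexp t) (cmon s ⟪-1⟫ cmon t).
Proof.
move=> hs; move: t; move: s hs.
by apply: lights_ind; apply: lights_ind; light_span_tac.
Qed.

(** The additional 1 in the exponent, here and for index -3, is the factor h from the accompanying
    product of index 0 or 1 on V. *)
Lemma light_prodN2 s t : s \in lights -> t \in lights -> (0 < vwt s + vwt t)%N ->
  light_span G (size s + size t) (vwt s + vwt t - 1) (hexp s + hexp t + 1)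
    (cmon s ⟪-2⟫ cmon t).
Proof.
move=> hs; move: t; move: s hs.
by apply: lights_ind; apply: lights_ind => // _; light_span_tac.
Qed.

Lemma light_prodN3 s t : s \in lights -> t \in lights -> (1 < vwt s + vwt t)%N ->
  light_span G (size s + size t) (vwt s + vwt t - 2) (hexp s + hexp t + 1)
    (cmon s ⟪-3⟫ cmon t).
Proof.
move=> hs; move: t; move: s hs.
by apply: lights_ind; apply: lights_ind => // _; light_span_tac.
Qed.

(** The light monomials on which b_(-1) is nonzero: it removes a leading c. The default 1 makes the
    empty monomial fail the test. *)
Definition lowering (s : seq nat) := head 1%N s == 0%N.

(** The exponent leaves no slack: the power of h contributed by V has to survive as the factor h of
    the bracket. *)
Lemma light_low_prodN1 s t : s \in lights -> lowering s -> t \in lights ->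
  (0 < vwt s + vwt t)%N ->
  light_span G (size s + size t - 1) (vwt s + vwt t - 1) (hexp s + hexp t)
    (cmon (behead s) ⟪-1⟫ cmon t).
Proof.
move=> hs ls; move: t; move: s hs ls.
by apply: lights_ind => // _; apply: lights_ind => // _; light_span_tac.
Qed.

Lemma light_low_prodN2 s t : s \in lights -> lowering s -> t \in lights ->
  (1 < vwt s + vwt t)%N ->
  light_span G (size s + size t - 1) (vwt s + vwt t - 2) (hexp s + hexp t)
    (cmon (behead s) ⟪-2⟫ cmon t).
Proof.
move=> hs ls; move: t; move: s hs ls.
by apply: lights_ind => // _; apply: lights_ind => // _; light_span_tac.
Qed.

(** The only monomials in c and its derivatives of conformal weight -1, the weight of a product of
    index 0 of light modes. *)
Definition cghosts : seq (seq nat) := [:: [:: 0]; [:: 0; 1]]%N.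

Lemma cghosts_ind (P : seq nat -> Prop) : P [:: 0]%N -> P [:: 0; 1]%N ->
  forall s : seq nat, s \in cghosts -> P s.
Proof. by move=> P1 P2 s; rewrite !inE => /orP[]/eqP->. Qed.

Definition cghost_span (i : nat) (a : L) : Prop :=
  a = 0 \/ exists s, [/\ s \in cghosts, size s = i & inspan G s a].

(** At total weight 2 both monomials contain an undifferentiated c, whose square is 0. *)
Lemma cghost_prodN1 s t : s \in lights -> t \in lights -> (0 < vwt s + vwt t)%N ->
  cmon s ⟪-1⟫ cmon t = 0 \/
  (vwt s + vwt t = 1)%N /\ cghost_span (size s + size t) (cmon s ⟪-1⟫ cmon t).
Proof.
move=> hs; move: t; move: s hs.
apply: lights_ind; apply: lights_ind => // _; ghost_norm; first
  [ by left
  | right; split; [by [] | right; first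
    [ by exists [:: 0]%N; split=> //; inspan_tac
    | by exists [:: 0; 1]%N; split=> //; inspan_tac ]] ].
Qed.

Lemma cghost_prodN2 s t : s \in lights -> t \in lights -> (1 < vwt s + vwt t)%N ->
  cghost_span (size s + size t) (cmon s ⟪-2⟫ cmon t).
Proof.
move=> hs; move: t; move: s hs.
apply: lights_ind; apply: lights_ind => // _; ghost_norm; first
  [ by left
  | right; first
    [ by exists [:: 0]%N; split=> //; inspan_tac
    | by exists [:: 0; 1]%N; split=> //; inspan_tac ] ].
Qed.

(** The second factor comes from a product of index 0, whose coefficient already carries one h;
    hence [hexp s + 1], and [hexp s + 2] in the next statement, where V contributes another. *)
Lemma light_low_cghostN1 s p : s \in lights -> lowering s -> p \in cghosts ->
  light_span G (size s + size p - 1) (vwt s) (hexp s + 1) (cmon (behead s) ⟪-1⟫ cmon p).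
Proof.
move=> hs ls; move: p; move: s hs ls.
by apply: lights_ind => // _; apply: cghosts_ind; light_span_tac.
Qed.

Lemma light_low_cghostN2 s p : s \in lights -> lowering s -> p \in cghosts ->
  (0 < vwt s)%N ->
  light_span G (size s + size p - 1) 0 (hexp s + 2) (cmon (behead s) ⟪-2⟫ cmon p).
Proof.
move=> hs ls; move: p; move: s hs ls.
by apply: lights_ind => // _; apply: cghosts_ind => // _; light_span_tac.
Qed.

Lemma b_cmon i k s : b ⟪i%:Z⟫ cmon (k :: s) =
  (if i == k then cmon s else 0) - cmode G k (b ⟪i%:Z⟫ cmon s).
Proof. exact: bmode_cmode. Qed.

Lemma b_cmon_nil (i : nat) : b ⟪i%:Z⟫ cmon [::] = 0.
Proof. exact: bmode_vac. Qed.

Lemma bm1_light s : s \in lights ->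
  b ⟪0⟫ cmon s = if lowering s then cmon (behead s) else 0.
Proof.
move: s; apply: lights_ind; rewrite ?(b_cmon 0) ?(b_cmon_nil 0) /lowering /=.
all: by rewrite ?(cmode0, subr0, oppr0, addr0).
Qed.

(** Minus b_0 on light monomials: dc is removed, with the sign chosen so that passing a leading c
    gives coefficient 1. *)
Definition b0_val s : L :=
  match s with
  | [:: 1%N] => - cmon [::]
  | [:: 0%N, 1%N & s'] => cmon (0%N :: s')
  | _ => 0
  end.

Lemma b0_light s : s \in lights -> b ⟪1⟫ cmon s = - b0_val s.
Proof.
move: s; apply: lights_ind; rewrite ?(b_cmon 1) ?(b_cmon_nil 1) /=.
all: by rewrite ?(cmode0, subr0, oppr0, addr0, sub0r, opprK).
Qed.

Local Notation X := (nprod G (-1) (gc G) (nprod G (-1) (gdc G) b)).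

Lemma X_nil : X ⟪0⟫ cmon [::] = 0. Proof. exact: X_vac. Qed.
Lemma X_cons0 s : X ⟪0⟫ cmon (0%N :: s) =
  cmon [:: 0; 1]%N ⟪-1⟫ cmon s - cmode G 0 (X ⟪0⟫ cmon s).
Proof. exact: (X_cmode G 0). Qed.
Lemma X_cons1 s : X ⟪0⟫ cmon (1%N :: s) =
  cmon [:: 0; 1]%N ⟪-2⟫ cmon s - cmode G 1 (X ⟪0⟫ cmon s).
Proof. exact: (X_cmode G 1). Qed.
Lemma X_cons2 s : X ⟪0⟫ cmon (2%N :: s) =
  cmon [:: 0; 1]%N ⟪-3⟫ cmon s - cmode G 2 (X ⟪0⟫ cmon s).
Proof. exact: (X_cmode G 2). Qed.

(** The total L_0 is 0 on light modes, so the terms c_0 L_0 of both sides cancel; what remains of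
    the charge is 2 c_1 c_(-1) b_0, which is nonzero on dc alone. *)
Lemma X_light s : s \in lights ->
  (vwt s)%:R *: cmode G 1 (cmon s) + X ⟪0⟫ cmon s =
  if s == [:: 1%N] then 2 *: cmon [:: 0; 2]%N else 0.
Proof.
move: s; apply: lights_ind; rewrite ?(X_cons0, X_cons1, X_cons2, X_nil); ghost_norm.
all: rewrite ?(eqxx, mul1n, muln1) /vwt ?(scale0r, scale1r, add0r, addr0) /=.
all: rewrite ?(scale0r, scale1r, add0r, addr0, oppr0, addNr, subr0) //.
by rewrite divff ?pnatr_eq0 // scale1r scaler_nat mulr2n addrK subrr.
Qed.

(** [phi s] strips the factors of [s] with the conjugate modes of b and evaluates a functional
    normalised at the vacuum; within one ghost number this separates the light monomials. *)
Lemma light_dual : exists phi : seq nat -> L -> K,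
  (forall s k x y, phi s (k *: x + y) = k * phi s x + phi s y) /\
  forall s t, s \in lights -> t \in lights -> size s = size t ->
    phi s (cmon t) = (s == t)%:R.
Proof.
have [phi [phiP phi1]] := linear_functional_exists (gh_vac_neq0 (g := G)).
have phi0 : phi 0 = 0 by have := phiP (-1) 0 0; rewrite scaler0 addr0 mulN1r addNr.
exists (fun s x => phi (foldl (fun y (k : nat) => b ⟪k%:Z⟫ y) x s)).
split=> [s|s t hs].
  elim: s => [|j s IHs] k x y /=; first exact: phiP.
  by rewrite (nprod_bilin G _).2 IHs.
move: t; move: s hs; apply: lights_ind; apply: lights_ind => //= _.
all: rewrite ?(bmode_cmode, bmode_vac, bilin0r (nprod_bilin G _), cmode0, subr0) //=.
Qed.

End LightGhostProducts.

(** * The rescaled complex *)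

Section RescaledComplex.
Variables (K : numFieldType) (V : lmodType K) (Vn : nat -> set V).
Variables (Y : voa_formal Vn) (L : lmodType K) (G : ghost_vsa L).
Variable W : tensor_vsa Y G.

Local Notation "A ⊗ a" := (tens W A a) (at level 40).
Local Notation "x ⟪ n ⟫ y" := (nprod (tv_vsa W) n x y)
  (at level 45, n at level 99, y at next level, format "x  ⟪ n ⟫  y").
Local Notation om := (vf_omega Y).
Local Notation cmon := (cmon G).
Local Notation cmode := (cmode G).
Local Notation hW_ := (hW (W := W)).
Local Notation bm1 := (Defs.bW (W := W) (-1)).
Local Notation b0 := (Defs.bW (W := W) 0).
Let bN := nprod_bilin (tv_vsa W).
Let bT := tens_bilin W.
Let VnS := Vn_subspace Y.
Implicit Types (A B : laurent V) (s t : seq nat).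

(* h^k F_i[h], for every integer k. *)
Definition Fpoly (k i : int) : set W := [set x | exists A : seq nat -> laurent V,
  (forall s, s \in lights -> hgr (k + (hexp s)%:Z) (Vn (vwt s)) (A s)) /\
  x = \sum_(s <- lights | (size s)%:Z == i) A s ⊗ cmon s].

Lemma Fpoly_subspace k i : subspace (Fpoly k i).
Proof.
split=> [|c x y [A [AV ->]] [B [BV ->]]].
  exists (fun=> 0); split=> [s _|]; first exact: (hgr_subspace _ (VnS _)).1.
  by rewrite big1 // => s _; rewrite (bilin0l bT).
exists (fun s => c *: A s + B s); split=> [s sl|].
  by apply: (hgr_subspace _ (VnS _)).2; [exact: AV|exact: BV].
rewrite scaler_sumr -big_split; apply: eq_bigr => s _.
by rewrite bT.1.
Qed.

Lemma Fpoly_tens k i s A : s \in lights -> (size s)%:Z = i ->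
  hgr (k + (hexp s)%:Z) (Vn (vwt s)) A -> Fpoly k i (A ⊗ cmon s).
Proof.
move=> sl si AV; exists (fun t => if t == s then A else 0); split=> [t tl|].
  by case: eqP => [->|_] //; exact: (hgr_subspace _ (VnS _)).1.
rewrite big_mkcond (bigD1_seq s) //= si !eqxx big1 ?addr0 // => t /negPf->.
by rewrite (bilin0l bT) if_same.
Qed.

Lemma Fpoly_ind k i (S : set W) : subspace S ->
  (forall (s : seq nat) A, s \in lights -> (size s)%:Z = i -> hgr (k + (hexp s)%:Z) (Vn (vwt s)) A ->
     S (A ⊗ cmon s)) -> forall x, Fpoly k i x -> S x.
Proof.
move=> sS St x [A [AV ->]]; rewrite big_seq_cond; apply: subspace_sum => // s.
by move=> /andP[sl /eqP si]; apply: St => //; exact: AV.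
Qed.

Lemma Fpoly_linear k i f (S : set W) : linear f -> subspace S ->
  (forall (s : seq nat) A, s \in lights -> (size s)%:Z = i -> hgr (k + (hexp s)%:Z) (Vn (vwt s)) A ->
     S (f (A ⊗ cmon s))) -> forall x, Fpoly k i x -> S (f x).
Proof.
move=> lf sS St; apply: (Fpoly_ind (S := [set x | S (f x)])) => //.
split=> [|c x y Sx Sy] /=; first by rewrite (lin0 lf); exact: sS.1.
by rewrite lf; apply: sS.2.
Qed.

Lemma Fpoly_le k l i x : l <= k -> Fpoly k i x -> Fpoly l i x.
Proof.
move=> lk; move: x; apply: Fpoly_ind => [|s A sl si AV]; first exact: Fpoly_subspace.
by apply: Fpoly_tens => //; apply: hgr_le AV; lia.
Qed.

Lemma Fpoly_hW k l i x : Fpoly k i x -> Fpoly (l + k) i (hW_ l x).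
Proof.
move: x; apply: Fpoly_linear => [||s A sl si AV]; first exact: hW_linear.
  exact: Fpoly_subspace.
by rewrite hW_tens; apply: Fpoly_tens => //; rewrite -addrA; apply: hgr_hmul.
Qed.

Lemma Fpoly_light_span k l i i' w e A a : light_span G i w e a ->
  hgr l (Vn w) A -> k + e%:Z <= l -> i%:Z = i' -> Fpoly k i' (A ⊗ a).
Proof.
move=> [->|[s [sl <- <- he [c ->]]]] AV kl <-.
  by rewrite (bilin0r bT); exact: (Fpoly_subspace _ _).1.
rewrite (bilinZr bT); apply: (subspaceZ (Fpoly_subspace _ _)).
by apply: Fpoly_tens => //; apply: hgr_le AV; lia.
Qed.

Lemma light_par s A : vpar (tv_vsa W) (odd (size s)) (A ⊗ cmon s).
Proof. exact/tens_par/cmon_par. Qed.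

Lemma Fpoly_par k i x : Fpoly k i x -> vpar (tv_vsa W) (odd `|i|) x.
Proof.
move: x; apply: Fpoly_ind => [|s A sl <- _]; [exact: vpar_subspace|exact: light_par].
Qed.

Lemma vwt_light s : s \in lights -> (vwt s <= 1)%N.
Proof. by move: s; apply: lights_ind. Qed.

(* The L_0 term of c L cancels the action of :c dc b:, except on dc. *)
Lemma Q_light s A : s \in lights -> (forall i, Vn (vwt s) (A i)) ->
  Q W (A ⊗ cmon s) = nprod Y 0 om A ⊗ cmode 0 (cmon s) + nprod Y 2 om A ⊗ cmode 2 (cmon s)
    + A ⊗ (if s == [:: 1%N] then 2 *: cmon [:: 0; 2]%N else 0).
Proof.
move=> sl AV; rewrite (Q_tens _ _ AV) ?vwt_light // -X_light //.
rewrite ((vf_weight Y _ A).2 AV) bT.2 (bilinZl bT) addrA; congr (_ + _).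
by rewrite addrAC.
Qed.

(** c_1 L_(-1) adds an undifferentiated c and keeps the power of h; c_(-1) L_1 adds ddc and takes
    its power of h from L_1. *)
Lemma Fpoly_Q k i x : Fpoly k i x -> Fpoly k (i + 1) (Q W x).
Proof.
move: x; apply: Fpoly_linear => [||s A sl <- AV].
- exact: Q_linear.
- exact: Fpoly_subspace.
rewrite (Q_light sl AV.2).
have S := Fpoly_subspace k ((size s)%:Z + 1).
apply: (subspaceD S); first apply: (subspaceD S).
- have [w0|w1] := posnP (vwt s).
    apply: (Fpoly_light_span (l := k + (hexp s)%:Z) (i := (size s).+1) (w := 1) (e := hexp s)).
    + by move: s sl w0 {A AV S}; apply: lights_ind => // _; light_span_tac.
    + by apply: hgr_Lm1; rewrite -w0.
    + by [].
    + by lia.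
  (* Weight 1 on V means that c is already a factor of the monomial. *)
  rewrite [cmode 0 _](_ : _ = 0) ?(bilin0r bT); first exact: S.1.
  by move: s sl w1 {A AV S}; apply: lights_ind => // _; ghost_norm.
- have [w0|w1] := posnP (vwt s).
    rewrite w0 in AV.
    by rewrite (nprod_weight_neg Y (n := 2) (omega_weight Y) AV.2) // (bilin0l bT); exact: S.1.
  have {}w1 : vwt s = 1%N by have := vwt_light sl; lia.
  rewrite w1 in AV.
  apply: (Fpoly_light_span (i := (size s).+1) (e := (hexp s).+1) _ (hgr_L1 Y AV)); try lia.
  by move: s sl w1 {A AV S}; apply: lights_ind => // _; light_span_tac.
case: eqP S AV => [-> S AV|_ S _]; last by rewrite (bilin0r bT); exact: S.1.
rewrite (bilinZr bT); apply: (subspaceZ S).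
exact: (Fpoly_tens (s := [:: 0; 2]%N)).
Qed.

Lemma Fpoly_b0 k i x : Fpoly k i x -> Fpoly (k + 1) (i - 1) (b0 x).
Proof.
move: x; apply: Fpoly_linear => [||s A sl <-].
- exact: bW_linear.
- exact: Fpoly_subspace.
rewrite bW_tens b0_light //; have S j := Fpoly_subspace (k + 1) j.
move: s sl; apply: lights_ind => AV /=; rewrite ?(oppr0, opprK) ?(bilin0r bT);
  try exact: (S _).1.
- by apply: (Fpoly_tens (s := [::])) => //; apply: hgr_le AV; rewrite /hexp /=; lia.
- rewrite (bilinNr bT); apply: (subspaceN (S _)).
  by apply: (Fpoly_tens (s := [:: 0%N])) => //; apply: hgr_le AV; rewrite /hexp /=; lia.
- rewrite (bilinNr bT); apply: (subspaceN (S _)).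
  by apply: (Fpoly_tens (s := [:: 0; 2]%N)) => //; apply: hgr_le AV; rewrite /hexp /=; lia.
Qed.

Lemma Fpoly_bilinear k i l j f (S : set W) : bilin f -> subspace S ->
  (forall (s : seq nat) A (t : seq nat) B, s \in lights -> t \in lights ->
     (size s)%:Z = i -> (size t)%:Z = j ->
     hgr (k + (hexp s)%:Z) (Vn (vwt s)) A -> hgr (l + (hexp t)%:Z) (Vn (vwt t)) B ->
     S (f (A ⊗ cmon s) (B ⊗ cmon t))) ->
  forall x y, Fpoly k i x -> Fpoly l j y -> S (f x y).
Proof.
move=> bf sS St x y Fx; move: y; apply: Fpoly_linear => // [|t B tl tj BV].
  exact: bf.2.
move: x Fx; apply: (Fpoly_linear (f := f^~ (B ⊗ cmon t))) => // [|s A sl si AV].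
  exact: bf.1.
exact: St.
Qed.

Lemma vwt_light2 s t : s \in lights -> t \in lights -> (vwt s + vwt t <= 2)%N.
Proof. by move=> /vwt_light s1 /vwt_light t1; rewrite (leq_add s1 t1). Qed.

(** For n >= 2 no term survives the two cuts; for n = 1 the weights on V force both monomials to
    contain c, so their product is 0. *)
Lemma Fpoly_nprod_pos k i l j (n : int) x y : 1 <= n -> Fpoly k i x -> Fpoly l j y ->
  x ⟪n⟫ y = 0.
Proof.
move=> n1; move: x y.
apply: (Fpoly_bilinear (S := [set 0]) (bN n)) => [|s A t B sl tl _ _ AV BV].
  by split=> // c x y -> ->; rewrite scaler0 addr0.
have ab := vwt_light2 sl tl; have [n2|n2] := lerP 2 n.
  exact: (tens_nprod_ge2 _ _ _ n2 AV.2 BV.2).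
have -> : n = 1 by lia.
rewrite /= (tens_nprod1 _ _ _ AV.2 BV.2) //.
have [w1|w2] := leqP (vwt s + vwt t) 1.
  by rewrite (nprod_weight_neg Y AV.2 BV.2) ?(bilin0l bT) //; lia.
have [->|[w _]] := cghost_prodN1 G sl tl (ltnW w2); first by rewrite (bilin0r bT).
by rewrite w in w2.
Qed.

Lemma Fpoly_mu k i l j x y : Fpoly k i x -> Fpoly l j y -> Fpoly (k + l) (i + j) (x ⟪-1⟫ y).
Proof.
move: x y; apply: Fpoly_bilinear => [||s A t B sl tl <- <- AV BV].
- exact: bN.
- exact: Fpoly_subspace.
have ab := vwt_light2 sl tl; rewrite (tens_nprodN1 _ _ _ AV.2 BV.2) //.
have S := Fpoly_subspace (k + l) ((size s)%:Z + (size t)%:Z).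
apply: (subspaceD S); first apply: (subspaceD S).
- apply: (Fpoly_light_span (light_prodN1 G sl tl)); first apply: (hgr_nprod _ AV BV); lia.
- have [w0|w1] := leqP (vwt s + vwt t) 0.
    by rewrite (nprod_weight_neg Y AV.2 BV.2) ?(bilin0l bT); [exact: S.1|lia].
  apply: (Fpoly_light_span (light_prodN2 G sl tl w1)); first apply: (hgr_nprod_pos _ _ AV BV); lia.
have [w0|w1] := leqP (vwt s + vwt t) 1.
  by rewrite (nprod_weight_neg Y AV.2 BV.2) ?(bilin0l bT); [exact: S.1|lia].
apply: (Fpoly_light_span (light_prodN3 G sl tl w1)); first apply: (hgr_nprod_pos _ _ AV BV); lia.
Qed.

Lemma bm1_tens s A : s \in lights ->
  bm1 (A ⊗ cmon s) = if lowering s then A ⊗ cmon (behead s) else 0.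
Proof.
by move=> sl; rewrite bW_tens bm1_light //; case: ifP; rewrite ?(bilin0r bT).
Qed.

Lemma lowering_size s : lowering s -> (0 < size s)%N.
Proof. by case: s. Qed.

Lemma bm1_bilin (n : int) : bilin (fun x y => bm1 x ⟪n⟫ y).
Proof.
split=> [y|x] c u v; last exact: (bN n).2.
by rewrite bW_linear (bN n).1.
Qed.

Lemma Fpoly_bm1_nprod0 k i l j x y : Fpoly k i x -> Fpoly l j y ->
  Fpoly (k + l + 1) (i + j - 1) (bm1 x ⟪0⟫ y).
Proof.
move: x y; apply: Fpoly_bilinear => [||s A t B sl tl <- <- AV BV].
- exact: bm1_bilin.
- exact: Fpoly_subspace.
have ab := vwt_light2 sl tl.
have S := Fpoly_subspace (k + l + 1) ((size s)%:Z + (size t)%:Z - 1).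
rewrite bm1_tens //; case: ifPn => [ls|_]; last by rewrite (bilin0l (bN _)); exact: S.1.
have s0 := lowering_size ls.
rewrite (tens_nprod0 _ _ _ AV.2 BV.2) //; apply: (subspaceD S).
- have [w0|w1] := leqP (vwt s + vwt t) 0.
    by rewrite (nprod_weight_neg Y AV.2 BV.2) ?(bilin0l bT); [exact: S.1|lia].
  apply: (Fpoly_light_span (light_low_prodN1 G sl ls tl w1));
    first apply: (hgr_nprod_pos _ _ AV BV); lia.
have [w0|w1] := leqP (vwt s + vwt t) 1.
  by rewrite (nprod_weight_neg Y AV.2 BV.2) ?(bilin0l bT); [exact: S.1|lia].
apply: (Fpoly_light_span (light_low_prodN2 G sl ls tl w1));
  first apply: (hgr_nprod_pos _ _ AV BV); lia.
Qed.

(* The products a_(0) b of light modes have conformal weight -1; they involve the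
   ghosts c and c dc only, with coefficients in h V^0[h]. *)
Definition Fneg (k i : int) : set W := [set x | exists B : seq nat -> laurent V,
  (forall s, hgr (k + 1) (Vn 0) (B s)) /\
  x = \sum_(s <- cghosts | (size s)%:Z == i) B s ⊗ cmon s].

Lemma Fneg_subspace k i : subspace (Fneg k i).
Proof.
split=> [|c x y [A [AV ->]] [B [BV ->]]].
  exists (fun=> 0); split=> [s|]; first exact: (hgr_subspace _ (VnS _)).1.
  by rewrite big1 // => s _; rewrite (bilin0l bT).
exists (fun s => c *: A s + B s); split=> [s|].
  by apply: (hgr_subspace _ (VnS _)).2.
rewrite scaler_sumr -big_split; apply: eq_bigr => s _.
by rewrite bT.1.
Qed.

Lemma Fneg_tens k i s A : s \in cghosts -> (size s)%:Z = i ->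
  hgr (k + 1) (Vn 0) A -> Fneg k i (A ⊗ cmon s).
Proof.
move=> sl si AV; exists (fun t => if t == s then A else 0); split=> [t|].
  by case: ifP => _ //; exact: (hgr_subspace _ (VnS _)).1.
rewrite big_mkcond (bigD1_seq s) //= si !eqxx big1 ?addr0 // => t /negPf->.
by rewrite (bilin0l bT) if_same.
Qed.

Lemma Fneg_linear k i f (S : set W) : linear f -> subspace S ->
  (forall (s : seq nat) A, s \in cghosts -> (size s)%:Z = i -> hgr (k + 1) (Vn 0) A ->
     S (f (A ⊗ cmon s))) -> forall x, Fneg k i x -> S (f x).
Proof.
move=> lf sS St x [A [AV ->]]; rewrite (lin_sum lf) big_seq_cond.
apply: subspace_sum => // s /andP[sl /eqP si]; exact: St.
Qed.

Lemma Fneg_cghost_span k l i i' A a : cghost_span G i a ->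
  hgr l (Vn 0) A -> k + 1 <= l -> i%:Z = i' -> Fneg k i' (A ⊗ a).
Proof.
move=> [->|[s [sl <- [c ->]]]] AV kl <-.
  by rewrite (bilin0r bT); exact: (Fneg_subspace _ _).1.
rewrite (bilinZr bT); apply: (subspaceZ (Fneg_subspace _ _)).
by apply: Fneg_tens => //; apply: hgr_le AV.
Qed.

Lemma Fneg_nprod0 k i l j x y : Fpoly k i x -> Fpoly l j y ->
  Fneg (k + l) (i + j) (x ⟪0⟫ y).
Proof.
move: x y; apply: Fpoly_bilinear => [||s A t B sl tl <- <- AV BV].
- exact: bN.
- exact: Fneg_subspace.
have ab := vwt_light2 sl tl; rewrite (tens_nprod0 _ _ _ AV.2 BV.2) //.
have S := Fneg_subspace (k + l) ((size s)%:Z + (size t)%:Z).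
apply: (subspaceD S).
- have [w0|w1] := leqP (vwt s + vwt t) 0.
    by rewrite (nprod_weight_neg Y AV.2 BV.2) ?(bilin0l bT); [exact: S.1|lia].
  have [->|[w2 st]] := cghost_prodN1 G sl tl w1; first by rewrite (bilin0r bT); exact: S.1.
  apply: (Fneg_cghost_span st); first apply: (hgr_nprod_pos _ _ AV BV); lia.
have [w0|w1] := leqP (vwt s + vwt t) 1.
  by rewrite (nprod_weight_neg Y AV.2 BV.2) ?(bilin0l bT); [exact: S.1|lia].
apply: (Fneg_cghost_span (cghost_prodN2 G sl tl w1)); first apply: (hgr_nprod_pos _ _ AV BV); lia.
Qed.

(** The extra h in the coefficients is spent on dc when c is removed from c dc. *)
Lemma Fneg_bm1 k i x : Fneg k i x -> Fpoly k (i - 1) (bm1 x).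
Proof.
move: x; apply: Fneg_linear => [||s A + <- AV].
- exact: bW_linear.
- exact: Fpoly_subspace.
move: s; apply: cghosts_ind; rewrite bm1_tens //=.
  by apply: (Fpoly_tens (s := [::])) => //; apply: hgr_le AV; rewrite /hexp /=; lia.
by apply: (Fpoly_tens (s := [:: 1%N])) => //; apply: hgr_le AV; rewrite /hexp /=; lia.
Qed.

Lemma Fpoly_bm1_Fneg k i l j x y : Fpoly k i x -> Fneg l j y ->
  Fpoly (k + l) (i + j - 1) (bm1 x ⟪-1⟫ y).
Proof.
move=> Fx; move: y; apply: Fneg_linear => [||t B tl <- BV].
- exact: (bN _).2.
- exact: Fpoly_subspace.
move: x Fx; apply: (Fpoly_linear (f := fun x => bm1 x ⟪-1⟫ B ⊗ cmon t)) => [||s A sl <- AV].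
- exact: (bm1_bilin _).1.
- exact: Fpoly_subspace.
have S := Fpoly_subspace (k + l) ((size s)%:Z + (size t)%:Z - 1).
rewrite bm1_tens //; case: ifPn => [ls|_]; last by rewrite (bilin0l (bN _)); exact: S.1.
have s0 := lowering_size ls; have s1 := vwt_light sl.
rewrite (tens_nprodN1 _ _ _ AV.2 BV.2); last by lia.
apply: (subspaceD S); first apply: (subspaceD S).
- apply: (Fpoly_light_span (light_low_cghostN1 G sl ls tl));
    first apply: (hgr_nprod _ AV BV); lia.
- have [w0|w1] := leqP (vwt s) 0.
    by rewrite (nprod_weight_neg Y AV.2 BV.2) ?(bilin0l bT); [exact: S.1|lia].
  apply: (Fpoly_light_span (light_low_cghostN2 G sl ls tl w1));
    first apply: (hgr_nprod_pos _ _ AV BV); lia.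
by rewrite (nprod_weight_neg Y AV.2 BV.2) ?(bilin0l bT); [exact: S.1|lia].
Qed.

End RescaledComplex.

(** * Leading parts *)

Section LeadingParts.
Variables (K : numFieldType) (V : lmodType K) (Vn : nat -> set V).
Variables (Y : voa_formal Vn) (L : lmodType K) (G : ghost_vsa L).
Variable W : tensor_vsa Y G.

Local Notation "A ⊗ a" := (tens W A a) (at level 40).
Local Notation cmon := (cmon G).
Local Notation hW_ := (hW (W := W)).
Local Notation F := (F W).
Local Notation Fpoly := (Fpoly (W := W)).
Let bT := tens_bilin W.
Let VnS := Vn_subspace Y.
Implicit Types (A B : laurent V) (s t : seq nat) (x y z : W).

Lemma lmonoZ k c (u : V) : lmono k (c *: u) = c *: lmono k u.
Proof. exact/linZ/lmono_linear. Qed.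
Lemma lmono0 k : lmono k (0 : V) = 0.
Proof. exact/lin0/lmono_linear. Qed.

(** One formula for all ghost numbers, in terms of the light monomials; outside 0, ..., 3 the sum is
    empty. *)
Definition Fsum (v : seq nat -> V) (i : int) : W :=
  \sum_(s <- lights | (size s)%:Z == i) lmono (hexp s)%:Z (v s) ⊗ cmon s.

Definition Fcoef (v : seq nat -> V) := forall s, s \in lights -> Vn (vwt s) (v s).

Lemma Fsum_nat v (n : nat) :
  Fsum v n%:Z = \sum_(s <- lights | size s == n) lmono (hexp s)%:Z (v s) ⊗ cmon s.
Proof. by apply: eq_bigl => s; rewrite eqz_nat. Qed.

Lemma Fsum0 v : Fsum v 0 = lmono 0 (v [::]) ⊗ vac G.
Proof. by rewrite (Fsum_nat v 0) !big_cons big_nil /= addr0. Qed.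

Lemma Fsum1 v : Fsum v 1 = lmono 0 (v [:: 0%N]) ⊗ gc G + lmono 1 (v [:: 1%N]) ⊗ gdc G.
Proof. by rewrite (Fsum_nat v 1) !big_cons big_nil /= addr0 gcE. Qed.

Lemma Fsum2 v : Fsum v 2 = lmono 1 (v [:: 0; 1]%N) ⊗ gcdc G
  + lmono 1 (2^-1 *: v [:: 0; 2]%N) ⊗ gcddc G.
Proof.
rewrite (Fsum_nat v 2) !big_cons big_nil /= addr0 gcddcE lmonoZ.
by rewrite (bilinZl bT) (bilinZr bT) scalerA mulVf ?pnatr_eq0 // scale1r.
Qed.

Lemma Fsum3 v : Fsum v 3 = lmono 2 (2^-1 *: v [:: 0; 1; 2]%N) ⊗ gcdcddc G.
Proof.
rewrite (Fsum_nat v 3) !big_cons big_nil /= addr0 gcdcddcE lmonoZ.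
by rewrite (bilinZl bT) (bilinZr bT) scalerA mulVf ?pnatr_eq0 // scale1r.
Qed.

Lemma Fsum_other v i : (forall n : nat, i = n%:Z -> (3 < n)%N) -> Fsum v i = 0.
Proof.
move=> i3; rewrite /Fsum big_seq_cond big1 // => s /andP[sl /eqP si].
have := i3 _ (esym si); rewrite ltnNge => /negP[].
by move: s sl {si}; apply: lights_ind.
Qed.

Lemma half2 (u : V) : 2^-1 *: (2 *: u) = u.
Proof. by rewrite scalerA mulVf ?pnatr_eq0 // scale1r. Qed.

Lemma FE i x : F i x <-> exists2 v, Fcoef v & x = Fsum v i.
Proof.
(* Coefficients that depend on the weight alone suffice, since no ghost number has two light
   monomials of the same weight. *)
have Fz u w : Vn 1 w -> Vn 0 u -> Fcoef (fun s => if vwt s == 1%N then w else u).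
  by move=> wV uV; apply: lights_ind.
case: i => [[|[|[|[|n]]]]|n].
- split=> [[u uV ->]|[v vV ->]]; last by exists (v [::]); [exact: (vV [::] erefl)|rewrite Fsum0].
  by exists (fun s => if vwt s == 1%N then 0 else u);
    [apply: Fz => //; exact: (VnS _).1|rewrite Fsum0].
- split=> [[A [u [AV uV ->]]]|[v vV ->]]; last first.
    exists (v [:: 0%N]), (v [:: 1%N]); rewrite Fsum1.
    by split=> //; [exact: (vV [:: 0%N] erefl)|exact: (vV [:: 1%N] erefl)].
  by exists (fun s => if vwt s == 1%N then A else u); [exact: Fz|rewrite Fsum1].
- split=> [[A [u [AV uV ->]]]|[v vV ->]]; last first.
    exists (v [:: 0; 1]%N), (2^-1 *: v [:: 0; 2]%N); rewrite Fsum2.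
    split=> //; first exact: (vV [:: 0; 1]%N erefl).
    by apply: subspaceZ; [exact: VnS|exact: (vV [:: 0; 2]%N erefl)].
  exists (fun s => if vwt s == 1%N then A else 2 *: u); last by rewrite Fsum2 half2.
  by apply: Fz => //; apply: subspaceZ.
- split=> [[u uV ->]|[v vV ->]]; last first.
    exists (2^-1 *: v [:: 0; 1; 2]%N); last by rewrite Fsum3.
    by apply: subspaceZ; [exact: VnS|exact: (vV [:: 0; 1; 2]%N erefl)].
  exists (fun s => if vwt s == 1%N then 0 else 2 *: u); last by rewrite Fsum3 half2.
  by apply: Fz; [exact: (VnS _).1|apply: subspaceZ].
- split=> [->|[v vV ->]]; last by apply: Fsum_other => m [<-].
  by exists (fun=> 0) => [s _|]; [exact: (VnS _).1|rewrite Fsum_other // => m [<-]].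
split=> [->|[v vV ->]]; last exact: Fsum_other.
by exists (fun=> 0) => [s _|]; [exact: (VnS _).1|rewrite Fsum_other].
Qed.

Lemma F_subspace i : subspace (F i).
Proof.
split=> [|c x y /FE[v vV ->] /FE[w wV ->]]; apply/FE.
  exists (fun=> 0) => [s _|]; first exact: (VnS _).1.
  by rewrite /Fsum big1 // => s _; rewrite lmono0 (bilin0l bT).
exists (fun s => c *: v s + w s) => [s sl|].
  by apply: (VnS _).2; [exact: vV|exact: wV].
rewrite /Fsum scaler_sumr -big_split; apply: eq_bigr => s _.
by rewrite lmono_linear bT.1.
Qed.

Lemma F_tens s (v : V) i : s \in lights -> (size s)%:Z = i -> Vn (vwt s) v ->
  F i (lmono (hexp s)%:Z v ⊗ cmon s).
Proof.
move=> sl si vV; apply/FE; exists (fun t => if t == s then v else 0) => [t tl|].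
  by case: eqP => [->|_] //; exact: (VnS _).1.
rewrite /Fsum big_mkcond (bigD1_seq s) //= si !eqxx big1 ?addr0 // => t /negPf->.
by rewrite lmono0 (bilin0l bT) if_same.
Qed.

Lemma F_linear i f (S : set W) : linear f -> subspace S ->
  (forall s (v : V), s \in lights -> (size s)%:Z = i -> Vn (vwt s) v ->
     S (f (lmono (hexp s)%:Z v ⊗ cmon s))) -> forall x, F i x -> S (f x).
Proof.
move=> lf sS St x /FE[v vV ->]; rewrite (lin_sum lf) big_seq_cond.
by apply: subspace_sum => // s /andP[sl /eqP si]; apply: St => //; exact: vV.
Qed.

Lemma F_Fpoly i x : F i x -> Fpoly 0 i x.
Proof.
apply: (F_linear (f := id)) => // [|s v sl si vV]; first exact: Fpoly_subspace.
by apply: Fpoly_tens => //; rewrite add0r; apply: hgr_lmono => //; exact: (VnS _).1.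
Qed.

(** In [Fh] the power of h indexes the outer sum, in [Fpoly] it sits inside each coefficient; the
    interchange needs one bound [M] for all six monomials. *)
Lemma FhE (k : nat) i x : Fh k i x <-> Fpoly k%:Z i x.
Proof.
split=> [[N [f [fF ->]]]|[A [AV ->]]].
  apply: subspace_sum => [|j _]; first exact: Fpoly_subspace.
  apply: (Fpoly_le (k := (k + j)%N%:Z + 0)); first by lia.
  exact/Fpoly_hW/F_Fpoly.
have [N NE] : exists N : seq nat -> nat, forall s, s \in lights ->
    forall M, (N s <= M)%N -> A s = \sum_(j < M)
      lmono (k%:Z + (hexp s)%:Z + j%:Z) (A s (k%:Z + (hexp s)%:Z + j%:Z)).
  pose P s (N : nat) := s \in lights -> forall M, (N <= M)%N -> A s = \sum_(j < M)
    lmono (k%:Z + (hexp s)%:Z + j%:Z) (A s (k%:Z + (hexp s)%:Z + j%:Z)).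
  suff /boolp.choice[N NP] : forall s, exists N, P s N by exists N => s; exact: NP.
  move=> s.
  have [sl|/negP sl] := boolP (s \in lights); last by exists 0%N => /sl.
  by have [N NE] := hgr_expand_ge (AV s sl); exists N => _.
pose M := (\sum_(s <- lights) N s)%N.
exists M, (fun j => Fsum (fun s => A s (k%:Z + (hexp s)%:Z + j%:Z)) i); split=> [j|].
  by apply/FE; exists (fun s => A s (k%:Z + (hexp s)%:Z + j%:Z)) => // s sl; apply: (AV s sl).2.
rewrite /Fsum; under [RHS]eq_bigr => j _ do rewrite (lin_sum (@hW_linear _ _ _ _ _ _ W _)).
rewrite exchange_big big_seq_cond [RHS]big_seq_cond; apply: eq_bigr => s /andP[sl _].
rewrite [in LHS](NE s sl M); last by rewrite /M (bigD1_seq s) //= leq_addr.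
rewrite (bilin_suml bT); apply: eq_bigr => j _.
by rewrite hW_tens hmul_lmono; congr (lmono _ _ ⊗ _); lia.
Qed.

(** The functionals of [light_dual] extend to maps that read off the coefficient of a light
    monomial; compare the lowest powers of h. *)
Lemma F_leading_unique (k : int) i f : F i f -> Fpoly (k + 1) i (hW_ k f) -> f = 0.
Proof.
have [phi [phiP phiE]] := light_dual G.
pose Wc s : W -> laurent V := tlift (fun A a => phi s a *: A).
have bphi s : bilin (fun (A : laurent V) a => phi s a *: A).
  split=> [a|A] c x y /=.
    by rewrite scalerDr !scalerA mulrC.
  by rewrite phiP scalerDl scalerA.
have lWc s : linear (Wc s) by exact: tlift_linear.
have WcT s A a : Wc s (A ⊗ a) = phi s a *: A by exact: (tliftE _ (bphi s)).
have WcE s (B : seq nat -> laurent V) j : s \in lights -> (size s)%:Z = j ->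
    Wc s (\sum_(t <- lights | (size t)%:Z == j) B t ⊗ cmon t) = B s.
  move=> sl sj; rewrite (lin_sum (lWc s)) big_mkcond (bigD1_seq s) //= sj eqxx big_seq_cond big1.
    by rewrite addr0 WcT phiE // eqxx scale1r.
  move=> t /andP[tl ts]; case: eqP => // tj.
  rewrite WcT phiE // 1?eq_sym ?(negPf ts) ?scale0r //.
  by apply/eqP; rewrite -eqz_nat sj tj.
move=> /FE[v vV ->] [B [BV E]]; rewrite /Fsum big_seq_cond big1 // => s /andP[sl /eqP si].
have := congr1 (Wc s) E; rewrite WcE // /Fsum (lin_sum (@hW_linear _ _ _ _ _ _ W _)).
under eq_bigr => t _ do rewrite hW_tens hmul_lmono.
rewrite (WcE s (fun t => lmono (k + (hexp t)%:Z) (v t))) // => /(congr1 (fun A : laurent V => A (k + (hexp s)%:Z))).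
rewrite /= eqxx => ->; rewrite (BV s sl).1 ?lmono0 ?(bilin0l bT) //; lia.
Qed.

Lemma F_eq (k : int) i f g : F i f -> F i g -> Fpoly (k + 1) i (hW_ k f - hW_ k g) -> f = g.
Proof.
move=> Ff Fg; rewrite -(linB (@hW_linear _ _ _ _ _ _ W _)) => Ffg.
apply/eqP; rewrite -subr_eq0; apply/eqP/(F_leading_unique _ Ffg).
by apply: (subspaceB (F_subspace i)).
Qed.

(** The first term of an expansion, or 0 if there is none, is a witness, so [xget] returns a genuine
    leading coefficient and not its default. *)
Lemma leadP (k : nat) i x : Fpoly k%:Z i x ->
  F i (lead k i x) /\ Fpoly (k%:Z + 1) i (x - hW_ k%:Z (lead k i x)).
Proof.
move=> Fx; have S := Fpoly_subspace W (k%:Z + 1) i.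
suff [f fP] : exists f, [set f | F i f /\ Fh k.+1 i (x - hW_ k%:Z f)] f.
  have [Fl /FhE] := xgetPex 0 (ex_intro _ f fP); rewrite -/(lead k i x) => Fxl.
  by split=> //; rewrite addrC -intS.
move: Fx => /FhE[[|N] [f [fF ->]]].
  exists 0; split; first exact: (F_subspace i).1.
  rewrite big_ord0 sub0r (lin0 (@hW_linear _ _ _ _ _ _ W _)) oppr0.
  by apply/FhE; exact: (Fpoly_subspace _ _ _).1.
exists (f 0%N); split=> //; rewrite big_ord_recl addn0 addrAC subrr add0r.
exists N, (fun j => f j.+1); split=> //; apply: eq_bigr => j _.
by rewrite /bump /= addnCA add1n.
Qed.

End LeadingParts.

(** * The Lian-Zuckerman relations *)

Section Signs.
Variable K : numFieldType.
Local Notation sg d := ((-1 : K) ^ (d : int)).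

Lemma sgD (i j : int) : sg (i + j) = sg i * sg j.
Proof. by rewrite expfzDr // oppr_eq0 oner_eq0. Qed.

Lemma sg1 : sg 1 = -1. Proof. exact: expr1z. Qed.

Lemma sgN1 : sg (-1) = -1. Proof. by rewrite -exprnN expr1 invrN invr1. Qed.

Lemma sgS (i : int) : sg (i + 1) = - sg i.
Proof. by rewrite sgD sg1 mulrN1. Qed.

Lemma sgP (i : int) : sg (i - 1) = - sg i.
Proof. by rewrite -[in RHS](subrK 1 i) sgS opprK. Qed.

Lemma sgB (i j : int) : sg (i - j) = sg i * sg j.
Proof.
rewrite sgD; congr (_ * _); case: j => n; rewrite ?NegzE ?opprK -exprnN invr_sign //.
Qed.

Lemma sg_odd (i : int) : (-1 : K) ^+ (odd `|i|) = sg i.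
Proof.
by rewrite signr_odd; case: i => n //; rewrite NegzE -exprnN invr_sign abszN.
Qed.

Lemma sg_andb (i j : int) : (-1 : K) ^+ (odd `|i| && odd `|j|) = sg (i * j).
Proof. by rewrite -oddM -abszM sg_odd. Qed.

Lemma sg_cases (i : int) : sg i = 1 \/ sg i = -1.
Proof. by rewrite -sg_odd; case: odd; [right|left]. Qed.

Lemma sg_sq (i : int) : sg i * sg i = 1.
Proof. by case: (sg_cases i) => ->; rewrite ?mulr1 ?mulrNN ?mulr1. Qed.
End Signs.

Section LianZuckermanRelations.
Variables (K : numFieldType) (V : lmodType K) (Vn : nat -> set V).
Variables (Y : voa_formal Vn) (L : lmodType K) (G : ghost_vsa L).
Variable W : tensor_vsa Y G.

Local Notation "A ⊗ a" := (tens W A a) (at level 40).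
Local Notation "x ⟪ n ⟫ y" := (nprod (tv_vsa W) n x y)
  (at level 45, n at level 99, y at next level, format "x  ⟪ n ⟫  y").
Local Notation om := (vf_omega Y).
Local Notation cmon := (cmon G).
Local Notation hW_ := (hW (W := W)).
Local Notation bm1 := (Defs.bW (W := W) (-1)).
Local Notation b0 := (Defs.bW (W := W) 0).
Local Notation F := (F W).
Local Notation Q := (Q W).
Local Notation Fpoly := (Fpoly (W := W)).
Local Notation sg d := ((-1 : K) ^ (d : int)).
Let bN := nprod_bilin (tv_vsa W).
Let bT := tens_bilin W.
Let VnS := Vn_subspace Y.
Let Ql : linear Q := @Q_linear _ _ _ _ _ _ W.
Let hl k : linear (hW_ k) := @hW_linear _ _ _ _ _ _ W k.
Implicit Types (x y z a : W) (i j k l : int).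

(** * The differentials on the rescaled complex *)

Lemma Lm1_lmono (u : V) : Vn 0 u ->
  exists2 B, Vn 1 B & forall k, nprod Y 0 om (lmono k u) = lmono k B.
Proof.
move=> uV; have [B BE] := vf_Lm1 Y u; exists B => [|k]; last first.
  by rewrite lmonoE nprod_hmulr BE -lmonoE.
have := (hgr_Lm1 Y (hgr_lmono 0 (VnS _).1 uV)).2 0.
by rewrite BE.
Qed.

Lemma L1_lmono (A : V) : Vn 1 A ->
  exists2 B, Vn 0 B & forall k, nprod Y 2 om (lmono k A) = lmono (k + 1) B.
Proof.
move=> AV; have [B BE] := vf_L1 Y AV; exists B => [|k]; last first.
  by rewrite lmonoE nprod_hmulr BE hmul_lmono.
have := (hgr_L1 Y (hgr_lmono 0 (VnS _).1 AV)).2 1.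
by rewrite BE.
Qed.

Lemma wt_lmono n k (v : V) : Vn n v -> forall j, Vn n ((lmono k v : laurent V) j).
Proof. by move=> vV j /=; case: ifP => // _; exact: (VnS _).1. Qed.

Section BRSTValues.
Variable A : laurent V.

Lemma Q_1 : (forall j, Vn 0 (A j)) ->
  Q (A ⊗ cmon [::]) = nprod Y 0 om A ⊗ cmon [:: 0%N].
Proof.
move=> AV; rewrite (@Q_light _ _ _ _ _ _ W [::]) //=.
by rewrite (nprod_weight_neg Y (n := 2) (omega_weight Y) AV) // (bilin0l bT) (bilin0r bT) !addr0.
Qed.

Lemma Q_c : (forall j, Vn 1 (A j)) ->
  Q (A ⊗ cmon [:: 0%N]) = - (nprod Y 2 om A ⊗ cmon [:: 0; 2]%N).
Proof.
move=> AV; rewrite (@Q_light _ _ _ _ _ _ W [:: 0%N]) //=.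
by rewrite cmode_sq cmode_anticomm (bilinNr bT) !(bilin0r bT) add0r addr0.
Qed.

Lemma Q_dc : (forall j, Vn 0 (A j)) ->
  Q (A ⊗ cmon [:: 1%N]) =
  nprod Y 0 om A ⊗ cmon [:: 0; 1]%N + 2 *: (A ⊗ cmon [:: 0; 2]%N).
Proof.
move=> AV; rewrite (@Q_light _ _ _ _ _ _ W [:: 1%N]) //=.
by rewrite (nprod_weight_neg Y (n := 2) (omega_weight Y) AV) // (bilin0l bT) addr0 (bilinZr bT).
Qed.

Lemma Q_cdc : (forall j, Vn 1 (A j)) ->
  Q (A ⊗ cmon [:: 0; 1]%N) = nprod Y 2 om A ⊗ cmon [:: 0; 1; 2]%N.
Proof.
move=> AV; rewrite (@Q_light _ _ _ _ _ _ W [:: 0; 1]%N) //=.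
rewrite cmode_sq (cmode_anticomm G 2 0) (cmode_anticomm G 2 1) cmodeN opprK.
by rewrite !(bilin0r bT) add0r addr0.
Qed.

Lemma Q_cddc : (forall j, Vn 0 (A j)) -> Q (A ⊗ cmon [:: 0; 2]%N) = 0.
Proof.
move=> AV; rewrite (@Q_light _ _ _ _ _ _ W [:: 0; 2]%N) //=.
rewrite (nprod_weight_neg Y (n := 2) (omega_weight Y) AV) // (bilin0l bT).
by rewrite cmode_sq !(bilin0r bT) !addr0.
Qed.

Lemma Q_cdcddc : (forall j, Vn 0 (A j)) -> Q (A ⊗ cmon [:: 0; 1; 2]%N) = 0.
Proof.
move=> AV; rewrite (@Q_light _ _ _ _ _ _ W [:: 0; 1; 2]%N) //=.
rewrite (nprod_weight_neg Y (n := 2) (omega_weight Y) AV) // (bilin0l bT).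
by rewrite cmode_sq !(bilin0r bT) !addr0.
Qed.

End BRSTValues.

(** Sharper than [Fpoly_Q]: F itself is preserved, not only F[h], because L_(-1) and L_1 are
    homogeneous in h, of degrees 0 and 1, on the states concerned. *)
Lemma F_Q i a : F i a -> F (i + 1) (Q a).
Proof.
move: a; apply: F_linear => [||s v sl <-]; [exact: Q_linear|exact: F_subspace|].
have S j := F_subspace W j.
move: s sl v; apply: lights_ind => v vV; have vV' := wt_lmono _ vV.
- have [B BV BE] := Lm1_lmono vV.
  by rewrite Q_1 // BE; apply: (@F_tens _ _ _ _ _ _ W [:: 0%N]).
- have [B BV BE] := L1_lmono vV.
  by rewrite Q_c // BE; apply: (subspaceN (S _)); apply: (@F_tens _ _ _ _ _ _ W [:: 0; 2]%N).
- have [B BV BE] := Lm1_lmono vV; rewrite Q_dc // BE; apply: (subspaceD (S _)).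
    exact: (@F_tens _ _ _ _ _ _ W [:: 0; 1]%N).
  by apply: (subspaceZ (S _)); apply: (@F_tens _ _ _ _ _ _ W [:: 0; 2]%N).
- have [B BV BE] := L1_lmono vV.
  by rewrite Q_cdc // BE; apply: (@F_tens _ _ _ _ _ _ W [:: 0; 1; 2]%N).
- by rewrite Q_cddc //; exact: (S _).1.
- by rewrite Q_cdcddc //; exact: (S _).1.
Qed.

Lemma Q_Q i a : F i a -> Q (Q a) = 0.
Proof.
move: a; apply: (F_linear (f := fun a => Q (Q a)) (S := fun x => x = 0)).
- by move=> c x y; rewrite !Q_linear.
- by split=> // c x y -> ->; rewrite scaler0 addr0.
have Q0 : Q 0 = 0 by exact: (bilin0r (bN _)).
move=> s v sl _; move: s sl v; apply: lights_ind => v vV; have vV' := wt_lmono _ vV.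
- rewrite Q_1 // Q_c; first by rewrite (L1_Lm1 Y (vV' _)) (bilin0l bT) oppr0.
  by apply: (nprod_weight Y (omega_weight Y) (vV' _)).
- rewrite Q_c // (linN Ql) Q_cddc ?oppr0 //.
  by apply: (nprod_weight Y (omega_weight Y) (vV' _)).
- rewrite Q_dc // (linD Ql) (linZ Ql) Q_cddc // scaler0 addr0.
  rewrite Q_cdc; first by rewrite (L1_Lm1 Y (vV' _)) (bilin0l bT).
  by apply: (nprod_weight Y (omega_weight Y) (vV' _)).
- rewrite Q_cdc // Q_cdcddc //.
  by apply: (nprod_weight Y (omega_weight Y) (vV' _)).
- by rewrite Q_cddc.
- by rewrite Q_cdcddc.
Qed.

Local Notation beta := (beta W).

Lemma betaE a : beta a = hW_ (-1) (b0 a). Proof. by []. Qed.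

Lemma beta_linear : linear beta.
Proof. by move=> c x y; rewrite !betaE bW_linear hW_linear. Qed.

Lemma hW_beta a : hW_ 1 (beta a) = b0 a.
Proof. by rewrite betaE hW_hW addrN hW0. Qed.

Lemma beta_tens (A : laurent V) s : s \in lights ->
  beta (A ⊗ cmon s) = - hmul (-1) A ⊗ b0_val G s.
Proof.
by move=> sl; rewrite betaE bW_tens hW_tens b0_light // (bilinNr bT) (bilinNl bT).
Qed.

Lemma F_beta i a : F i a -> F (i - 1) (beta a).
Proof.
move: a; apply: F_linear => [||s v sl <-]; [exact: beta_linear|exact: F_subspace|].
have S j := F_subspace W j.
move: s sl v; apply: lights_ind => v vV; rewrite beta_tens // hmul_lmono (bilinNl bT) [b0_val _ _]/=.
- by rewrite (bilin0r bT) oppr0; exact: (S _).1.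
- by rewrite (bilin0r bT) oppr0; exact: (S _).1.
- by rewrite (bilinNr bT) opprK; apply: (@F_tens _ _ _ _ _ _ W [::]).
- by apply: (subspaceN (S _)); apply: (@F_tens _ _ _ _ _ _ W [:: 0%N]).
- by rewrite (bilin0r bT) oppr0; exact: (S _).1.
- by apply: (subspaceN (S _)); apply: (@F_tens _ _ _ _ _ _ W [:: 0; 2]%N).
Qed.

Lemma beta_beta a : beta (beta a) = 0.
Proof. by rewrite !betaE bW_hW bW_bW !(lin0 (hl _)). Qed.

(** The anticommutator of Q and b_0 is the total L_0, which is 0 on light modes; this is checked on
    each monomial. *)
Lemma Q_beta i a : F i a -> Q (beta a) + beta (Q a) = 0.
Proof.
move: a; apply: (F_linear (f := fun a => Q (beta a) + beta (Q a)) (S := fun x => x = 0)).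
- by move=> c x y; rewrite beta_linear !Q_linear beta_linear scalerDr addrACA.
- by split=> // c x y -> ->; rewrite scaler0 addr0.
have Q0 : Q 0 = 0 by exact: (lin0 Ql).
have beta0 : beta 0 = 0 by exact: (lin0 beta_linear).
have betaN x : beta (- x) = - beta x by exact: (linN beta_linear).
have QN x : Q (- x) = - Q x by exact: (linN Ql).
move=> s v sl _; move: s sl v; apply: lights_ind => v vV; have vV' := wt_lmono _ vV.
all: rewrite beta_tens //= ?(bilin0r bT) ?hmul_lmono.
- by rewrite Q_1 // beta_tens //= (bilin0r bT) Q0 addr0.
- by rewrite Q_c // betaN beta_tens //= (bilin0r bT) Q0 oppr0 addr0.
- rewrite (bilinNl bT) (bilinNr bT) opprK Q_dc // (linD beta_linear) (linZ beta_linear).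
  rewrite !beta_tens //= (bilin0r bT) scaler0 addr0 Q_1; last exact: wt_lmono.
  by rewrite -nprod_hmulr hmul_lmono (bilinNl bT) addrN.
- rewrite Q_cdc // beta_tens //= !(bilinNl bT) QN Q_c; last exact: wt_lmono.
  by rewrite opprK -nprod_hmulr hmul_lmono addrN.
- by rewrite Q_cddc // Q0 beta0 addr0.
- rewrite Q_cdcddc // beta0 addr0 (bilinNl bT) QN Q_cddc ?oppr0 //; exact: wt_lmono.
Qed.

(* The operations m and n on light modes, where only the term i = 0 of the defining
   sums survives. *)
Definition mfull x y := bm1 (x ⟪0⟫ y).

Definition nfull (i j : int) x y z :=
  bm1 x ⟪-1⟫ (y ⟪0⟫ z) + sg (i * j) *: (bm1 y ⟪-1⟫ (x ⟪0⟫ z)).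

Lemma mopE k i l j x y : Fpoly k i x -> Fpoly l j y -> mop x y = mfull x y.
Proof.
move=> Fx Fy; rewrite /mop (fsbig_ord_vanish (N := 1)) => [|n n1]; last first.
  rewrite (Fpoly_nprod_pos _ Fx Fy) //.
  by rewrite (lin0 (@bW_linear _ _ _ _ _ _ W _)) (bilin0l (bN _)) scaler0.
by rewrite big_ord1 /= expr0 divr1 scale1r sub0r vac_right.
Qed.

Lemma nop3E k1 k2 k3 i j l x y z : Fpoly k1 i x -> Fpoly k2 j y -> Fpoly k3 l z ->
  nop3 i j x y z = nfull i j x y z.
Proof.
move=> Fx Fy Fz; rewrite /nop3 /nfull !(fsbig_ord_vanish (N := 1)); last first.
- by move=> n n1; rewrite (Fpoly_nprod_pos _ Fy Fz) // (bilin0r (bN _)) scaler0.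
- by move=> n n1; rewrite (Fpoly_nprod_pos _ Fx Fz) // (bilin0r (bN _)) scaler0.
by rewrite !big_ord1 /= invr1 !scale1r !sub0r.
Qed.

(** * Relations of the full operations on light modes *)

Lemma mu_Q k i x y : Fpoly k i x ->
  Q (x ⟪-1⟫ y) = Q x ⟪-1⟫ y + sg i *: (x ⟪-1⟫ Q y).
Proof. by move=> Fx; rewrite (Q_derivation _ _ (Fpoly_par Fx)) sg_odd. Qed.

Lemma bm1_par k i x : Fpoly k i x -> vpar (tv_vsa W) (odd (absz (i - 1)%R)) (bm1 x).
Proof.
move=> Fx; have := bW_par (-1) (Fpoly_par Fx); congr (vpar _ _ _); lia.
Qed.

(** The supercommutator of the modes of index -1, evaluated on the vacuum, is the translate of
    [x ⟪0⟫ y], and translation is the anticommutator of Q with b_(-1). *)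
Lemma mfull_Q k1 i k2 j x y : Fpoly k1 i x -> Fpoly k2 j y ->
  x ⟪-1⟫ y - sg (i * j) *: (y ⟪-1⟫ x) =
  Q (mfull x y) + mfull (Q x) y + sg i *: mfull x (Q y).
Proof.
move=> Fx Fy; have := commutator (vac (tv_vsa W)) (-1) (-1) (N := 1)
  (Fpoly_par Fx) (Fpoly_par Fy) (fun n n1 =>
  @Fpoly_nprod_pos _ _ _ _ _ _ W _ _ _ _ n%:Z _ _ n1 Fx Fy).
rewrite !vac_right sg_andb big_ord1 /= binz0 scale1r => ->.
rewrite /mfull -[RHS]addrA -(linZ (@bW_linear _ _ _ _ _ _ W _)) -(linD (@bW_linear _ _ _ _ _ _ W _)).
by rewrite -sg_odd -(Q_derivation _ _ (Fpoly_par Fx)) Q_bm1.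
Qed.

(** The associator formula stops after j = 1, and modes of index -2 are modes of index -1 of
    translates. *)
Lemma mu_assoc k1 k2 k3 i j l x y z : Fpoly k1 i x -> Fpoly k2 j y -> Fpoly k3 l z ->
  (x ⟪-1⟫ y) ⟪-1⟫ z - x ⟪-1⟫ (y ⟪-1⟫ z) =
  vT (tv_vsa W) x ⟪-1⟫ (y ⟪0⟫ z) + sg (i * j) *: (vT (tv_vsa W) y ⟪-1⟫ (x ⟪0⟫ z)).
Proof.
move=> Fx Fy Fz.
rewrite (associator (N := 2) _ (Fpoly_par Fx) (Fpoly_par Fy)); last first.
  by move=> n n2; split; [apply: (Fpoly_nprod_pos _ Fx Fz)|apply: (Fpoly_nprod_pos _ Fy Fz)]; lia.
rewrite !big_ord_recl big_ord0 addr0 /= !binzN1 !expr0 mulr1 scale1r sg_andb.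
rewrite (Fpoly_nprod_pos (n := (bump 0 0)%:Z) _ Fx Fz) // (bilin0r (bN _)) scaler0 !subr0.
rewrite sgN1 mulrN1 scaleNr opprK -expr2 sqrr_sign scale1r addr0.
by rewrite !vT_nprod !scale1r [LHS]addrC -[X in - _ + X]addrA addKr [LHS]addrC.
Qed.

(** Replacing T by Q b_(-1) + b_(-1) Q in the associator produces the commutator of Q with
    [nfull]. *)
Lemma nfull_Q k1 k2 k3 i j l x y z : Fpoly k1 i x -> Fpoly k2 j y -> Fpoly k3 l z ->
  Q (nfull i j x y z) + nfull (i + 1) j (Q x) y z + sg i *: nfull i (j + 1) x (Q y) z
    + sg (i + j) *: nfull i j x y (Q z) =
  (x ⟪-1⟫ y) ⟪-1⟫ z - x ⟪-1⟫ (y ⟪-1⟫ z).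
Proof.
move=> Fx Fy Fz; rewrite (mu_assoc Fx Fy Fz) -!Q_bm1 /nfull.
rewrite !(linD Ql) !(linZ Ql) !(bilinDl (bN _)).
rewrite !(Q_derivation _ _ (bm1_par Fx)) !(Q_derivation _ _ (bm1_par Fy)).
rewrite !(Q_derivation _ _ (Fpoly_par Fx)) !(Q_derivation _ _ (Fpoly_par Fy)).
rewrite !sg_odd !sgP mulrDl mulrDr mul1r mulr1 !sgD !(bilinDr (bN _)) !(bilinZr (bN _)).
case: (sg_cases K i) => ->; case: (sg_cases K j) => ->; case: (sg_cases K (i * j)) => ->.
all: lin_identity K W.
Qed.

Lemma brk_b0 k i x y : Fpoly k i x ->
  bm1 x ⟪0⟫ y = b0 (x ⟪-1⟫ y) - b0 x ⟪-1⟫ y - sg i *: (x ⟪-1⟫ b0 y).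
Proof.
move=> Fx.
rewrite (b0_commutator _ _ (Fpoly_par Fx)) sg_odd.
by rewrite [RHS]addrAC [X in X - _]addrK [RHS]addrK.
Qed.

Lemma brkE i x y : brk i x y = sg i *: (bm1 x ⟪0⟫ y).
Proof. by []. Qed.

Lemma brk_mu k1 k2 i j x y z : Fpoly k1 i x -> Fpoly k2 j y ->
  brk i x (y ⟪-1⟫ z) = brk i x y ⟪-1⟫ z + sg ((i - 1) * j) *: (y ⟪-1⟫ brk i x z).
Proof.
move=> Fx Fy; rewrite !brkE (zero_mode_derivation _ _ (bm1_par Fx) (Fpoly_par Fy)) sg_andb.
by rewrite scalerDr (bilinZl (bN _)) (bilinZr (bN _)) !scalerA mulrC.
Qed.

(** The zero modes of b_(-1) x and b_(-1) y have as supercommutator the zero mode of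
    [bm1 x ⟪0⟫ bm1 y], which is up to sign b_(-1) of the bracket because b_(-1) squares to 0. *)
Lemma brk_jacobi k1 k2 i j x y z : Fpoly k1 i x -> Fpoly k2 j y ->
  brk (i + j - 1) (brk i x y) z - brk i x (brk j y z)
    + sg ((i - 1) * (j - 1)) *: brk j y (brk i x z) = 0.
Proof.
move=> Fx Fy; rewrite !brkE !(linZ (@bW_linear _ _ _ _ _ _ W _)) !(bilinZl (bN _)) !(bilinZr (bN _)).
rewrite (bm1_derivation _ _ (bm1_par Fx)) bW_bW (bilin0l (bN _)) add0r sg_odd.
rewrite (bilinZl (bN _)) (zero_mode_derivation _ _ (bm1_par Fx) (bm1_par Fy)) sg_andb.
rewrite !sgP !sgD.
case: (sg_cases K i) => ->; case: (sg_cases K j) => ->.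
all: by case: (sg_cases K ((i - 1) * (j - 1))) => ->; lin_identity K W.
Qed.

(** Congruence modulo h^k F_i[h], through which identities of the full operations descend; [F_eq]
    turns it back into equality of leading coefficients. *)
Definition eqF k i x y := Fpoly k i (x - y).

Let FpS k i : subspace (Fpoly k i) := Fpoly_subspace W k i.

Lemma eqF_refl k i x : eqF k i x x.
Proof. by rewrite /eqF subrr; exact: (FpS _ _).1. Qed.

Lemma eqF_sym k i x y : eqF k i x y -> eqF k i y x.
Proof. by move=> xy; rewrite /eqF -opprB; apply: (subspaceN (FpS _ _)). Qed.

Lemma eqF_trans k i y x z : eqF k i x y -> eqF k i y z -> eqF k i x z.
Proof.
by move=> xy yz; rewrite /eqF -(subrK y x) -addrA; apply: (subspaceD (FpS _ _)).
Qed.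

Lemma eqF_add k i x x' y y' : eqF k i x x' -> eqF k i y y' -> eqF k i (x + y) (x' + y').
Proof. by move=> xy yz; rewrite /eqF opprD addrACA; apply: (subspaceD (FpS _ _)). Qed.

Lemma eqF_scale k i c x x' : eqF k i x x' -> eqF k i (c *: x) (c *: x').
Proof. by move=> xy; rewrite /eqF -scalerBr; apply: (subspaceZ (FpS _ _)). Qed.

Lemma eqF_sub k i x x' y y' : eqF k i x x' -> eqF k i y y' -> eqF k i (x - y) (x' - y').
Proof. by move=> xy yz; rewrite -!scaleN1r; apply/eqF_add/eqF_scale. Qed.

(** Degrees such as i + 1 + j and i + j + 1 are equal without being convertible. *)
Lemma eqF_idx i k i' x y : i = i' -> eqF k i x y -> eqF k i' x y.
Proof. by move->. Qed.

Lemma eqF_hW k l i x y : eqF k i x y -> eqF (l + k) i (hW_ l x) (hW_ l y).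
Proof. by move=> xy; rewrite /eqF -(linB (hl l)); apply: Fpoly_hW. Qed.

Lemma eqF_Q k i x y : eqF k i x y -> eqF k (i + 1) (Q x) (Q y).
Proof. by move=> xy; rewrite /eqF -(linB Ql); apply: Fpoly_Q. Qed.

Lemma Fpoly_beta k i x : Fpoly k i x -> Fpoly k (i - 1) (beta x).
Proof.
move=> /Fpoly_b0/(Fpoly_hW (-1)); rewrite (_ : -1 + (k + 1) = k) //; lia.
Qed.

Lemma eqF_beta k i x y : eqF k i x y -> eqF k (i - 1) (beta x) (beta y).
Proof. by move=> xy; rewrite /eqF -(linB beta_linear); apply: Fpoly_beta. Qed.

Lemma eqF_mul k l i j x x' y : eqF k i x x' -> Fpoly l j y ->
  eqF (k + l) (i + j) (x ⟪-1⟫ y) (x' ⟪-1⟫ y).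
Proof. by move=> xx Fy; rewrite /eqF -(bilinBl (bN _)); apply: Fpoly_mu. Qed.

Lemma eqF_mur k l i j x y y' : Fpoly k i x -> eqF l j y y' ->
  eqF (k + l) (i + j) (x ⟪-1⟫ y) (x ⟪-1⟫ y').
Proof. by move=> Fx yy; rewrite /eqF -(bilinBr (bN _)); apply: Fpoly_mu. Qed.

Lemma Fpoly_brk k i l j d x y : Fpoly k i x -> Fpoly l j y ->
  Fpoly (k + l + 1) (i + j - 1) (brk d x y).
Proof. by move=> Fx Fy; rewrite brkE; apply: (subspaceZ (FpS _ _)); apply: Fpoly_bm1_nprod0. Qed.

Lemma brk_bilin d : bilin (brk d : W -> W -> W).
Proof.
split=> [y|x] c u v; rewrite !brkE.
  by rewrite (bm1_bilin W _).1 scalerDr !scalerA mulrC.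
by rewrite (bm1_bilin W _).2 scalerDr !scalerA mulrC.
Qed.

Lemma eqF_brkl k l i j d x x' y : eqF k i x x' -> Fpoly l j y ->
  eqF (k + l + 1) (i + j - 1) (brk d x y) (brk d x' y).
Proof. by move=> xx Fy; rewrite /eqF -(bilinBl (brk_bilin d)); apply: Fpoly_brk. Qed.

Lemma eqF_brkr k l i j d x y y' : Fpoly k i x -> eqF l j y y' ->
  eqF (k + l + 1) (i + j - 1) (brk d x y) (brk d x y').
Proof. by move=> Fx yy; rewrite /eqF -(bilinBr (brk_bilin d)); apply: Fpoly_brk. Qed.

Lemma brk_hWl k d x y : brk d (hW_ k x) y = hW_ k (brk d x y).
Proof. by rewrite !brkE bW_hW nprod_hWl (linZ (hl _)). Qed.

Lemma brk_hWr k d x y : brk d x (hW_ k y) = hW_ k (brk d x y).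
Proof. by rewrite !brkE nprod_hWr (linZ (hl _)). Qed.

Lemma Fpoly_mfull k l i j x y : Fpoly k i x -> Fpoly l j y ->
  Fpoly (k + l) (i + j - 1) (mfull x y).
Proof. by move=> Fx Fy; apply/Fneg_bm1/Fneg_nprod0. Qed.

Lemma Fpoly_nfull k1 k2 k3 i j l x y z : Fpoly k1 i x -> Fpoly k2 j y -> Fpoly k3 l z ->
  Fpoly (k1 + k2 + k3) (i + j + l - 1) (nfull i j x y z).
Proof.
move=> Fx Fy Fz; apply: (subspaceD (FpS _ _)).
  by have := Fpoly_bm1_Fneg Fx (Fneg_nprod0 Fy Fz); rewrite !addrA.
apply: (subspaceZ (FpS _ _)); have := Fpoly_bm1_Fneg Fy (Fneg_nprod0 Fx Fz).
by rewrite !addrA (addrC k2) (addrC j).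
Qed.

Lemma mfull_bilin : bilin mfull.
Proof.
split=> [y|x] c u v; rewrite /mfull.
  by rewrite (bN _).1 bW_linear.
by rewrite (bN _).2 bW_linear.
Qed.

Lemma nfull_lin1 i j y z : linear (fun x => nfull i j x y z).
Proof.
move=> c u v; rewrite /nfull (bm1_bilin W _).1 (bN 0).1 (bm1_bilin W _).2.
lin_identity K W.
Qed.

Lemma nfull_lin2 i j x z : linear (fun y => nfull i j x y z).
Proof.
move=> c u v; rewrite /nfull (bm1_bilin W _).1 (bN 0).1 (bm1_bilin W _).2.
lin_identity K W.
Qed.

Lemma nfull_lin3 i j x y : linear (nfull i j x y).
Proof.
move=> c u v; rewrite /nfull !(bN 0).2 !(bm1_bilin W _).2.
lin_identity K W.
Qed.

(** * Leading coefficients of the operations *)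

Lemma lead_eqF (k : nat) i x : Fpoly k%:Z i x ->
  F i (lead k i x) /\ eqF (k%:Z + 1) i (hW_ k%:Z (lead k i x)) x.
Proof. by move=> /leadP[Fl xl]; split=> //; apply: eqF_sym. Qed.

Lemma mu0P i j x y : F i x -> F j y ->
  F (i + j) (mu0 W i j x y) /\ eqF 1 (i + j) (mu0 W i j x y) (x ⟪-1⟫ y).
Proof.
move=> /F_Fpoly Fx /F_Fpoly Fy.
by have := lead_eqF (k := 0) (Fpoly_mu Fx Fy); rewrite hW0.
Qed.

Lemma brk0P i j x y : F i x -> F j y ->
  F (i + j - 1) (brk0 W i j x y) /\ eqF 2 (i + j - 1) (hW_ 1 (brk0 W i j x y)) (brk i x y).
Proof. by move=> /F_Fpoly Fx /F_Fpoly Fy; exact: (lead_eqF (k := 1) (Fpoly_brk i Fx Fy)). Qed.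

Lemma m0P i j x y : F i x -> F j y ->
  F (i + j - 1) (m0 W i j x y) /\ eqF 1 (i + j - 1) (m0 W i j x y) (mfull x y).
Proof.
move=> /F_Fpoly Fx /F_Fpoly Fy.
by have := lead_eqF (k := 0) (Fpoly_mfull Fx Fy); rewrite hW0 /m0 (mopE Fx Fy).
Qed.

Lemma n0P i j l x y z : F i x -> F j y -> F l z ->
  F (i + j + l - 1) (n0 W i j l x y z) /\
  eqF 1 (i + j + l - 1) (n0 W i j l x y z) (nfull i j x y z).
Proof.
move=> /F_Fpoly Fx /F_Fpoly Fy /F_Fpoly Fz.
by have := lead_eqF (k := 0) (Fpoly_nfull Fx Fy Fz); rewrite hW0 /n0 (nop3E Fx Fy Fz).
Qed.

Lemma F_eqF0 i x y : F i x -> F i y -> eqF 1 i x y -> x = y.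
Proof. by move=> Fx Fy xy; apply: (F_eq (k := 0) Fx Fy); rewrite !hW0. Qed.

Let FS i : subspace (F i) := F_subspace W i.

Lemma F_idx i i' x : i = i' -> F i x -> F i' x. Proof. by move->. Qed.

Lemma leading_parts : leading_parts_defined W.
Proof.
split.
- move=> k i f Ff /FhE; rewrite intS addrC; exact: F_leading_unique.
- by move=> i j x y /F_Fpoly Fx /F_Fpoly Fy; apply/FhE; exact: (Fpoly_mu Fx Fy).
- by move=> i j x y /F_Fpoly Fx /F_Fpoly Fy; apply/FhE; exact: (Fpoly_brk i Fx Fy).
- by move=> i j x y /F_Fpoly Fx /F_Fpoly Fy; apply/FhE; rewrite (mopE Fx Fy); exact: (Fpoly_mfull Fx Fy).
- move=> i j l x y z /F_Fpoly Fx /F_Fpoly Fy /F_Fpoly Fz.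
  by apply/FhE; rewrite (nop3E Fx Fy Fz); exact: (Fpoly_nfull Fx Fy Fz).
Qed.

Lemma mu0_graded : graded_map2 F 0 (mu0 W).
Proof.
move=> i j; split=> [x y Fx Fy|c x x' y Fx Fx' Fy|c x y y' Fx Fy Fy'].
- by rewrite addr0; exact: (mu0P Fx Fy).1.
- have [F1 E1] := mu0P Fx Fy; have [F2 E2] := mu0P Fx' Fy.
  have [F3 E3] := mu0P ((FS i).2 c _ _ Fx Fx') Fy.
  apply: F_eqF0 F3 ((FS _).2 c _ _ F1 F2) _; apply: (eqF_trans E3).
  rewrite (bN _).1; apply/eqF_add/eqF_sym => //; exact/eqF_scale/eqF_sym.
have [F1 E1] := mu0P Fx Fy; have [F2 E2] := mu0P Fx Fy'.
have [F3 E3] := mu0P Fx ((FS j).2 c _ _ Fy Fy').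
apply: F_eqF0 F3 ((FS _).2 c _ _ F1 F2) _; apply: (eqF_trans E3).
rewrite (bN _).2; apply/eqF_add/eqF_sym => //; exact/eqF_scale/eqF_sym.
Qed.

Lemma m0_graded : graded_map2 F (-1) (m0 W).
Proof.
move=> i j; split=> [x y Fx Fy|c x x' y Fx Fx' Fy|c x y y' Fx Fy Fy'].
- exact: (m0P Fx Fy).1.
- have [F1 E1] := m0P Fx Fy; have [F2 E2] := m0P Fx' Fy.
  have [F3 E3] := m0P ((FS i).2 c _ _ Fx Fx') Fy.
  apply: F_eqF0 F3 ((FS _).2 c _ _ F1 F2) _; apply: (eqF_trans E3).
  rewrite mfull_bilin.1; apply/eqF_add/eqF_sym => //; exact/eqF_scale/eqF_sym.
have [F1 E1] := m0P Fx Fy; have [F2 E2] := m0P Fx Fy'.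
have [F3 E3] := m0P Fx ((FS j).2 c _ _ Fy Fy').
apply: F_eqF0 F3 ((FS _).2 c _ _ F1 F2) _; apply: (eqF_trans E3).
rewrite mfull_bilin.2; apply/eqF_add/eqF_sym => //; exact/eqF_scale/eqF_sym.
Qed.

Lemma n0_graded : graded_map3 F (-1) (n0 W).
Proof.
move=> i j l; split.
- by move=> x y z Fx Fy Fz; exact: (n0P Fx Fy Fz).1.
- move=> c x x' y z Fx Fx' Fy Fz.
  have [F1 E1] := n0P Fx Fy Fz; have [F2 E2] := n0P Fx' Fy Fz.
  have [F3 E3] := n0P ((FS i).2 c _ _ Fx Fx') Fy Fz.
  apply: F_eqF0 F3 ((FS _).2 c _ _ F1 F2) _; apply: (eqF_trans E3).
  rewrite nfull_lin1; apply/eqF_add/eqF_sym => //; exact/eqF_scale/eqF_sym.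
- move=> c x y y' z Fx Fy Fy' Fz.
  have [F1 E1] := n0P Fx Fy Fz; have [F2 E2] := n0P Fx Fy' Fz.
  have [F3 E3] := n0P Fx ((FS j).2 c _ _ Fy Fy') Fz.
  apply: F_eqF0 F3 ((FS _).2 c _ _ F1 F2) _; apply: (eqF_trans E3).
  rewrite nfull_lin2; apply/eqF_add/eqF_sym => //; exact/eqF_scale/eqF_sym.
move=> c x y z z' Fx Fy Fz Fz'.
have [F1 E1] := n0P Fx Fy Fz; have [F2 E2] := n0P Fx Fy Fz'.
have [F3 E3] := n0P Fx Fy ((FS l).2 c _ _ Fz Fz').
apply: F_eqF0 F3 ((FS _).2 c _ _ F1 F2) _; apply: (eqF_trans E3).
rewrite nfull_lin3; apply/eqF_add/eqF_sym => //; exact/eqF_scale/eqF_sym.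
Qed.

Lemma brk0_graded : graded_map2 F (-1) (brk0 W).
Proof.
have E (i j : int) x y z c : F (i + j - 1) x -> F (i + j - 1) y -> F (i + j - 1) z ->
    eqF 2 (i + j - 1) (hW_ 1 z) (c *: hW_ 1 x + hW_ 1 y) -> z = c *: x + y.
  move=> Fx Fy Fz; rewrite -hW_linear => zxy; apply: (F_eq (k := 1) Fz _ zxy).
  exact: (FS _).2.
move=> i j; split=> [x y Fx Fy|c x x' y Fx Fx' Fy|c x y y' Fx Fy Fy'].
- exact: (brk0P Fx Fy).1.
- have [F1 E1] := brk0P Fx Fy; have [F2 E2] := brk0P Fx' Fy.
  have [F3 E3] := brk0P ((FS i).2 c _ _ Fx Fx') Fy.
  apply: (E i j) F1 F2 F3 _; apply: (eqF_trans E3).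
  rewrite (brk_bilin i).1; apply/eqF_add/eqF_sym => //; exact/eqF_scale/eqF_sym.
have [F1 E1] := brk0P Fx Fy; have [F2 E2] := brk0P Fx Fy'.
have [F3 E3] := brk0P Fx ((FS j).2 c _ _ Fy Fy').
apply: (E i j) F1 F2 F3 _; apply: (eqF_trans E3).
rewrite (brk_bilin i).2; apply/eqF_add/eqF_sym => //; exact/eqF_scale/eqF_sym.
Qed.

(** * Relations of the leading coefficients *)

Lemma mu0_Q i j x y : F i x -> F j y ->
  Q (mu0 W i j x y) = mu0 W (i + 1) j (Q x) y + sg i *: mu0 W i (j + 1) x (Q y).
Proof.
move=> Fx Fy; have [F1 E1] := mu0P Fx Fy.
have [F2 E2] := mu0P (F_Q Fx) Fy; have [F3 E3] := mu0P Fx (F_Q Fy).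
apply: (F_eqF0 (F_Q F1)).
  apply: (subspaceD (FS _)); first by apply: F_idx F2; lia.
  by apply: (subspaceZ (FS _)); apply: F_idx F3; lia.
apply: (eqF_trans (eqF_Q E1)); rewrite (mu_Q _ (F_Fpoly Fx)); apply: eqF_add.
  by apply: eqF_idx (eqF_sym E2); lia.
by apply: eqF_scale; apply: eqF_idx (eqF_sym E3); lia.
Qed.

Lemma mu0_comm i j x y : F i x -> F j y ->
  mu0 W i j x y - sg (i * j) *: mu0 W j i y x =
  Q (m0 W i j x y) + m0 W (i + 1) j (Q x) y + sg i *: m0 W i (j + 1) x (Q y).
Proof.
move=> Fx Fy; have [F1 E1] := mu0P Fx Fy; have [F2 E2] := mu0P Fy Fx.
have [F3 E3] := m0P Fx Fy; have [F4 E4] := m0P (F_Q Fx) Fy.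
have [F5 E5] := m0P Fx (F_Q Fy).
apply: (@F_eqF0 (i + j)).
- by apply: (subspaceB (FS _)) => //; apply: (subspaceZ (FS _)); apply: F_idx F2; lia.
- apply: (subspaceD (FS _)); first apply: (subspaceD (FS _)).
  + by apply: F_idx (F_Q F3); lia.
  + by apply: F_idx F4; lia.
  + by apply: (subspaceZ (FS _)); apply: F_idx F5; lia.
apply: (eqF_trans (y := x ⟪-1⟫ y - sg (i * j) *: (y ⟪-1⟫ x))).
  by apply: (eqF_sub E1); apply: eqF_scale; apply: eqF_idx E2; lia.
rewrite (mfull_Q (F_Fpoly Fx) (F_Fpoly Fy)); apply: eqF_sym.
apply: eqF_add; first apply: eqF_add.
- by apply: eqF_idx (eqF_Q E3); lia.
- by apply: eqF_idx E4; lia.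
- by apply: eqF_scale; apply: eqF_idx E5; lia.
Qed.

Lemma mu0_assoc i j l x y z : F i x -> F j y -> F l z ->
  Q (n0 W i j l x y z) + n0 W (i + 1) j l (Q x) y z + sg i *: n0 W i (j + 1) l x (Q y) z
    + sg (i + j) *: n0 W i j (l + 1) x y (Q z) =
  mu0 W (i + j) l (mu0 W i j x y) z - mu0 W i (j + l) x (mu0 W j l y z).
Proof.
move=> Fx Fy Fz; have [F1 E1] := mu0P Fx Fy; have [F2 E2] := mu0P Fy Fz.
have [F3 E3] := mu0P F1 Fz; have [F4 E4] := mu0P Fx F2.
have [F5 E5] := n0P Fx Fy Fz; have [F6 E6] := n0P (F_Q Fx) Fy Fz.
have [F7 E7] := n0P Fx (F_Q Fy) Fz; have [F8 E8] := n0P Fx Fy (F_Q Fz).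
apply: (@F_eqF0 (i + j + l)).
- apply: (subspaceD (FS _)); first apply: (subspaceD (FS _)); first apply: (subspaceD (FS _)).
  + by apply: F_idx (F_Q F5); lia.
  + by apply: F_idx F6; lia.
  + by apply: (subspaceZ (FS _)); apply: F_idx F7; lia.
  + by apply: (subspaceZ (FS _)); apply: F_idx F8; lia.
- by apply: (subspaceB (FS _)) => //; apply: F_idx F4; lia.
apply: (eqF_trans (y := Q (nfull i j x y z) + nfull (i + 1) j (Q x) y z
  + sg i *: nfull i (j + 1) x (Q y) z + sg (i + j) *: nfull i j x y (Q z))).
  apply: eqF_add; first apply: eqF_add; first apply: eqF_add.
  - by apply: eqF_idx (eqF_Q E5); lia.
  - by apply: eqF_idx E6; lia.
  - by apply: eqF_scale; apply: eqF_idx E7; lia.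
  - by apply: eqF_scale; apply: eqF_idx E8; lia.
rewrite (nfull_Q (F_Fpoly Fx) (F_Fpoly Fy) (F_Fpoly Fz)); apply: eqF_sym.
apply: eqF_sub.
  by apply: (eqF_trans E3); apply: (eqF_mul E1 (F_Fpoly Fz)).
apply: eqF_idx (eqF_trans E4 (eqF_mur (F_Fpoly Fx) E2)); lia.
Qed.

Lemma F_eqF1 i x y : F i x -> F i y -> eqF 2 i (hW_ 1 x) (hW_ 1 y) -> x = y.
Proof. by move=> Fx Fy; apply: (F_eq (k := 1)). Qed.

(** The bracket starts at order h and beta contains h^(-1), so both sides are multiplied by h and
    compared modulo h^2. *)
Lemma brk0_beta i j x y : F i x -> F j y ->
  sg i *: brk0 W i j x y =
  beta (mu0 W i j x y) - mu0 W (i - 1) j (beta x) y - sg i *: mu0 W i (j - 1) x (beta y).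
Proof.
move=> Fx Fy; have [F1 E1] := mu0P Fx Fy; have [F2 E2] := brk0P Fx Fy.
have [F3 E3] := mu0P (F_beta Fx) Fy; have [F4 E4] := mu0P Fx (F_beta Fy).
apply: (@F_eqF1 (i + j - 1)).
- exact: (subspaceZ (FS _)).
- apply: (subspaceB (FS _)); first apply: (subspaceB (FS _)).
  + exact: F_beta.
  + by apply: F_idx F3; lia.
  + by apply: (subspaceZ (FS _)); apply: F_idx F4; lia.
apply: (eqF_trans (y := bm1 x ⟪0⟫ y)).
  rewrite (linZ (hl 1)); apply: (eqF_trans (eqF_scale _ E2)).
  by rewrite brkE scalerA sg_sq scale1r; exact: eqF_refl.
rewrite (brk_b0 _ (F_Fpoly Fx)) -!hW_beta nprod_hWl nprod_hWr -(linZ (hl 1)) -!(linB (hl 1)).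
apply/eqF_sym/(eqF_hW (k := 1)); apply: eqF_sub; first apply: eqF_sub.
- exact: eqF_beta.
- by apply: eqF_idx E3; lia.
- by apply: eqF_scale; apply: eqF_idx E4; lia.
Qed.

Lemma brk0_mu0 i j l x y z : F i x -> F j y -> F l z ->
  brk0 W i (j + l) x (mu0 W j l y z) =
  mu0 W (i + j - 1) l (brk0 W i j x y) z
    + sg ((i - 1) * j) *: mu0 W j (i + l - 1) y (brk0 W i l x z).
Proof.
move=> Fx Fy Fz; have [F1 E1] := mu0P Fy Fz; have [F2 E2] := brk0P Fx F1.
have [F3 E3] := brk0P Fx Fy; have [F4 E4] := mu0P F3 Fz.
have [F5 E5] := brk0P Fx Fz; have [F6 E6] := mu0P Fy F5.
apply: (F_eqF1 F2).
  apply: (subspaceD (FS _)); first by apply: F_idx F4; lia.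
  by apply: (subspaceZ (FS _)); apply: F_idx F6; lia.
apply: (eqF_trans E2); apply: (eqF_trans (eqF_brkr i (F_Fpoly Fx) E1)).
rewrite (brk_mu _ (F_Fpoly Fx) (F_Fpoly Fy)) (linD (hl 1)) (linZ (hl 1)).
apply/eqF_sym/eqF_add; last apply: eqF_scale.
  apply: (eqF_idx (i := i + j - 1 + l)); first lia.
  by apply: (eqF_trans (eqF_hW 1 E4)); rewrite -nprod_hWl; apply: (eqF_mul E3 (F_Fpoly Fz)).
apply: (eqF_idx (i := j + (i + l - 1))); first lia.
by apply: (eqF_trans (eqF_hW 1 E6)); rewrite -nprod_hWr; apply: (eqF_mur (F_Fpoly Fy) E5).
Qed.

(** Each bracket contributes one h, so double brackets are compared at order h^2, modulo h^3. *)
Lemma brk0_brk0l i j l x y z : F i x -> F j y -> F l z ->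
  F (i + j + l - 2) (brk0 W (i + j - 1) l (brk0 W i j x y) z) /\
  eqF 3 (i + j + l - 2) (hW_ 2 (brk0 W (i + j - 1) l (brk0 W i j x y) z))
    (brk (i + j - 1) (brk i x y) z).
Proof.
move=> Fx Fy Fz; have [F1 E1] := brk0P Fx Fy; have [F2 E2] := brk0P F1 Fz.
split; first by apply: F_idx F2; lia.
apply: (eqF_idx (i := i + j - 1 + l - 1)); first lia.
rewrite -(hW_hW 1 1); apply: (eqF_trans (eqF_hW 1 E2)); rewrite -brk_hWl.
exact: (eqF_brkl _ E1 (F_Fpoly Fz)).
Qed.

Lemma brk0_brk0r i j l x y z : F i x -> F j y -> F l z ->
  F (i + j + l - 2) (brk0 W i (j + l - 1) x (brk0 W j l y z)) /\
  eqF 3 (i + j + l - 2) (hW_ 2 (brk0 W i (j + l - 1) x (brk0 W j l y z)))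
    (brk i x (brk j y z)).
Proof.
move=> Fx Fy Fz; have [F1 E1] := brk0P Fy Fz; have [F2 E2] := brk0P Fx F1.
split; first by apply: F_idx F2; lia.
apply: (eqF_idx (i := i + (j + l - 1) - 1)); first lia.
rewrite -(hW_hW 1 1); apply: (eqF_trans (eqF_hW 1 E2)); rewrite -brk_hWr.
exact: (eqF_brkr _ (F_Fpoly Fx) E1).
Qed.

Lemma brk0_jacobi i j l x y z : F i x -> F j y -> F l z ->
  brk0 W (i + j - 1) l (brk0 W i j x y) z - brk0 W i (j + l - 1) x (brk0 W j l y z)
    + sg ((i - 1) * (j - 1)) *: brk0 W j (i + l - 1) y (brk0 W i l x z) = 0.
Proof.
move=> Fx Fy Fz; have [F1 E1] := brk0_brk0l Fx Fy Fz.
have [F2 E2] := brk0_brk0r Fx Fy Fz; have [] := brk0_brk0r Fy Fx Fz.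
rewrite (addrC j i) => F3 E3; apply: (F_eq (k := 2) (i := i + j + l - 2)).
- apply: (subspaceD (FS _)); first exact: (subspaceB (FS _)).
  exact: (subspaceZ (FS _)).
- exact: (FS _).1.
rewrite (lin0 (hl 2)) -(brk_jacobi z (F_Fpoly Fx) (F_Fpoly Fy)).
rewrite (linD (hl 2)) (linB (hl 2)) (linZ (hl 2)).
by apply: eqF_add; [apply: eqF_sub|apply: eqF_scale].
Qed.

End LianZuckermanRelations.

(** * Homotopy BV algebras *)

Section HomotopyBVCriterion.
Variables (K : numFieldType) (E : lmodType K) (gr : int -> set E).
Variables (Q beta : E -> E) (mu br m : int -> int -> E -> E -> E).
Variable n : int -> int -> int -> E -> E -> E -> E.
Local Notation sg d := ((-1 : K) ^ (d : int)).
Implicit Types (i j k : int) (a b c : E).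

Hypothesis grS : forall i, subspace (gr i).
Hypothesis dQ : differential gr 1 Q.
Hypothesis dbeta : differential gr (-1) beta.
Hypothesis gmu : graded_map2 gr 0 mu.
Hypothesis gbr : graded_map2 gr (-1) br.
Hypothesis gm : graded_map2 gr (-1) m.
Hypothesis gn : graded_map3 gr (-1) n.
Hypothesis Qbeta : forall i a, gr i a -> Q (beta a) + beta (Q a) = 0.
Hypothesis Qmu : forall i j a b, gr i a -> gr j b ->
  Q (mu i j a b) = mu (i + 1) j (Q a) b + sg i *: mu i (j + 1) a (Q b).
Hypothesis mu_comm : forall i j a b, gr i a -> gr j b ->
  mu i j a b - sg (i * j) *: mu j i b a =
  Q (m i j a b) + m (i + 1) j (Q a) b + sg i *: m i (j + 1) a (Q b).
Hypothesis mu_assoc : forall i j k a b c, gr i a -> gr j b -> gr k c ->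
  Q (n i j k a b c) + n (i + 1) j k (Q a) b c + sg i *: n i (j + 1) k a (Q b) c
    + sg (i + j) *: n i j (k + 1) a b (Q c) =
  mu (i + j) k (mu i j a b) c - mu i (j + k) a (mu j k b c).
Hypothesis br_beta : forall i j a b, gr i a -> gr j b ->
  sg i *: br i j a b =
  beta (mu i j a b) - mu (i - 1) j (beta a) b - sg i *: mu i (j - 1) a (beta b).
Hypothesis br_mu : forall i j k a b c, gr i a -> gr j b -> gr k c ->
  br i (j + k) a (mu j k b c) = mu (i + j - 1) k (br i j a b) c
    + sg ((i - 1) * j) *: mu j (i + k - 1) b (br i k a c).
Hypothesis br_jacobi : forall i j k a b c, gr i a -> gr j b -> gr k c ->
  br (i + j - 1) k (br i j a b) c - br i (j + k - 1) a (br j k b c)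
    + sg ((i - 1) * (j - 1)) *: br j (i + k - 1) b (br i k a c) = 0.

Let gr_idx i i' a : i = i' -> gr i a -> gr i' a. Proof. by move->. Qed.

Section GradedLinear.
Variables (d : int) (f : E -> E).
Hypothesis gf : graded_map1 gr d f.
Lemma gr_lin0 : f 0 = 0.
Proof. by have := (gf 0).2 (-1) 0 0 (grS 0).1 (grS 0).1; rewrite !scaleN1r !addNr. Qed.
Lemma gr_linD i a b : gr i a -> gr i b -> f (a + b) = f a + f b.
Proof. by move=> ga gb; have := (gf i).2 1 a b ga gb; rewrite !scale1r. Qed.
Lemma gr_linZ i x a : gr i a -> f (x *: a) = x *: f a.
Proof.
by move=> ga; have := (gf i).2 x a 0 ga (grS i).1; rewrite gr_lin0 !addr0.
Qed.
Lemma gr_linN i a : gr i a -> f (- a) = - f a.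
Proof. by move=> ga; rewrite -!scaleN1r (gr_linZ _ ga). Qed.
End GradedLinear.

Section GradedBilinear.
Variables (d : int) (f : int -> int -> E -> E -> E).
Hypothesis gf : graded_map2 gr d f.
Lemma gr_bil0l i j b : gr j b -> f i j 0 b = 0.
Proof.
move=> gb; have [_ /(_ (-1) 0 0 b (grS i).1 (grS i).1 gb) + _] := gf i j.
by rewrite !scaleN1r !addNr.
Qed.
Lemma gr_bil0r i j a : gr i a -> f i j a 0 = 0.
Proof.
move=> ga; have [_ _ /(_ (-1) a 0 0 ga (grS j).1 (grS j).1)] := gf i j.
by rewrite !scaleN1r !addNr.
Qed.
Lemma gr_bilDl i j a a' b : gr i a -> gr i a' -> gr j b ->
  f i j (a + a') b = f i j a b + f i j a' b.
Proof.
by move=> ga ga' gb; have [_ /(_ 1 a a' b ga ga' gb) + _] := gf i j; rewrite !scale1r.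
Qed.
Lemma gr_bilDr i j a b b' : gr i a -> gr j b -> gr j b' ->
  f i j a (b + b') = f i j a b + f i j a b'.
Proof.
by move=> ga gb gb'; have [_ _ /(_ 1 a b b' ga gb gb')] := gf i j; rewrite !scale1r.
Qed.
Lemma gr_bilZl i j x a b : gr i a -> gr j b -> f i j (x *: a) b = x *: f i j a b.
Proof.
move=> ga gb; have [_ /(_ x a 0 b ga (grS i).1 gb) + _] := gf i j.
by rewrite gr_bil0l // !addr0.
Qed.
Lemma gr_bilZr i j x a b : gr i a -> gr j b -> f i j a (x *: b) = x *: f i j a b.
Proof.
move=> ga gb; have [_ _ /(_ x a b 0 ga gb (grS j).1)] := gf i j.
by rewrite gr_bil0r // !addr0.
Qed.
Lemma gr_bilNl i j a b : gr i a -> gr j b -> f i j (- a) b = - f i j a b.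
Proof. by move=> ga gb; rewrite -!scaleN1r gr_bilZl. Qed.
Lemma gr_bilNr i j a b : gr i a -> gr j b -> f i j a (- b) = - f i j a b.
Proof. by move=> ga gb; rewrite -!scaleN1r gr_bilZr. Qed.
End GradedBilinear.

Section GradedTrilinear.
Variables (d : int) (f : int -> int -> int -> E -> E -> E -> E).
Hypothesis gf : graded_map3 gr d f.
Lemma gr_triN1 i j k a b c : gr i a -> gr j b -> gr k c ->
  f i j k (- a) b c = - f i j k a b c.
Proof.
move=> ga gb gc; have [_ fP _ _] := gf i j k.
have f0 : f i j k 0 b c = 0.
  by have := fP (-1) 0 0 b c (grS i).1 (grS i).1 gb gc; rewrite !scaleN1r !addNr.
by have := fP (-1) a 0 b c ga (grS i).1 gb gc; rewrite f0 !addr0 !scaleN1r.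
Qed.
Lemma gr_triN2 i j k a b c : gr i a -> gr j b -> gr k c ->
  f i j k a (- b) c = - f i j k a b c.
Proof.
move=> ga gb gc; have [_ _ fP _] := gf i j k.
have f0 : f i j k a 0 c = 0.
  by have := fP (-1) a 0 0 c ga (grS j).1 (grS j).1 gc; rewrite !scaleN1r !addNr.
by have := fP (-1) a b 0 c ga gb (grS j).1 gc; rewrite f0 !addr0 !scaleN1r.
Qed.
Lemma gr_triN3 i j k a b c : gr i a -> gr j b -> gr k c ->
  f i j k a b (- c) = - f i j k a b c.
Proof.
move=> ga gb gc; have [_ _ _ fP] := gf i j k.
have f0 : f i j k a b 0 = 0.
  by have := fP (-1) a b 0 0 ga gb (grS k).1 (grS k).1; rewrite !scaleN1r !addNr.
by have := fP (-1) a b c 0 ga gb gc (grS k).1; rewrite f0 !addr0 !scaleN1r.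
Qed.
End GradedTrilinear.

Let grQ i a : gr i a -> gr (i + 1) (Q a). Proof. exact: (dQ.1 i).1. Qed.
Let grb i a : gr i a -> gr (i - 1) (beta a). Proof. exact: (dbeta.1 i).1. Qed.
Let grmu i j a b : gr i a -> gr j b -> gr (i + j) (mu i j a b).
Proof. by move=> ga gb; have [/(_ a b ga gb) + _ _] := gmu i j; rewrite addr0. Qed.
Let grbr i j a b : gr i a -> gr j b -> gr (i + j - 1) (br i j a b).
Proof. by move=> ga gb; have [/(_ a b ga gb) + _ _] := gbr i j. Qed.
Let grm i j a b : gr i a -> gr j b -> gr (i + j - 1) (m i j a b).
Proof. by move=> ga gb; have [/(_ a b ga gb) + _ _] := gm i j. Qed.
Let grn i j k a b c : gr i a -> gr j b -> gr k c -> gr (i + j + k - 1) (n i j k a b c).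
Proof. by move=> ga gb gc; have [/(_ a b c ga gb gc) + _ _ _] := gn i j k. Qed.

Let betaQ i a : gr i a -> beta (Q a) = - Q (beta a).
Proof. by move=> /Qbeta/eqP; rewrite addr_eq0 => /eqP->; rewrite opprK. Qed.

Definition comm_homotopy i j a b :=
  beta (m i j a b) + m (i - 1) j (beta a) b + sg i *: m i (j - 1) a (beta b).

(** The graded commutator of beta with [n]; the last term exchanges the factors in the product of
    [b] with the bracket of [a] and [c] left over by relation 6. *)
Definition assoc_homotopy i j k a b c :=
  beta (n i j k a b c) + n (i - 1) j k (beta a) b c + sg i *: n i (j - 1) k a (beta b) c
  + sg (i + j) *: n i j (k - 1) a b (beta c)
  - (sg (i + j) * sg (i * j)) *: m j (i + k - 1) b (br i k a c).

Lemma comm_homotopy_graded : graded_map2 gr (-2) comm_homotopy.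
Proof.
move=> i j; split.
- move=> a b ga gb; rewrite /comm_homotopy.
  apply: (subspaceD (grS _)); first apply: (subspaceD (grS _)).
  + by apply: gr_idx (grb (grm ga gb)); lia.
  + by apply: gr_idx (grm (grb ga) gb); lia.
  + by apply: (subspaceZ (grS _)); apply: gr_idx (grm ga (grb gb)); lia.
- move=> x a a' b ga ga' gb; rewrite /comm_homotopy.
  have [_ mP _] := gm i j; have [_ mP' _] := gm (i - 1) j; have [_ mP'' _] := gm i (j - 1).
  rewrite mP // ((dbeta.1 _).2 x _ _ (grm ga gb) (grm ga' gb)).
  rewrite ((dbeta.1 i).2 x _ _ ga ga') mP' ?mP'' //; try exact: grb.
  lin_identity K E.
move=> x a b b' ga gb gb'; rewrite /comm_homotopy.
have [_ _ mP] := gm i j; have [_ _ mP'] := gm (i - 1) j; have [_ _ mP''] := gm i (j - 1).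
rewrite mP // ((dbeta.1 _).2 x _ _ (grm ga gb) (grm ga gb')).
rewrite ((dbeta.1 j).2 x _ _ gb gb') mP' ?mP'' //; try exact: grb.
lin_identity K E.
Qed.

Lemma assoc_homotopy_graded : graded_map3 gr (-2) assoc_homotopy.
Proof.
move=> i j k; split.
- move=> a b c ga gb gc; rewrite /assoc_homotopy.
  apply: (subspaceB (grS _)); first apply: (subspaceD (grS _));
    first apply: (subspaceD (grS _)); first apply: (subspaceD (grS _)).
  + by apply: gr_idx (grb (grn ga gb gc)); lia.
  + by apply: gr_idx (grn (grb ga) gb gc); lia.
  + by apply: (subspaceZ (grS _)); apply: gr_idx (grn ga (grb gb) gc); lia.
  + by apply: (subspaceZ (grS _)); apply: gr_idx (grn ga gb (grb gc)); lia.
  + by apply: (subspaceZ (grS _)); apply: gr_idx (grm gb (grbr ga gc)); lia.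
- move=> x a a' b c ga ga' gb gc; rewrite /assoc_homotopy.
  have [_ nP _ _] := gn i j k; have [_ nP1 _ _] := gn (i - 1) j k.
  have [_ nP2 _ _] := gn i (j - 1) k; have [_ nP3 _ _] := gn i j (k - 1).
  have [_ bP _] := gbr i k; have [_ _ mP] := gm j (i + k - 1).
  rewrite nP // ((dbeta.1 _).2 x _ _ (grn ga gb gc) (grn ga' gb gc)).
  rewrite ((dbeta.1 i).2 x _ _ ga ga') bP // nP1 ?nP2 ?nP3 ?mP //;
    try exact: grb; try exact: grbr.
  lin_identity K E.
- move=> x a b b' c ga gb gb' gc; rewrite /assoc_homotopy.
  have [_ _ nP _] := gn i j k; have [_ _ nP1 _] := gn (i - 1) j k.
  have [_ _ nP2 _] := gn i (j - 1) k; have [_ _ nP3 _] := gn i j (k - 1).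
  have [_ mP _] := gm j (i + k - 1).
  rewrite nP // ((dbeta.1 _).2 x _ _ (grn ga gb gc) (grn ga gb' gc)).
  rewrite ((dbeta.1 j).2 x _ _ gb gb') nP1 ?nP2 ?nP3 ?mP //;
    try exact: grb; try exact: grbr.
  lin_identity K E.
move=> x a b c c' ga gb gc gc'; rewrite /assoc_homotopy.
have [_ _ _ nP] := gn i j k; have [_ _ _ nP1] := gn (i - 1) j k.
have [_ _ _ nP2] := gn i (j - 1) k; have [_ _ _ nP3] := gn i j (k - 1).
have [_ _ bP] := gbr i k; have [_ _ mP] := gm j (i + k - 1).
rewrite nP // ((dbeta.1 _).2 x _ _ (grn ga gb gc) (grn ga gb gc')).
rewrite ((dbeta.1 k).2 x _ _ gc gc') bP // nP1 ?nP2 ?nP3 ?mP //;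
  try exact: grb; try exact: grbr.
lin_identity K E.
Qed.

Let brE i j a b : gr i a -> gr j b ->
  br i j a b = sg i *: (beta (mu i j a b) - mu (i - 1) j (beta a) b)
    - mu i (j - 1) a (beta b).
Proof.
move=> ga gb; rewrite -[LHS]scale1r -(sg_sq K i) -scalerA br_beta // scalerBr.
by rewrite scalerA sg_sq scale1r.
Qed.

(* The bracket is the commutator of beta with mu, so its symmetry defect is the
   commutator of beta with the commutativity homotopy of mu. *)
Lemma br_symmetry i j a b : gr i a -> gr j b ->
  br i j a b + sg ((i - 1) * (j - 1)) *: br j i b a =
  sg (i - 1) *: (Q (comm_homotopy i j a b) - comm_homotopy (i + 1) j (Q a) b
    - sg i *: comm_homotopy i (j + 1) a (Q b)).
Proof.
move=> ga gb.
have ga1 := grb ga; have gb1 := grb gb; have gaQ := grQ ga; have gbQ := grQ gb.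
have gab : gr (i + j - 1) (m i j a b) := grm ga gb.
have gQab : gr (i + j) (m (i + 1) j (Q a) b) by apply: gr_idx (grm gaQ gb); lia.
have gaQb : gr (i + j) (m i (j + 1) a (Q b)) by apply: gr_idx (grm ga gbQ); lia.
have g1ab : gr (i + j - 1 - 1) (m (i - 1) j (beta a) b) by apply: gr_idx (grm ga1 gb); lia.
have ga1b : gr (i + j - 1 - 1) (m i (j - 1) a (beta b)) by apply: gr_idx (grm ga gb1); lia.
have gba : gr (i + j) (mu j i b a) by apply: gr_idx (grmu gb ga); lia.
have gQm : gr (i + j) (Q (m i j a b)) by apply: gr_idx (grQ gab); lia.
have C i' j' x y : gr i' x -> gr j' y -> mu i' j' x y = sg (i' * j') *: mu j' i' y x
    + (Q (m i' j' x y) + m (i' + 1) j' (Q x) y + sg i' *: m i' (j' + 1) x (Q y)).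
  by move=> gx gy; rewrite -mu_comm // addrC subrK.
(* Only the products from the first bracket are rewritten by [C]; their transposes then cancel
   against the second bracket. *)
rewrite !brE // (C i j) // (C (i - 1) j) // (C i (j - 1)) // !subrK.
rewrite !(gr_linD dbeta.1 (i := i + j)) //; try by
  repeat first [apply: (subspaceD (grS _)) | apply: (subspaceZ (grS _))].
rewrite (gr_linZ dbeta.1 _ gba) (gr_linZ dbeta.1 _ gaQb) (betaQ gab).
rewrite /comm_homotopy !(gr_linD dQ.1 (i := i + j - 1 - 1)) //; try by
  repeat first [apply: (subspaceD (grS _)) | apply: (subspaceZ (grS _)) | exact: grb].
rewrite (gr_linZ dQ.1 _ ga1b) !addrK (betaQ ga) (betaQ gb).
have gQ1a : gr i (Q (beta a)) by apply: gr_idx (grQ ga1); lia.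
have gQ1b : gr j (Q (beta b)) by apply: gr_idx (grQ gb1); lia.
rewrite (gr_bilNl gm gQ1a gb) (gr_bilNr gm ga gQ1b).
rewrite !sgS !sgP !mulrBl !mulrBr !mul1r !mulr1 !sgB sg1.
case: (sg_cases K i) => ->; case: (sg_cases K j) => ->.
all: by case: (sg_cases K (i * j)) => ->; lin_identity K E.
Qed.

(** Q anticommutes with beta and is a derivation of [mu], hence of the bracket built from both; the
    term with [m] in [assoc_homotopy] calls for this. *)
Lemma Q_br i j a b : gr i a -> gr j b ->
  Q (br i j a b) = br (i + 1) j (Q a) b - sg i *: br i (j + 1) a (Q b).
Proof.
move=> ga gb.
have ga1 := grb ga; have gb1 := grb gb; have gaQ := grQ ga; have gbQ := grQ gb.
have gab := grmu ga gb.
have gQab : gr (i + j + 1) (mu (i + 1) j (Q a) b) by apply: gr_idx (grmu gaQ gb); lia.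
have gaQb : gr (i + j + 1) (mu i (j + 1) a (Q b)) by apply: gr_idx (grmu ga gbQ); lia.
have g1ab : gr (i + j - 1) (mu (i - 1) j (beta a) b) by apply: gr_idx (grmu ga1 gb); lia.
have ga1b : gr (i + j - 1) (mu i (j - 1) a (beta b)) by apply: gr_idx (grmu ga gb1); lia.
have gbab : gr (i + j - 1) (beta (mu i j a b)) := grb gab.
have gN x l : gr l x -> gr l (- x) by exact: subspaceN.
have gQ1a : gr i (Q (beta a)) by apply: gr_idx (grQ ga1); lia.
have gQ1b : gr j (Q (beta b)) by apply: gr_idx (grQ gb1); lia.
have gsc : gr (i + j - 1) (beta (mu i j a b) - mu (i - 1) j (beta a) b).
  by apply: (subspaceD (grS _)) => //; apply: gN.
rewrite !brE // (gr_linD dQ.1 (i := i + j - 1)); first last.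
- exact: gN.
- exact: (subspaceZ (grS _)).
rewrite (gr_linZ dQ.1 _ gsc) (gr_linN dQ.1 ga1b).
rewrite (gr_linD dQ.1 gbab (gN _ _ g1ab)) (gr_linN dQ.1 g1ab).
rewrite -[Q (beta (mu _ _ _ _))]opprK -(betaQ gab) !Qmu //.
rewrite (gr_linD dbeta.1 gQab (subspaceZ (grS _) _ gaQb)) (gr_linZ dbeta.1 _ gaQb).
rewrite !(addrK, subrK) (betaQ ga) (betaQ gb) (gr_bilNl gmu gQ1a gb) (gr_bilNr gmu ga gQ1b).
rewrite !sgS !sgP; case: (sg_cases K i) => ->; lin_identity K E.
Qed.

(* The bracket with a fixed first argument is a derivation of mu, so the failure of
   the bracket to be a derivation in its first argument is the commutator of beta
   with the associator, up to the commutativity homotopy. *)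
Lemma br_derivation i j k a b c : gr i a -> gr j b -> gr k c ->
  br (i + j) k (mu i j a b) c - mu i (j + k - 1) a (br j k b c)
    - sg ((k - 1) * j) *: mu (i + k - 1) j (br i k a c) b =
  sg (i + j - 1) *: (Q (assoc_homotopy i j k a b c) - assoc_homotopy (i + 1) j k (Q a) b c
    - sg i *: assoc_homotopy i (j + 1) k a (Q b) c
    - sg (i + j) *: assoc_homotopy i j (k + 1) a b (Q c)).
Proof.
move=> ga gb gc.
have ga1 := grb ga; have gb1 := grb gb; have gc1 := grb gc.
have gaQ := grQ ga; have gbQ := grQ gb; have gcQ := grQ gc.
have gab := grmu ga gb; have gbc := grmu gb gc.
have gbrab : gr (i + j - 1) (br i j a b) := grbr ga gb.
have gbrbc : gr (j + k - 1) (br j k b c) := grbr gb gc.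
have g1ab : gr (i + j - 1) (mu (i - 1) j (beta a) b) by apply: gr_idx (grmu ga1 gb); lia.
have ga1b : gr (i + j - 1) (mu i (j - 1) a (beta b)) by apply: gr_idx (grmu ga gb1); lia.
have g1bc : gr (j + k - 1) (mu (j - 1) k (beta b) c) by apply: gr_idx (grmu gb1 gc); lia.
have gb1c : gr (j + k - 1) (mu j (k - 1) b (beta c)) by apply: gr_idx (grmu gb gc1); lia.
have gD l x y : gr l x -> gr l y -> gr l (x + y) by exact: subspaceD.
have gZ l z x : gr l x -> gr l (z *: x) by exact: subspaceZ.
have gN l x : gr l x -> gr l (- x) by exact: subspaceN.
have bmu i' j' x y : gr i' x -> gr j' y -> beta (mu i' j' x y) =
    sg i' *: br i' j' x y + mu (i' - 1) j' (beta x) y + sg i' *: mu i' (j' - 1) x (beta y).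
  by move=> gx gy; rewrite br_beta //; lin_identity K E.
pose As i' j' k' x y z := mu (i' + j') k' (mu i' j' x y) z - mu i' (j' + k') x (mu j' k' y z).
(* Relation 4 trades beta for brackets; by relation 6 the products of the bracket of [a] and [b]
   with [c] cancel, and the product of [b] with the bracket of [a] and [c] remains, in the order
   opposite to that of relation 7. *)
have As_beta : beta (As i j k a b c) - As (i - 1) j k (beta a) b c
    - sg i *: As i (j - 1) k a (beta b) c - sg (i + j) *: As i j (k - 1) a b (beta c) =
    sg (i + j) *: (br (i + j) k (mu i j a b) c - mu i (j + k - 1) a (br j k b c)
      - sg (i * j) *: mu j (i + k - 1) b (br i k a c)).
  rewrite /As (gr_linD dbeta.1 (grmu gab gc) (gN _ _ (gr_idx _ (grmu ga gbc)))); last by lia.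
  rewrite (gr_linN dbeta.1 (grmu ga gbc)) (bmu _ _ _ _ gab gc) (bmu _ _ _ _ ga gbc).
  rewrite (bmu _ _ _ _ ga gb) (bmu _ _ _ _ gb gc).
  rewrite !(gr_bilDl gmu _ _ gc) ?(gr_bilDr gmu ga) ?(gr_bilZl gmu _ _ gc) ?(gr_bilZr gmu _ ga);
    try by repeat first [apply: gD | apply: gZ].
  rewrite br_mu //.
  rewrite (_ : i - 1 + j = i + j - 1); last by lia.
  rewrite (_ : i + (j - 1) = i + j - 1); last by lia.
  rewrite (_ : j - 1 + k = j + k - 1); last by lia.
  rewrite (_ : j + (k - 1) = j + k - 1); last by lia.
  have -> : sg ((i - 1) * j) = sg (i * j) * sg j by rewrite mulrBl mul1r sgB.
  rewrite !sgD; case: (sg_cases K i) => ->; case: (sg_cases K j) => ->;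
    case: (sg_cases K (i * j)) => ->; lin_identity K E.
have gD' l x y := gD l x y; have gbrac : gr (i + k - 1) (br i k a c) := grbr ga gc.
(* Relation 2 restores the order, and its homotopy is the last term of [assoc_homotopy]. *)
have C := mu_comm gb gbrac.
have gn1 := grn ga gb gc.
have gn2 : gr (i + j + k) (n (i + 1) j k (Q a) b c) by apply: gr_idx (grn gaQ gb gc); lia.
have gn3 : gr (i + j + k) (n i (j + 1) k a (Q b) c) by apply: gr_idx (grn ga gbQ gc); lia.
have gn4 : gr (i + j + k) (n i j (k + 1) a b (Q c)) by apply: gr_idx (grn ga gb gcQ); lia.
have gn5 : gr (i + j + k - 2) (n (i - 1) j k (beta a) b c) by apply: gr_idx (grn ga1 gb gc); lia.
have gn6 : gr (i + j + k - 2) (n i (j - 1) k a (beta b) c) by apply: gr_idx (grn ga gb1 gc); lia.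
have gn7 : gr (i + j + k - 2) (n i j (k - 1) a b (beta c)) by apply: gr_idx (grn ga gb gc1); lia.
have gn8 : gr (i + j + k - 2) (beta (n i j k a b c)) by apply: gr_idx (grb gn1); lia.
have gm1 : gr (i + j + k - 2) (m j (i + k - 1) b (br i k a c)).
  by apply: gr_idx (grm gb gbrac); lia.
have gQn : gr (i + j + k) (Q (n i j k a b c)) by apply: gr_idx (grQ gn1); lia.
have gQ1a : gr i (Q (beta a)) by apply: gr_idx (grQ ga1); lia.
have gQ1b : gr j (Q (beta b)) by apply: gr_idx (grQ gb1); lia.
have gQ1c : gr k (Q (beta c)) by apply: gr_idx (grQ gc1); lia.
have gS2 : gr (i + j + k) (Q (n i j k a b c) + n (i + 1) j k (Q a) b c) by exact: gD.
have gS3 : gr (i + j + k) (Q (n i j k a b c) + n (i + 1) j k (Q a) b c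
    + sg i *: n i (j + 1) k a (Q b) c) by apply: gD => //; exact: gZ.
have gT1 := gD _ _ _ gn8 gn5; have gT2 := gD _ _ _ gT1 (gZ _ (sg i) _ gn6).
have gT3 := gD _ _ _ gT2 (gZ _ (sg (i + j)) _ gn7).
have gbrQac : gr (i + k - 1 + 1) (br (i + 1) k (Q a) c).
  by apply: gr_idx (grbr gaQ gc); lia.
have gbraQc : gr (i + k - 1 + 1) (br i (k + 1) a (Q c)).
  by apply: gr_idx (grbr ga gcQ); lia.
(* By relation 3 each associator is the commutator of Q with [n]; beta is then moved past Q. *)
move: As_beta; rewrite /As -!mu_assoc // /assoc_homotopy !(addrK, subrK).
rewrite (gr_linD dbeta.1 gS3 (gZ _ _ _ gn4)) (gr_linD dbeta.1 gS2 (gZ _ _ _ gn3)).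
rewrite (gr_linD dbeta.1 gQn gn2).
rewrite (gr_linZ dbeta.1 _ gn3) (gr_linZ dbeta.1 _ gn4) (betaQ gn1).
rewrite (betaQ ga) (betaQ gb) (betaQ gc).
rewrite (gr_triN1 gn gQ1a gb gc) (gr_triN2 gn ga gQ1b gc) (gr_triN3 gn ga gb gQ1c).
rewrite (gr_linD dQ.1 gT3 (gN _ _ (gZ _ _ _ gm1))) (gr_linN dQ.1 (gZ _ _ _ gm1)).
rewrite (gr_linD dQ.1 gT2 (gZ _ _ _ gn7)) (gr_linD dQ.1 gT1 (gZ _ _ _ gn6)).
rewrite (gr_linD dQ.1 gn8 gn5) (gr_linZ dQ.1 _ gn6) (gr_linZ dQ.1 _ gn7) (gr_linZ dQ.1 _ gm1).
rewrite (_ : i + 1 + k - 1 = i + k - 1 + 1); last by lia.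
rewrite (_ : i + (k + 1) - 1 = i + k - 1 + 1); last by lia.
move: C; rewrite Q_br // (gr_bilDr gm gb gbrQac (gN _ _ (gZ _ _ _ gbraQc))).
rewrite (gr_bilNr gm gb (gZ _ _ _ gbraQc)) (gr_bilZr gm _ gb gbraQc) => C.
move=> /(congr1 (fun x => sg (i + j) *: x)); rewrite scalerA sg_sq scale1r => H.
move/eqP: C; rewrite subr_eq => /eqP C.
rewrite -[LHS](subrK (sg (i * j) *: mu j (i + k - 1) b (br i k a c))).
rewrite [X in X + _ = _]addrAC -H C.
have -> : sg (j * (i + k - 1)) = sg (i * j) * sg (k * j) * sg j.
  by rewrite mulrC mulrBl mulrDl mul1r sgB sgD.
have -> : sg ((k - 1) * j) = sg (k * j) * sg j by rewrite mulrBl mul1r sgB.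
have -> : sg ((i + 1) * j) = sg (i * j) * sg j by rewrite mulrDl mul1r sgD.
have -> : sg (i * (j + 1)) = sg (i * j) * sg i by rewrite mulrDr mulr1 sgD.
rewrite !(sgD, sgB) sg1 sgN1.
case: (sg_cases K i) => ->; case: (sg_cases K j) => ->;
  case: (sg_cases K (i * j)) => ->; case: (sg_cases K (k * j)) => ->; lin_identity K E.
Qed.

Lemma homotopy_BV_criterion : homotopy_BV gr Q beta mu br m n.
Proof.
split; first exact: grS.
split; first by split.
exists comm_homotopy, assoc_homotopy; split.
- exact: comm_homotopy_graded.
- exact: assoc_homotopy_graded.
move=> i j k a b c ga gb gc; split.
- by split; [exact: Qmu|exact: mu_comm|exact: mu_assoc|exact: br_beta].
- exact: br_symmetry.
- exact: br_mu.
- exact: br_derivation.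
- exact: br_jacobi.
Qed.

End HomotopyBVCriterion.

Theorem theorem3p1 (R : realType)
  (V : lmodType R[i]) (Vn : nat -> set V) (Y : voa_formal Vn)
  (Lambda : lmodType R[i]) (G : ghost_vsa Lambda)
  (W : tensor_vsa Y G) :
  leading_parts_defined W /\
  homotopy_BV (F W) (Q W) (beta W) (mu0 W) (brk0 W) (m0 W) (n0 W).
Proof.
split; first exact: leading_parts.
apply: homotopy_BV_criterion.
- exact: F_subspace.
- split=> [i|i a]; last exact: Q_Q.
  by split=> [a|c a b _ _]; [exact: F_Q|exact: Q_linear].
- split=> [i|i a _]; last exact: beta_beta.
  by split=> [a|c a b _ _]; [exact: F_beta|exact: beta_linear].
- exact: mu0_graded.
- exact: brk0_graded.
- exact: m0_graded.
- exact: n0_graded.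
- exact: Q_beta.
- exact: mu0_Q.
- exact: mu0_comm.
- exact: mu0_assoc.
- exact: brk0_beta.
- exact: brk0_mu0.
- exact: brk0_jacobi.
Qed.
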